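(* Let $M$ be an expansion $0\to A^*\xrightarrow{\iota}B\xrightarrow{\nu}C^*\to0$ of a pure short exact sequence of Abelian structures expanded by $\Phi$, with $\Phi$ a fundamental system for $B$ (see context). Let $\Gamma\subseteq\Delta\subseteq M^{eq}$ with $\Gamma=\mathrm{dcl}^{eq}(\Gamma)$, $\Delta=\mathrm{dcl}^{eq}(\Delta)$, where $M$ is $|\Delta|^+$-saturated and strongly $|\Delta|^+$-homogeneous, and let $u$ be a finite tuple of $M$. Assume: (H1) for every $\phi\in\Phi$, each coset in $C/\phi(C)$ belonging to $\mathrm{acl}^{eq}(\Gamma)$ belongs to $\Gamma$; (H2) $\Delta=\mathrm{dcl}^{eq}(A^*(\Delta)\cup B(\Delta)\cup C^*(\Delta))$; (H3) $\Gamma=\mathrm{dcl}^{eq}(A^*(\Gamma)\cup B(\Gamma)\cup C^*(\Gamma))$, and for every $\phi\in\Phi$ and every coset $X\in C/\phi(C)$ belonging to $\Gamma$, there is $\beta\in B(\Gamma)$ with $\nu(\beta)\in X$. Let $U$ be the substructure of $M$ generated by $u$ and $A^*(\Gamma)\cup B(\Gamma)\cup C^*(\Gamma)$. Then $\mathrm{tp}(U/\Delta)$ does not fork over $\Gamma$ if and only if, in the reduct $A^*(M)$, $\mathrm{tp}(A^*(U)/A^*(\Delta))$ does not fork over $A^*(\Gamma)$ and, in the reduct $C^*(M)$, $\mathrm{tp}(C^*(U)/C^*(\Delta))$ does not fork over $C^*(\Gamma)$.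
   Context: Fix a multi-sorted language $\mathcal{L}$. p.p.-formulas are the formulas in the closure of parameter-free atomic formulas under finite conjunction and existential quantification. An Abelian structure is an $\mathcal{L}$-structure such that each sort expands an Abelian group, each parameter-free term is a group homomorphism, and each p.p.-formula $\phi(x_{s_1},\dots,x_{s_n})$ defines a subgroup of the product of the corresponding sorts. For an Abelian structure $A$, $A/\phi(A)$ denotes the quotient of that product by $\phi(A)$. A fundamental system for $B$ is a set $\Phi$ of p.p.-formulas such that, modulo the theory of $B$, every p.p.-formula is equivalent to a finite conjunction of formulas $\phi(t(x))$ with $\phi\in\Phi$ and $t$ a tuple of parameter-free terms. An embedding $\iota:A\to B$ is pure if $\iota^{-1}(\phi(B))=\phi(A)$ for every p.p.-formula $\phi$. A pure short exact sequence expanded by $\Phi$ consists of Abelian structures $A,B,C$ on disjoint copies of $\mathcal{L}$, a pure embedding $\iota:A\to B$, a surjective morphism $\nu:B\to C$ with $\mathrm{Im}(\iota)=\mathrm{Ker}(\nu)$ on each sort and $\nu^{-1}(\phi(C))=\phi(B)+\iota(A)$ for all p.p. $\phi$, and for each $\phi\in\Phi$ the sort $A/\phi(A)$, the quotient map $\pi_\phi:A\to A/\phi(A)$, and the map $\rho_\phi:B\to A/\phi(A)$ which is $0$ outside $\phi(B)+\iota(A)$ and on $\phi(B)+\iota(A)$ is the homomorphism $\phi(B)+\iota(A)\to(\phi(B)+\iota(A))/\phi(B)\simeq A/\phi(A)$. $A^*$ is an arbitrary expansion of $A$ together with the sorts $A/\phi(A)$ and maps $\pi_\phi$, in a language $\mathcal{L}_A$;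 $C^*$ is an arbitrary expansion of $C$, in a language $\mathcal{L}_C$. $M$ is the resulting expansion of the sequence (its language contains $\mathcal{L}_A$, the language of $B$, $\mathcal{L}_C$, $\iota$, $\nu$ and all $\rho_\phi$). For $D\subseteq M^{eq}$, $A^*(D),B(D),C^*(D)$ are the sets of elements of $D$ in the sorts of $A^*$ (including the sorts $A/\phi(A)$), $B$, $C^*$. $A^*(M)$ and $C^*(M)$ are regarded as an $\mathcal{L}_A$-structure and an $\mathcal{L}_C$-structure. A formula divides over $\Gamma$ if for some $\Gamma$-indiscernible sequence of conjugates of its parameters, starting with the original, the corresponding formulas are jointly inconsistent; it forks over $\Gamma$ if it implies a finite disjunction of formulas dividing over $\Gamma$; a type forks over $\Gamma$ if it implies a formula that does. *)

(* Defs.v *)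
From Stdlib Require Import RelationClasses.
From HB Require Import structures.
From mathcomp Require Import all_boot all_order all_algebra.
From mathcomp Require Import boolp classical_sets functions cardinality.

Set Implicit Arguments.
Unset Strict Implicit.
Unset Printing Implicit Defensive.

Import GRing.Theory.
Local Open Scope classical_set_scope.
Local Open Scope card_scope.
Local Open Scope ring_scope.

Record lang := Lang {
  lsort : Type;
  fsym : Type;
  far : fsym -> nat;
  fdom : forall f, 'I_(far f) -> lsort;
  fcod : fsym -> lsort;
  rsym : Type;
  rar : rsym -> nat;
  rdom : forall r, 'I_(rar r) -> lsort }.

Record str (L : lang) := Str {
  car :> lsort L -> Type;
  sfun : forall f : fsym L, (forall i, car (fdom (f := f) i)) -> car (fcod f);
  srel : forall r : rsym L, (forall i, car (rdom (r := r) i)) -> Prop }.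

(* Terms and formulas are intrinsically sorted and scoped: their free variables
   range over an arbitrary type [V], the variable [v] having lsort [vs v].
   A quantifier adds the variable [None]. *)
Definition vcons (S V : Type) (s : S) (vs : V -> S) : option V -> S :=
  fun o => if o is Some v then vs v else s.

Definition vjoin (S V W : Type) (vs : V -> S) (ws : W -> S) : V + W -> S :=
  fun x => match x with inl v => vs v | inr w => ws w end.

Inductive term (L : lang) (V : Type) (vs : V -> lsort L) : lsort L -> Type :=
| tvar v : term vs (vs v)
| tapp (f : fsym L) :
    (forall i, term vs (fdom (f := f) i)) -> term vs (fcod f).

Inductive formula (L : lang) (V : Type) (vs : V -> lsort L) : Type :=
| ftrue
| feq s of term vs s & term vs s
| frel (r : rsym L) of (forall i, term vs (rdom (r := r) i))
| fnot of formula vs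
| fand of formula vs & formula vs
| fex s of formula (vcons s vs).

Section Semantics.
Variables (L : lang) (N : str L).

Definition econs V (vs : V -> lsort L) s (a : N s) (e : forall v, N (vs v)) :
    forall o, N (vcons s vs o) :=
  fun o => match o with Some v => e v | None => a end.

Definition ejoin V W (vs : V -> lsort L) (ws : W -> lsort L)
    (e : forall v, N (vs v)) (d : forall w, N (ws w)) :
    forall x, N (vjoin vs ws x) :=
  fun x => match x with inl v => e v | inr w => d w end.

Fixpoint eval V (vs : V -> lsort L) s (t : term vs s)
    (e : forall v, N (vs v)) : N s :=
  match t with
  | tvar v => e v
  | tapp f a => sfun (fun i => eval (a i) e)
  end.

Fixpoint sat V (vs : V -> lsort L) (p : formula vs) :
    (forall v, N (vs v)) -> Prop :=
  match p with
  | ftrue => fun=> True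
  | feq s t u => fun e => eval t e = eval u e
  | frel r a => fun e => srel (fun i => eval (a i) e)
  | fnot q => fun e => ~ sat q e
  | fand q r => fun e => sat q e /\ sat r e
  | fex s q => fun e => exists a : N s, sat q (econs a e)
  end.

Definition elt := {s : lsort L & N s}.
Definition Elt s (a : N s) : elt := existT _ s a.

End Semantics.
Arguments Elt {L N s} a.

Fixpoint is_pp (L : lang) V (vs : V -> lsort L) (p : formula vs) : bool :=
  match p with
  | ftrue | feq _ _ _ | frel _ _ => true
  | fnot _ => false
  | fand q r => is_pp q && is_pp r
  | fex _ q => is_pp q
  end.

Section Maps.
Variables (L : lang) (N N' : str L) (h : forall s, N s -> N' s).

Definition is_hom :=
  (forall (f : fsym L) x, h (@sfun L N f x) = @sfun L N' f (fun i => h (x i))) /\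
  (forall (r : rsym L) x, @srel L N r x -> @srel L N' r (fun i => h (x i))).

Definition is_embedding :=
  [/\ is_hom, forall s, injective (@h s) &
      forall (r : rsym L) x, @srel L N' r (fun i => h (x i)) -> @srel L N r x].

End Maps.

Inductive generated (L : lang) (N : str L) (X : set (elt N)) : set (elt N) :=
| gen_base x of X x : generated X x
| gen_fun (f : fsym L) (a : forall i, N (fdom (f := f) i)) of
    (forall i, generated X (Elt (a i))) : generated X (Elt (sfun a)).

(* The structure N plays the role of the monster model: parameters, and
   realisations of formulas, are taken in N. *)

Record pform (L : lang) (N : str L) (V : Type) (vs : V -> lsort L) := PForm {
  pf_n : nat;
  pf_s : 'I_pf_n -> lsort L;
  pf_fm : formula (vjoin vs pf_s);
  pf_par : forall i, N (pf_s i) }.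
Arguments PForm {L N V vs pf_n pf_s} pf_fm pf_par.
Arguments pf_par {L N V vs} p i : rename.

Section Forking.
Variables (L : lang) (N : str L).

Definition psat V (vs : V -> lsort L) (p : pform N vs) (v : forall x, N (vs x)) :=
  sat (pf_fm p) (ejoin v (pf_par p)).

Definition params_in (D : set (elt N)) V (vs : V -> lsort L) (p : pform N vs) :=
  forall i, D (Elt (pf_par p i)).

(* By compactness, this is consistency with the elementary diagram of N. *)
Definition consistent V (vs : V -> lsort L) (P : set (pform N vs)) :=
  forall n (p : 'I_n -> pform N vs), (forall k, P (p k)) ->
    exists v, forall k, psat (p k) v.

Definition implies V (vs : V -> lsort L) (P : set (pform N vs)) (q : pform N vs) :=
  exists n (p : 'I_n -> pform N vs), (forall k, P (p k)) /\
    forall v, (forall k, psat (p k) v) -> psat q v.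

(* tp(X/D), the elements of X being enumerated by themselves. *)
Definition tp_ctx (X : set (elt N)) : {x : elt N | X x} -> lsort L :=
  fun x => projT1 (sval x).

Definition tp (X D : set (elt N)) : set (pform N (tp_ctx (X := X))) :=
  [set p | params_in D p /\ psat p (fun x => projT2 (sval x))].

Definition indiscernible (G : set (elt N)) m (s : 'I_m -> lsort L)
    (b : nat -> forall i, N (s i)) :=
  forall n (p : pform N (fun ij : 'I_n * 'I_m => s ij.2)), params_in G p ->
  forall a a' : 'I_n -> nat,
    (forall i j : 'I_n, (i < j)%N -> (a i < a j)%N) ->
    (forall i j : 'I_n, (i < j)%N -> (a' i < a' j)%N) ->
    psat p (fun ij => b (a ij.1) ij.2) <-> psat p (fun ij => b (a' ij.1) ij.2).

(* That the b k are conjugates of the original parameters over G (i.e. have the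
   same type over G) is the case n = 1 of indiscernibility. *)
Definition divides (G : set (elt N)) V (vs : V -> lsort L) (p : pform N vs) :=
  exists b : nat -> forall i, N (pf_s (p := p) i),
    [/\ b 0%N = pf_par p, indiscernible G b &
        ~ consistent [set q | exists k, q = PForm (pf_fm p) (b k)]].

Definition forks (G : set (elt N)) V (vs : V -> lsort L) (p : pform N vs) :=
  exists n (q : 'I_n -> pform N vs), (forall k, divides G (q k)) /\
    forall v, psat p v -> exists k, psat (q k) v.

Definition type_forks (G : set (elt N)) V (vs : V -> lsort L)
    (P : set (pform N vs)) :=
  exists q, implies P q /\ forks G q.

Definition ctx1 (s : lsort L) : unit -> lsort L := fun=> s.

Definition dcl (D : set (elt N)) : set (elt N) :=
  [set x | exists p : pform N (ctx1 (projT1 x)), params_in D p /\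
     forall y : N (projT1 x), psat p (fun=> y) <-> y = projT2 x].

Definition acl (D : set (elt N)) : set (elt N) :=
  [set x | exists p : pform N (ctx1 (projT1 x)),
     [/\ params_in D p, psat p (fun=> projT2 x) &
         finite_set [set y : N (projT1 x) | psat p (fun=> y)]]].

(* K^+-saturation and strong K^+-homogeneity, K being the cardinal of D. *)
Definition saturated_succ T (D : set T) :=
  forall (Q : set (elt N)), Q #<= D ->
  forall (s : lsort L) (P : set (pform N (ctx1 s))),
    (forall p, P p -> params_in Q p) -> consistent P ->
    exists y : N s, forall p, P p -> psat p (fun=> y).

Definition automorphism (h : forall s, N s -> N s) :=
  is_embedding h /\ forall s (y : N s), exists x, h s x = y.

Definition strongly_homogeneous_succ T (D : set T) :=
  forall (Q : set (elt N)), Q #<= D ->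
  forall f : (forall x : elt N, N (projT1 x)),
    (forall n (x : 'I_n -> elt N), (forall i, Q (x i)) ->
       forall p : formula (fun i => projT1 (x i)),
         sat p (fun i => projT2 (x i)) <-> sat p (fun i => f (x i))) ->
    exists h, automorphism h /\
      forall x, Q x -> h (projT1 x) (projT2 x) = f x.

End Forking.
Arguments tp {L N} X D _.
Arguments saturated_succ {L} N {T} D.
Arguments strongly_homogeneous_succ {L} N {T} D.

Definition quot T (R : T -> T -> Prop) := {c : set T | exists x, c = R x}.
Definition cls T (R : T -> T -> Prop) (x : T) : quot R :=
  exist _ (R x) (ex_intro _ x erefl).

Record eqsort (L : lang) (N : str L) := EqSort {
  eq_n : nat;
  eq_s : 'I_eq_n -> lsort L;
  eq_fm : formula (vjoin eq_s eq_s);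
  eq_equiv : Equivalence (fun x y : forall i, N (eq_s i) =>
                            sat eq_fm (ejoin x y)) }.

Definition eq_rel (L : lang) (N : str L) (E : eqsort N)
    (x y : forall i, N (eq_s (e := E) i)) := sat (eq_fm E) (ejoin x y).

Definition eqlang (L : lang) (N : str L) : lang := {|
  lsort := lsort L + eqsort N;
  fsym := fsym L + eqsort N;
  far f := match f with inl f => far f | inr E => eq_n E end;
  fdom f := match f return 'I_(match f with inl f => far f | inr E => eq_n E end)
                           -> lsort L + eqsort N with
            | inl f => fun i => inl (fdom i)
            | inr E => fun i => inl (eq_s i) end;
  fcod f := match f with inl f => inl (fcod f) | inr E => inr E end;
  rsym := rsym L;
  rar := @rar L;
  rdom r i := inl (rdom i) |}.

Definition eqcar (L : lang) (N : str L) (s : lsort (eqlang N)) : Type :=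
  match s with inl s => N s | inr E => quot (@eq_rel L N E) end.

Definition eqstr (L : lang) (N : str L) : str (eqlang N) := {|
  car := @eqcar L N;
  sfun f := match f return
      (forall i, eqcar (fdom (l := eqlang N) (f := f) i)) ->
      eqcar (fcod (l := eqlang N) f) with
    | inl f => fun x => sfun (s := N) x
    | inr E => fun x => cls (@eq_rel L N E) x end;
  srel r x := srel (s := N) (r := r) x |}.

Definition home (L : lang) (N : str L) (x : elt N) : elt (eqstr N) :=
  @Elt _ (eqstr N) (inl (projT1 x)) (projT2 x).

(* Expansions may add sorts as well as function and relation symbols. *)
Record lext (L : lang) := LExt {
  xsort : Type;
  xfsym : Type;
  xfar : xfsym -> nat;
  xfdom : forall f, 'I_(xfar f) -> lsort L + xsort;
  xfcod : xfsym -> lsort L + xsort;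
  xrsym : Type;
  xrar : xrsym -> nat;
  xrdom : forall r, 'I_(xrar r) -> lsort L + xsort }.

Definition xlang (L : lang) (E : lext L) : lang := {|
  lsort := lsort L + xsort E;
  fsym := fsym L + xfsym E;
  far f := match f with inl f => far f | inr f => xfar f end;
  fdom f := match f return 'I_(match f with inl f => far f | inr f => xfar f end)
                           -> lsort L + xsort E with
            | inl f => fun i => inl (fdom i)
            | inr f => fun i => xfdom i end;
  fcod f := match f with inl f => inl (fcod f) | inr f => xfcod f end;
  rsym := rsym L + xrsym E;
  rar r := match r with inl r => rar r | inr r => xrar r end;
  rdom r := match r return 'I_(match r with inl r => rar r | inr r => xrar r end)
                           -> lsort L + xsort E with
            | inl r => fun i => inl (rdom i)
            | inr r => fun i => xrdom i end |}.

Definition xcarrier (L : lang) (N : str L) (S : Type) (X : S -> Type)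
    (s : lsort L + S) : Type :=
  match s with inl s => N s | inr s => X s end.

Record expansion (L : lang) (N : str L) := Expansion {
  x_ext : lext L;
  x_car : xsort x_ext -> Type;
  x_fun : forall f : xfsym x_ext,
    (forall i, xcarrier N x_car (xfdom (f := f) i)) ->
    xcarrier N x_car (xfcod f);
  x_rel : forall r : xrsym x_ext,
    (forall i, xcarrier N x_car (xrdom (r := r) i)) -> Prop }.

Definition xstr_car (L : lang) (N : str L) (X : expansion N)
    (s : lsort (xlang (x_ext X))) : Type := xcarrier N (@x_car L N X) s.

Definition xstr (L : lang) (N : str L) (X : expansion N) :
    str (xlang (x_ext X)) := {|
  car := @xstr_car L N X;
  sfun f := match f return
      (forall i, xstr_car (fdom (l := xlang (x_ext X)) (f := f) i)) ->
      xstr_car (fcod (l := xlang (x_ext X)) f) with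
    | inl f => fun x => sfun (s := N) x
    | inr f => fun x => x_fun x end;
  srel r := match r return
      (forall i, xstr_car (rdom (l := xlang (x_ext X)) (r := r) i)) -> Prop with
    | inl r => fun x => srel (s := N) x
    | inr r => fun x => x_rel x end |}.

(* [L] lists the symbols other than the group operations of the sorts; the
   actual language is [ablang L]. *)
Inductive ab_fsym (L : lang) : Type :=
| gzero of lsort L | gopp of lsort L | gadd of lsort L | gother of fsym L.
Arguments gzero {L}. Arguments gopp {L}. Arguments gadd {L}.
Arguments gother {L}.

Definition ab_far (L : lang) (f : ab_fsym L) : nat :=
  match f with gzero _ => 0 | gopp _ => 1 | gadd _ => 2 | gother f => far f end.

Definition ablang (L : lang) : lang := {|
  lsort := lsort L;
  fsym := ab_fsym L;
  far := @ab_far L;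
  fdom f := match f return 'I_(ab_far f) -> lsort L with
            | gzero s | gopp s | gadd s => fun=> s
            | gother f => fun i => fdom i end;
  fcod f := match f with gzero s | gopp s | gadd s => s | gother f => fcod f end;
  rsym := rsym L;
  rar := @rar L;
  rdom := @rdom L |}.

Record abdata (L : lang) := AbData {
  ab_car : lsort L -> zmodType;
  ab_fun : forall f : fsym L,
    (forall i, ab_car (fdom (f := f) i)) -> ab_car (fcod f);
  ab_rel : forall r : rsym L, (forall i, ab_car (rdom (r := r) i)) -> Prop }.

Definition abstr_fun (L : lang) (A : abdata L) (f : fsym (ablang L)) :
    (forall i, ab_car A (@fdom (ablang L) f i)) -> ab_car A (@fcod (ablang L) f) :=
  match f with
  | gzero s => fun=> 0
  | gopp s => fun x => - x ord0
  | gadd s => fun x => x ord0 + x ord_max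
  | gother f => fun x => @ab_fun L A f x
  end.

Definition abstr (L : lang) (A : abdata L) : str (ablang L) :=
  @Str (ablang L) (fun s => ab_car A s) (@abstr_fun L A) (@ab_rel L A).

Record ppform (L : lang) := PPForm {
  pp_n : nat;
  pp_s : 'I_pp_n -> lsort L;
  pp_fm : @formula (ablang L) 'I_pp_n pp_s;
  pp_pp : is_pp pp_fm }.

Definition ppsat (L : lang) (A : abdata L) (p : ppform L)
    (x : forall i, ab_car A (pp_s (p := p) i)) : Prop :=
  @sat (ablang L) (abstr A) _ _ (pp_fm p) x.

Record abelian (L : lang) := Abelian {
  ab_data :> abdata L;
  ab_term : forall n (s : 'I_n -> lsort L) s0 (t : @term (ablang L) 'I_n s s0)
    (x y : forall i, ab_car ab_data (s i)),
    @eval _ (abstr ab_data) _ _ _ t (fun i => x i + y i) =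
    @eval _ (abstr ab_data) _ _ _ t x + @eval _ (abstr ab_data) _ _ _ t y;
  ab_pp0 : forall p : ppform L, ppsat (A := ab_data) (p := p) (fun=> 0);
  ab_ppB : forall (p : ppform L) x y,
    ppsat (A := ab_data) (p := p) x -> ppsat y ->
    ppsat (A := ab_data) (p := p) (fun i => x i - y i) }.

Definition fundamental_system (L : lang) (B : abelian L) (Phi : set (ppform L)) :=
  forall psi : ppform L,
  exists (k : nat) (phi : 'I_k -> ppform L)
    (t : forall j (i : 'I_(pp_n (phi j))),
         @term (ablang L) _ (pp_s (p := psi)) (pp_s i)),
    (forall j, Phi (phi j)) /\
    forall x, ppsat (A := B) (p := psi) x <->
      forall j, ppsat (A := B) (p := phi j)
                  (fun i => @eval _ (abstr B) _ _ _ (t j i) x).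

Definition ppmod (L : lang) (A : abdata L) (p : ppform L)
    (x y : forall i, ab_car A (pp_s (p := p) i)) : Prop :=
  ppsat (fun i => y i - x i).

Definition ppquot (L : lang) (A : abdata L) (p : ppform L) := quot (@ppmod L A p).

Definition idx (L : lang) (Phi : set (ppform L)) := {p : ppform L | Phi p}.

(* The language of A, the sorts A / phi(A) and the maps pi_phi. *)
Definition quot_ext (L : lang) (Phi : set (ppform L)) : lext (ablang L) :=
  @LExt (ablang L) (idx Phi) (idx Phi)
    (fun p => pp_n (sval p))
    (fun p i => inl (@pp_s L (sval p) i))
    (fun p => inr p)
    void (fun=> 0%N) (fun r => match r with end).

Definition quot_expansion (L : lang) (A : abelian L) (Phi : set (ppform L)) :
    expansion (abstr A) :=
  @Expansion (ablang L) (abstr A) (quot_ext Phi)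
    (fun p => ppquot A (sval p))
    (fun p x => cls (@ppmod L A (sval p)) x)
    (fun r => match r with end).

Section Sequence.
Variables (L : lang) (A B C : abelian L).
Variables (iota : forall s, ab_car A s -> ab_car B s).
Variables (nu : forall s, ab_car B s -> ab_car C s).

Definition pp_plus_im (p : ppform L) (y : forall i, ab_car B (pp_s (p := p) i)) :=
  exists b a, ppsat b /\ y = (fun i => b i + iota (a i)).

Record pure_exact : Prop := PureExact {
  pe_iota_emb : @is_embedding (ablang L) (abstr A) (abstr B) iota;
  pe_iota_pure : forall (p : ppform L) x,
    ppsat (A := B) (p := p) (fun i => iota (x i)) <-> ppsat (A := A) (p := p) x;
  pe_nu_hom : @is_hom (ablang L) (abstr B) (abstr C) nu;
  pe_nu_surj : forall s (c : ab_car C s), exists b, nu b = c;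
  pe_exact : forall s (b : ab_car B s), nu b = 0 <-> exists a, b = iota a;
  pe_nu_pp : forall (p : ppform L) y,
    ppsat (A := C) (p := p) (fun i => nu (y i)) <-> pp_plus_im y }.

(* On phi(B) + iota(A), the inverse of A/phi(A) ~ (phi(B)+iota(A))/phi(B) sends
   the class of y to the class of any a such that y - iota(a) is in phi(B). *)
Definition rho (p : ppform L) (y : forall i, ab_car B (pp_s (p := p) i)) :
    ppquot A p :=
  match pselect (exists a : forall i, ab_car A (pp_s (p := p) i),
                   ppsat (A := B) (p := p) (fun i => y i - iota (a i))) with
  | left h => cls (@ppmod L A p) (projT1 (cid h))
  | right _ => cls (@ppmod L A p) (fun=> 0)
  end.

Lemma rho_in (E : pure_exact) (p : ppform L) b a :
  ppsat b -> rho (fun i => b i + iota (a i)) = cls (@ppmod L A p) a.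
Proof.
move=> hb; rewrite /rho; case: pselect => [h|]; last first.
  case; exists a; move: hb; congr ppsat.
  by apply: functional_extensionality_dep => i; rewrite addrK.
case: (cid h) => a' ha' /=.
have [[hf _] _ _] := pe_iota_emb E.
have iotaD s (x y : ab_car A s) : iota (x + y) = iota x + iota y.
  exact: (hf (gadd s) (fun i : 'I_2 => if i == ord0 then x else y)).
have iotaN s (x : ab_car A s) : iota (- x) = - iota x.
  exact: (hf (gopp s) (fun i : 'I_1 => x)).
have K : @ppsat L A p (fun i => a i - a' i).
  apply/(pe_iota_pure E); have := ab_ppB ha' hb; congr ppsat.
  apply: functional_extensionality_dep => i.
  by rewrite iotaD iotaN addrC addrA addrA addNr add0r.
apply: eq_exist; apply/funext => y; apply/propext; rewrite /ppmod; split => H.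
  move: (ab_ppB H K); congr ppsat; apply: functional_extensionality_dep => i.
  by rewrite opprB addrA subrK.
have N := ab_ppB (@ab_pp0 L A p) K.
move: (ab_ppB H N); congr ppsat; apply: functional_extensionality_dep => i.
by rewrite sub0r opprK addrA subrK.
Qed.

Lemma rho_out (p : ppform L) (y : forall i, ab_car B (pp_s (p := p) i)) :
  ~ pp_plus_im y -> rho y = cls (@ppmod L A p) (fun=> 0).
Proof.
move=> h; rewrite /rho; case: pselect => // -[a ha]; case: h.
exists (fun i => y i - iota (a i)), a; split => //.
by apply: functional_extensionality_dep => i; rewrite subrK.
Qed.

Variable Phi : set (ppform L).

Inductive sum3 (SA SB SC : Type) : Type :=
| MA of SA | MB of SB | MC of SC.

Inductive seq_fsym (FA FB FC : Type) : Type :=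
| MfA of FA | MfB of FB | MfC of FC
| Miota of lsort L | Mnu of lsort L | Mrho of idx Phi.

Variables (EA : lext (xlang (quot_ext Phi))) (EC : lext (ablang L)).

Notation LA := (xlang EA).
Notation LB := (ablang L).
Notation LC := (xlang EC).
Notation Msort := (sum3 (lsort LA) (lsort LB) (lsort LC)).
Notation Mfsym := (seq_fsym (fsym LA) (fsym LB) (fsym LC)).

Definition seq_far (f : Mfsym) : nat :=
  match f with
  | MfA f => far f | MfB f => far f | MfC f => far f
  | Miota _ | Mnu _ => 1
  | Mrho p => pp_n (sval p)
  end.

Definition seq_fdom (f : Mfsym) : 'I_(seq_far f) -> Msort :=
  match f with
  | MfA f => fun i => MA _ _ (fdom i)
  | MfB f => fun i => MB _ _ (fdom i)
  | MfC f => fun i => MC _ _ (fdom i)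
  | Miota s => fun=> MA _ _ (inl (inl s))
  | Mnu s => fun=> MB _ _ s
  | Mrho p => fun i => MB _ _ (pp_s i)
  end.

Definition seq_fcod (f : Mfsym) : Msort :=
  match f with
  | MfA f => MA _ _ (fcod f)
  | MfB f => MB _ _ (fcod f)
  | MfC f => MC _ _ (fcod f)
  | Miota s => MB _ _ s
  | Mnu s => MC _ _ (inl s)
  | Mrho p => MA _ _ (inl (inr p))
  end.

Notation Mrsym := (sum3 (rsym LA) (rsym LB) (rsym LC)).

Definition seq_rar (r : Mrsym) : nat :=
  match r with MA r => rar r | MB r => rar r | MC r => rar r end.

Definition seq_rdom (r : Mrsym) : 'I_(seq_rar r) -> Msort :=
  match r with
  | MA r => fun i => MA _ _ (rdom i)
  | MB r => fun i => MB _ _ (rdom i)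
  | MC r => fun i => MC _ _ (rdom i)
  end.

Definition seq_lang : lang := {|
  lsort := Msort; fsym := Mfsym; far := seq_far; fdom := seq_fdom;
  fcod := seq_fcod; rsym := Mrsym; rar := seq_rar; rdom := seq_rdom |}.

End Sequence.

Section SequenceStructure.
Variables (L : lang) (A B C : abelian L).
Variables (iota : forall s, ab_car A s -> ab_car B s).
Variables (nu : forall s, ab_car B s -> ab_car C s).
Variables (Phi : set (ppform L)).
Variables (As : expansion (xstr (quot_expansion A Phi))).
Variables (Cs : expansion (abstr C)).

Definition Mlang : lang := @seq_lang L Phi (x_ext As) (x_ext Cs).

Definition Mcar (s : lsort Mlang) : Type :=
  match s with MA s => xstr As s | MB s => abstr B s | MC s => xstr Cs s end.

Definition Mstr : str Mlang := {|
  car := Mcar;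
  sfun f := match f return (forall i, Mcar (fdom (l := Mlang) (f := f) i)) ->
                           Mcar (fcod (l := Mlang) f) with
    | MfA f => fun x => sfun (s := xstr As) x
    | MfB f => fun x => sfun (s := abstr B) x
    | MfC f => fun x => sfun (s := xstr Cs) x
    | Miota s => fun x => iota (x ord0)
    | Mnu s => fun x => nu (x ord0)
    | Mrho p => fun x => rho iota x end;
  srel r := match r return (forall i, Mcar (rdom (l := Mlang) (r := r) i)) -> Prop with
    | MA r => fun x => srel (s := xstr As) x
    | MB r => fun x => srel (s := abstr B) x
    | MC r => fun x => srel (s := xstr Cs) x end |}.

Definition inA (x : elt (xstr As)) : elt Mstr :=
  @Elt _ Mstr (MA _ _ (projT1 x)) (projT2 x).
Definition inB (x : elt (abstr B)) : elt Mstr :=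
  @Elt _ Mstr (MB _ _ (projT1 x)) (projT2 x).
Definition inC (x : elt (xstr Cs)) : elt Mstr :=
  @Elt _ Mstr (MC _ _ (projT1 x)) (projT2 x).

(* A*(D), B(D), C*(D), for D a subset of M^eq. *)
Definition Apart (D : set (elt (eqstr Mstr))) : set (elt (xstr As)) :=
  [set x | D (home (inA x))].
Definition Bpart (D : set (elt (eqstr Mstr))) : set (elt (abstr B)) :=
  [set x | D (home (inB x))].
Definition Cpart (D : set (elt (eqstr Mstr))) : set (elt (xstr Cs)) :=
  [set x | D (home (inC x))].

Definition parts (D : set (elt (eqstr Mstr))) : set (elt Mstr) :=
  inA @` Apart D `|` inB @` Bpart D `|` inC @` Cpart D.

(* [formC] translates formulas of the language of C into the language of M,
   substituting the terms [sg v] for the free variables [v]; it is used to see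
   the cosets of C/phi(C) as elements of a sort of M^eq. *)

Fixpoint tweak V (ws : V -> lsort Mlang) s0 s (t : term ws s) :
    term (vcons s0 ws) s :=
  match t with
  | tvar v => @tvar Mlang _ (vcons s0 ws) (Some v)
  | tapp f a => tapp (fun i => tweak s0 (a i))
  end.

Definition sortC (s : lsort L) : lsort Mlang := MC _ _ (inl s).

Fixpoint termC V (vs : V -> lsort (ablang L)) W (ws : W -> lsort Mlang)
    (sg : forall v, term ws (sortC (vs v))) s (t : term vs s) :
    term ws (sortC s) :=
  match t in term _ s return term ws (sortC s) with
  | tvar v => sg v
  | tapp f a => @tapp Mlang _ ws (MfC _ _ _ (inl f)) (fun i => termC sg (a i))
  end.

Definition liftC V (vs : V -> lsort (ablang L)) W (ws : W -> lsort Mlang)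
    (sg : forall v, term ws (sortC (vs v))) s0 :
    forall o, term (vcons (sortC s0) ws) (sortC (vcons s0 vs o)) :=
  fun o => match o with
  | Some v => tweak (sortC s0) (sg v)
  | None => @tvar Mlang _ (vcons (sortC s0) ws) None
  end.

Fixpoint formC V (vs : V -> lsort (ablang L)) (p : formula vs) :
    forall W (ws : W -> lsort Mlang),
    (forall v, term ws (sortC (vs v))) -> formula ws :=
  match p with
  | ftrue => fun W ws sg => ftrue ws
  | feq s t u => fun W ws sg => feq (termC sg t) (termC sg u)
  | frel r a => fun W ws sg =>
      @frel Mlang _ ws (MC _ _ (inl r)) (fun i => termC sg (a i))
  | fnot q => fun W ws sg => fnot (formC q sg)
  | fand q r => fun W ws sg => fand (formC q sg) (formC r sg)
  | fex s q => fun W ws sg => fex (formC q (@liftC V vs W ws sg s))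
  end.

Lemma eval_tweak V (ws : V -> lsort Mlang) s0 s (t : term ws s)
    (e : forall v, Mstr (ws v)) (a : Mstr s0) :
  eval (tweak s0 t) (econs a e) = eval t e.
Proof.
elim: t => //= f args IH; congr (@sfun _ Mstr f _).
by apply: functional_extensionality_dep => i; apply: IH.
Qed.

Lemma eval_termC V (vs : V -> lsort (ablang L)) W (ws : W -> lsort Mlang)
    (sg : forall v, term ws (sortC (vs v))) s (t : term vs s)
    (e : forall w, Mstr (ws w)) :
  eval (termC sg t) e = @eval _ (abstr C) _ vs s t (fun v => eval (sg v) e).
Proof.
elim: t => //= f args IH; congr (@sfun _ (abstr C) f _).
by apply: functional_extensionality_dep => i; apply: IH.
Qed.

Lemma sat_formC V (vs : V -> lsort (ablang L)) (p : formula vs)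
    W (ws : W -> lsort Mlang) (sg : forall v, term ws (sortC (vs v)))
    (e : forall w, Mstr (ws w)) :
  sat (formC p sg) e <-> @sat _ (abstr C) _ vs p (fun v => eval (sg v) e).
Proof.
elim: p W ws sg e => {V vs} [V vs|V vs s t u|V vs r a|V vs p IH|V vs p IHp q IHq
  |V vs s p IH] W ws sg e /=.
- by [].
- by rewrite !eval_termC.
- have -> // : (fun i => eval (termC sg (a i)) e) =
    (fun i => @eval _ (abstr C) _ vs _ (a i) (fun v => eval (sg v) e)).
  by apply: functional_extensionality_dep => i; rewrite eval_termC.
- by rewrite IH.
- by rewrite IHp IHq.
- have E (a : abstr C s) :
      (fun o => eval (@liftC V vs W ws sg s o) (econs (N := Mstr) (s := sortC s) a e)) =
      econs (N := abstr C) a (fun v => eval (sg v) e).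
    apply: functional_extensionality_dep => -[v|//] /=.
    exact: (@eval_tweak _ ws (sortC s) _ (sg v) e a).
  split=> -[a]; first by move/IH; rewrite E => h; exists a.
  by move=> h; exists a; apply/IH; rewrite E.
Qed.

Section Coset.
Variable p : ppform L.

Definition coset_ctx : 'I_(pp_n p) -> lsort Mlang := fun i => sortC (pp_s i).

Definition coset_diff (i : 'I_(pp_n p)) :
    term (vjoin coset_ctx coset_ctx) (sortC (pp_s i)) :=
  @tapp Mlang _ _ (MfC _ _ _ (inl (gadd (pp_s i))))
    (fun j : 'I_2 => if j == ord0 then @tvar Mlang _ (vjoin coset_ctx coset_ctx) (inr i)
       else @tapp Mlang _ _ (MfC _ _ _ (inl (gopp (pp_s i))))
              (fun=> @tvar Mlang _ (vjoin coset_ctx coset_ctx) (inl i))).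

Definition coset_fm : formula (vjoin coset_ctx coset_ctx) :=
  formC (pp_fm p) coset_diff.

Lemma sat_coset_fm (x y : forall i, Mstr (coset_ctx i)) :
  sat coset_fm (ejoin x y) <-> @ppmod L C p x y.
Proof. exact: sat_formC. Qed.

Lemma coset_equiv : Equivalence (fun x y : forall i, Mstr (coset_ctx i) =>
  sat coset_fm (ejoin x y)).
Proof.
have ppN z : @ppsat L C p z -> @ppsat L C p (fun i => - z i).
  move=> h; have := ab_ppB (@ab_pp0 L C p) h.
  by congr ppsat; apply: functional_extensionality_dep => i; rewrite sub0r.
split.
- move=> x; apply/sat_coset_fm; have := @ab_pp0 L C p.
  by congr ppsat; apply: functional_extensionality_dep => i; rewrite subrr.
- move=> x y /sat_coset_fm/ppN h; apply/sat_coset_fm; move: h.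
  by congr ppsat; apply: functional_extensionality_dep => i; rewrite opprB.
- move=> x y z /sat_coset_fm/ppN hxy /sat_coset_fm hyz; apply/sat_coset_fm.
  have := ab_ppB hyz hxy; congr ppsat; apply: functional_extensionality_dep => i.
  by rewrite opprK subrKA.
Qed.

Definition coset_sort : eqsort Mstr := EqSort coset_equiv.

Definition coset (c : forall i, ab_car C (pp_s (p := p) i)) : elt (eqstr Mstr) :=
  @Elt _ (eqstr Mstr) (inr coset_sort) (cls (@eq_rel _ Mstr coset_sort) c).

End Coset.

End SequenceStructure.

(* Main.v *)
(* Every formula of the sequence is a Boolean combination of formulas of A*, whose
   arguments are variables and terms rho_phi(t(x)), and of formulas of C*, whose
   arguments are variables and nu(x): an existential quantifier over B is eliminated by
   applying the fundamental system to the p.p.-formula that says that a system of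
   cosets has a common solution. Hence A* and C* are orthogonal, and their induced
   structures over Gamma are those given by A*(Gamma) and C*(Gamma).

   Forking in A* or C* is therefore forking in the sequence. Conversely, suppose that a
   formula in the type of U over Delta implies a disjunction of dividing formulas with
   parameters c. Realise the type in A* and in C* outside the dividing formulas, and
   amalgamate. A term rho_phi(t(x, c)) is nonzero only if nu t(x, c) lies in phi(C). If
   the coset of nu t(0, c) modulo phi(C) is not algebraic over Gamma, this condition on
   x divides in C*. Otherwise the coset belongs to Gamma by (H1), contains nu(beta) for
   some beta in B(Gamma) by (H3), and subtracting beta splits rho_phi(t(x, c)) as a sum
   of an element of A*(U) and an element of A* depending on c only. So a
   Gamma-indiscernible sequence of conjugates of c yields indiscernible sequences in A*
   and in C*, along which the instances of the formula have a common solution. *)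

From Stdlib Require List.
From mathcomp Require Import all_boot all_order all_algebra.
From mathcomp Require Import boolp classical_sets functions cardinality.
Require Import Defs.

Set Implicit Arguments.
Unset Strict Implicit.
Unset Printing Implicit Defensive.

Import GRing.Theory.
Local Open Scope classical_set_scope.

(** A formula is a finite disjunction of pairs of a condition on A* and a condition on C*. Which
    pair holds depends on the realisation, yet the realisation must be chosen outside dividing
    formulas listed in advance. Hence [block]: a formula comes with finite lists of formulas of A*
    and of C*, such that at a realisation avoiding the dividing ones it can hold only if its
    instances along every indiscernible sequence through its parameters have common solutions, any
    finite number at a time. Next, [rho] is additive only on its domain, which is a condition in C;
    so each argument fixes beforehand the set [J] of the terms whose arguments lie in the domain.
    Finally, the parts of a realisation are linked: [nu] and [rho] of its B-part must be its
    coordinates in C* and A*, as they are for the substructure U. A formula uses finitely many of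
    these equations; they form a condition over Gamma, to which orthogonality is applied again. As U
    may be infinite, formulas live in contexts indexed by arbitrary types, and finite supports are
    extracted where needed. *)

Local Notation fext := functional_extensionality_dep.

(** * Definable predicates *)

Section Substitution.
Variable L : lang.

Fixpoint tsub V (vs : V -> lsort L) W (ws : W -> lsort L)
    (F : forall v, term ws (vs v)) s (t : term vs s) : term ws s :=
  match t with
  | tvar v => F v
  | tapp f a => tapp (fun i => tsub F (a i))
  end.

Definition tlift V (vs : V -> lsort L) W (ws : W -> lsort L)
    (F : forall v, term ws (vs v)) s :
    forall o, term (vcons s ws) (vcons s vs o) :=
  fun o => match o with
  | Some v => tsub (fun w => @tvar L _ (vcons s ws) (Some w)) (F v)
  | None => @tvar L _ (vcons s ws) None
  end.

Fixpoint fsub V (vs : V -> lsort L) (p : formula vs) :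
    forall W (ws : W -> lsort L), (forall v, term ws (vs v)) -> formula ws :=
  match p with
  | ftrue => fun W ws F => ftrue ws
  | feq s t u => fun W ws F => feq (tsub F t) (tsub F u)
  | frel r a => fun W ws F => @frel L _ ws r (fun i => tsub F (a i))
  | fnot q => fun W ws F => fnot (fsub q F)
  | fand q r => fun W ws F => fand (fsub q F) (fsub r F)
  | fex s q => fun W ws F => fex (fsub q (@tlift V vs W ws F s))
  end.

Lemma is_pp_fsub V (vs : V -> lsort L) (p : formula vs) W (ws : W -> lsort L)
  (F : forall v, term ws (vs v)) : is_pp (fsub p F) = is_pp p.
Proof. by elim: p W ws F => //= {}V {}vs p IHp q IHq W ws F; rewrite IHp IHq. Qed.

Variable N : str L.

Lemma eval_tsub V (vs : V -> lsort L) W (ws : W -> lsort L)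
    (F : forall v, term ws (vs v)) s (t : term vs s) (e : forall w, N (ws w)) :
  eval (tsub F t) e = eval t (fun v => eval (F v) e).
Proof.
elim: t => //= f a IH; congr (sfun _); apply: fext => i; exact: IH.
Qed.

Lemma econs_tlift V (vs : V -> lsort L) W (ws : W -> lsort L)
    (F : forall v, term ws (vs v)) s (a : N s) (e : forall w, N (ws w)) :
  (fun o => eval (tlift F s o) (econs a e)) = econs a (fun v => eval (F v) e).
Proof. by apply: fext => -[v|] //=; rewrite eval_tsub. Qed.

Lemma sat_fsub V (vs : V -> lsort L) (p : formula vs) W (ws : W -> lsort L)
    (F : forall v, term ws (vs v)) (e : forall w, N (ws w)) :
  sat (fsub p F) e <-> sat p (fun v => eval (F v) e).
Proof.
elim: p W ws F e => {V vs}
    [V vs|V vs s t u|V vs r a|V vs p IH|V vs p IHp q IHq|V vs s p IH] W ws F e //=.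
- by rewrite !eval_tsub.
- have -> // : (fun i => eval (tsub F (a i)) e) =
    (fun i => eval (a i) (fun v => eval (F v) e)).
  by apply: fext => i; rewrite eval_tsub.
- by rewrite IH.
- by rewrite IHp IHq.
- split=> -[a h]; exists a; first by move: h => /IH; rewrite econs_tlift.
  by apply/IH; rewrite econs_tlift.
Qed.

Definition fands V (vs : V -> lsort L) (T : finType) (p : T -> formula vs) :=
  foldr (fun t q => fand (p t) q) (ftrue vs) (enum T).

Lemma is_pp_fands V (vs : V -> lsort L) (T : finType) (p : T -> formula vs) :
  (forall t, is_pp (p t)) -> is_pp (fands p).
Proof. by move=> h; rewrite /fands; elim: (enum T) => //= t l ->; rewrite h. Qed.

Lemma sat_fands V (vs : V -> lsort L) (T : finType) (p : T -> formula vs)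
    (e : forall v, N (vs v)) :
  sat (fands p) e <-> forall t, sat (p t) e.
Proof.
suff H l : sat (foldr (fun t q => fand (p t) q) (ftrue vs) l) e <->
    forall t, t \in l -> sat (p t) e.
  by rewrite H; split=> h t; [apply: h; rewrite mem_enum|move=> _; apply: h].
elim: l => //= t l IH; rewrite IH; split=> [[h1 h2] t'|h].
  by rewrite inE => /predU1P[->|/h2].
by split=> [|t' ht]; apply: h; rewrite inE ?eqxx ?ht ?orbT.
Qed.

End Substitution.

Lemma dchoice (I : Type) (T : I -> Type) (P : forall i, T i -> Prop) :
  (forall i, exists x, P i x) -> exists f : forall i, T i, forall i, P i (f i).
Proof. by move=> h; exists (fun i => projT1 (cid (h i))) => i; case: cid. Qed.

Section Tuples.
Variables (n : nat) (S : 'I_n.+1 -> Type).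

Definition dcons (a : S ord0) (d : forall i, S (lift ord0 i)) (i : 'I_n.+1) : S i :=
  match unliftP ord0 i with
  | UnliftSome j e => eq_rect_r S (d j) e
  | UnliftNone e => eq_rect_r S a e
  end.

Lemma dcons_eta (z : forall i, S i) : dcons (z ord0) (fun j => z (lift ord0 j)) = z.
Proof. by apply: fext => i; rewrite /dcons; case: unliftP => [j|] e; subst i. Qed.

Lemma dcons0 a d : dcons a d ord0 = a.
Proof.
rewrite /dcons; case: unliftP => [j e|e]; first by exfalso; have := neq_lift ord0 j; rewrite -e eqxx.
by rewrite (Prop_irrelevance e erefl).
Qed.

Lemma dconsS a d j : dcons a d (lift ord0 j) = d j.
Proof.
rewrite /dcons; case: unliftP => [k e|e]; last first.
  by exfalso; have := neq_lift ord0 j; rewrite e eqxx.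
have E := lift_inj e; subst k.
by rewrite (Prop_irrelevance e erefl).
Qed.

End Tuples.

Section Definable.
Variables (L : lang) (N : str L).

(** Terms and formulas are handled through the functions and predicates on assignments that they
    define. Closure properties then replace the manipulation of syntax, and the context [V] may be
    infinite. *)
Definition TFun V (vs : V -> lsort L) s (f : (forall v, N (vs v)) -> N s) :=
  exists t : term vs s, forall e, eval t e = f e.

Definition Def V (vs : V -> lsort L) (P : (forall v, N (vs v)) -> Prop) :=
  exists p : formula vs, forall e, sat p e <-> P e.

Section Context.
Variables (V : Type) (vs : V -> lsort L).
Implicit Types P Q : (forall v, N (vs v)) -> Prop.

Lemma TFun_var v : TFun (fun e : forall v, N (vs v) => e v).
Proof. by exists (tvar vs v). Qed.

Lemma TFun_app (f : fsym L) (F : forall i, (forall v, N (vs v)) -> N (fdom (f := f) i)) :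
  (forall i, TFun (F i)) -> TFun (fun e => sfun (fun i => F i e)).
Proof.
move=> /dchoice[t ht].
exists (tapp t) => e /=; congr sfun; apply: fext => i; exact: ht.
Qed.

Lemma TFun_ext s (f g : (forall v, N (vs v)) -> N s) :
  TFun f -> (forall e, f e = g e) -> TFun g.
Proof. by move=> [t ht] h; exists t => e; rewrite ht. Qed.

Lemma Def_sat (p : formula vs) : Def (sat (N := N) p).
Proof. by exists p. Qed.

Lemma Def_ext P Q : Def P -> (forall e, P e <-> Q e) -> Def Q.
Proof. by move=> [p hp] h; exists p => e; rewrite hp. Qed.

Lemma Def_not P : Def P -> Def (fun e => ~ P e).
Proof. by move=> [p hp]; exists (fnot p) => e /=; rewrite hp. Qed.

Lemma Def_and P Q : Def P -> Def Q -> Def (fun e => P e /\ Q e).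
Proof. by move=> [p hp] [q hq]; exists (fand p q) => e /=; rewrite hp hq. Qed.

Lemma Def_const (X : Prop) : Def (vs := vs) (fun=> X).
Proof.
have T : Def (vs := vs) (fun=> True) by exists (ftrue vs).
case: (pselect X) => h; first by apply: (Def_ext T).
by apply: (Def_ext (Def_not T)) => e; split=> [/(_ I)|].
Qed.

Lemma Def_imp P Q : Def P -> Def Q -> Def (fun e => P e -> Q e).
Proof.
move=> hP hQ; apply: Def_ext (Def_not (Def_and hP (Def_not hQ))) _ => e.
split=> [h hp|h [/h hq hn]] //.
by apply: contrapT => hn; apply: h.
Qed.

Lemma Def_iff P Q : Def P -> Def Q -> Def (fun e => P e <-> Q e).
Proof. by move=> hP hQ; apply: Def_and; apply: Def_imp. Qed.

Lemma Def_all (T : finType) (P : T -> (forall v, N (vs v)) -> Prop) :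
  (forall t, Def (P t)) -> Def (fun e => forall t, P t e).
Proof.
move=> /choice[p hp]; exists (fands p) => e; rewrite sat_fands.
by split=> h t; apply/hp.
Qed.

Lemma Def_eq s (f g : (forall v, N (vs v)) -> N s) :
  TFun f -> TFun g -> Def (fun e => f e = g e).
Proof. by move=> [t ht] [u hu]; exists (feq t u) => e /=; rewrite ht hu. Qed.

Lemma Def_rel (r : rsym L) (F : forall i, (forall v, N (vs v)) -> N (rdom (r := r) i)) :
  (forall i, TFun (F i)) -> Def (fun e => srel (fun i => F i e)).
Proof.
move=> /dchoice[t ht]; exists (frel t) => e /=.
by have -> : (fun i => eval (t i) e) = (fun i => F i e) by apply: fext.
Qed.

Lemma Def_ex s (P : N s -> (forall v, N (vs v)) -> Prop) :
  Def (vs := vcons s vs) (fun e => P (e None) (fun v => e (Some v))) ->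
  Def (fun e => exists a, P a e).
Proof.
move=> [p hp]; exists (fex p) => e /=.
by split=> -[a ha]; exists a; [move/hp: ha|apply/(hp (econs a e))].
Qed.

End Context.
End Definable.
Arguments TFun_var {L N V vs} v.
Arguments Def_const {L N V vs} X.

(** Proves that a coordinate projection is a term, by reading the variable off the reduced
    function. *)
Ltac coord :=
  match goal with |- @TFun ?L ?N ?V ?vs _ ?f =>
    let g := eval hnf in f in let g := eval cbv beta iota zeta in g in
    match g with fun e => e ?x => exact (@TFun_var L N V vs x) end end.

(** * Structures interpreted sort by sort in another structure *)

Section Interpretation.
Variables (L1 L2 : lang) (N1 : str L1) (N2 : str L2) (h : lsort L1 -> lsort L2).
Variables (to : forall s, N1 s -> N2 (h s)) (fr : forall s, N2 (h s) -> N1 s).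
Hypothesis frK : forall s (x : N1 s), fr (to x) = x.
Hypothesis toK : forall s (x : N2 (h s)), to (fr x) = x.
Hypothesis interp_fun : forall f : fsym L1,
  TFun (vs := fun i => h (fdom (f := f) i))
    (fun y : forall i, N2 _ => to (sfun (fun i => fr (y i)))).
Hypothesis interp_rel : forall r : rsym L1,
  Def (vs := fun i => h (rdom (r := r) i))
    (fun y : forall i, N2 _ => srel (fun i => fr (y i))).

Lemma TFun_subst U (us : U -> lsort L2) V (vs : V -> lsort L2)
    (F : forall u, (forall v, N2 (vs v)) -> N2 (us u)) s (g : (forall u, N2 (us u)) -> N2 s) :
  TFun g -> (forall u, TFun (F u)) -> TFun (fun e => g (fun u => F u e)).
Proof.
move=> [t ht] /dchoice[G hG]; exists (tsub G t) => e.
by rewrite eval_tsub ht; congr g; apply: fext.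
Qed.

Lemma TFun_interp U (us : U -> lsort L1) V (vs : V -> lsort L2)
    (F : forall u, (forall v, N2 (vs v)) -> N2 (h (us u))) s (t : term us s) :
  (forall u, TFun (F u)) -> TFun (fun e => to (eval t (fun u => fr (F u e)))).
Proof.
move=> hF; elim: t => [u|f a IH] /=.
  by apply: TFun_ext (hF u) _ => e; rewrite toK.
apply: TFun_ext (TFun_subst (interp_fun f) IH) _ => e.
by congr (to (sfun _)); apply: fext => i; rewrite frK.
Qed.

Lemma Def_interp U (us : U -> lsort L1) (p : formula us) V (vs : V -> lsort L2)
    (F : forall u, (forall v, N2 (vs v)) -> N2 (h (us u))) :
  (forall u, TFun (F u)) -> Def (fun e => sat p (fun u => fr (F u e))).
Proof.
elim: p V vs F => {U us}
    [U us|U us s t u|U us r a|U us p IH|U us p IHp q IHq|U us s p IH] V vs F hF /=.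
- exact: Def_const.
- apply: Def_ext (Def_eq (TFun_interp t hF) (TFun_interp u hF)) _ => e.
  by split=> [E|->//]; rewrite -[LHS]frK E frK.
- have [q hq] := interp_rel r.
  have /dchoice[t ht] := fun i => TFun_interp (a i) hF.
  exists (fsub q t) => e; rewrite sat_fsub hq.
  have -> // : (fun i => fr (eval (t i) e)) = (fun i => eval (a i) (fun u => fr (F u e))).
  by apply: fext => i; rewrite ht frK.
- exact: Def_not (IH _ _ _ hF).
- exact: Def_and (IHp _ _ _ hF) (IHq _ _ _ hF).
- pose G (o : option U) := match o return
      (forall v, N2 (vcons (h s) vs v)) -> N2 (h (vcons s us o)) with
      | Some u => fun e => F u (fun v => e (Some v)) | None => fun e => e None end.
  have hG o : TFun (G o).
    case: o => [u|]; last by exists (tvar (vcons (h s) vs) None).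
    exact: (TFun_subst (us := vs) (vs := vcons (h s) vs)
      (F := fun v e => e (Some v)) (hF u) (fun v => TFun_var (vs := vcons (h s) vs) (Some v))).
  have [q hq] := IH _ _ G hG.
  exists (fex q) => e /=; split=> -[a].
    move/hq => H; exists (fr a); move: H.
    by congr (sat p _); apply: fext => -[].
  move=> H; exists (to a); apply/hq; move: H.
  by congr (sat p _); apply: fext => -[u|] //=; rewrite frK.
Qed.

Lemma Def_reduct U (us : U -> lsort L1) (Q : (forall u, N1 (us u)) -> Prop)
    V (vs : V -> lsort L2)
    (F : forall u, (forall v, N2 (vs v)) -> N2 (h (us u))) :
  Def Q -> (forall u, TFun (F u)) -> Def (fun e => Q (fun u => fr (F u e))).
Proof.
by move=> [p hp] hF; apply: Def_ext (Def_interp p hF) _ => e; apply: hp.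
Qed.

End Interpretation.

Section Reindex.
Variables (L : lang) (N : str L).

Lemma Def_subst U (us : U -> lsort L) (Q : (forall u, N (us u)) -> Prop)
    V (vs : V -> lsort L) (F : forall u, (forall v, N (vs v)) -> N (us u)) :
  Def Q -> (forall u, TFun (F u)) -> Def (fun e => Q (fun u => F u e)).
Proof.
move=> [p hp] /dchoice[t ht]; exists (fsub p t) => e; rewrite sat_fsub hp.
by have -> : (fun u => eval (t u) e) = (fun u => F u e) by apply: fext.
Qed.

Lemma TFun_dcons V (vs : V -> lsort L) n (ss : 'I_n.+1 -> lsort L)
    (f : (forall v, N (vs v)) -> N (ss ord0))
    (g : forall j, (forall v, N (vs v)) -> N (ss (lift ord0 j))) i :
  TFun f -> (forall j, TFun (g j)) ->
  TFun (fun e => dcons (S := fun i => N (ss i)) (f e) (fun j => g j e) i).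
Proof.
move=> hf hg; case: (unliftP ord0 i) => [j|] E; subst i.
  by apply: TFun_ext (hg j) _ => e; rewrite dconsS.
by apply: TFun_ext hf _ => e; rewrite dcons0.
Qed.

Lemma Def_exs n (ss : 'I_n -> lsort L) V (vs : V -> lsort L)
    (P : (forall i, N (ss i)) -> (forall v, N (vs v)) -> Prop) :
  Def (vs := vjoin vs ss) (fun e => P (fun i => e (inr i)) (fun v => e (inl v))) ->
  Def (fun e => exists d, P d e).
Proof.
elim: n ss V vs P => [|n IH] ss V vs P hP.
  have d0 (i : 'I_0) : False by case: i.
  pose F x := match x return (forall v, N (vs v)) -> N (vjoin vs ss x) with
    | inl v => fun e => e v | inr i => False_rect _ (d0 i) end.
  have hF x : TFun (F x) by case: x => [v|i]; [exact: TFun_var|case: (d0 i)].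
  have [q hq] := Def_subst hP hF.
  exists q => e; rewrite hq; split=> [h|[d h]].
    by exists (fun i => F (inr i) e).
  by have -> // : (fun i => F (inr i) e) = d by apply: fext; case.
have H : Def (fun e : forall v, N (vs v) => exists a : N (ss ord0),
    exists d : forall i, N (ss (lift ord0 i)), P (dcons (S := fun i => N (ss i)) a d) e).
  apply: Def_ex; apply: IH.
  pose ws := vjoin (vcons (ss ord0) vs) (fun i => ss (lift ord0 i)).
  pose F x := match x return (forall w, N (ws w)) -> N (vjoin vs ss x) with
    | inl v => fun e => e (inl (Some v))
    | inr i => fun e => dcons (S := fun i => N (ss i)) (e (inl None)) (fun j => e (inr j)) i
    end.
  have hF x : TFun (F x).
    case: x => [v|i]; first coord.
    apply: TFun_dcons => [|j]; last coord.
    coord.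
  exact: Def_subst hP hF.
apply: Def_ext H _ => e; split=> [[a [d h]]|[d h]].
  by exists (dcons (S := fun i => N (ss i)) a d).
by exists (d ord0), (fun j => d (lift ord0 j)); rewrite (dcons_eta (S := fun i => N (ss i))).
Qed.

End Reindex.

(** * Finite supports of formulas in infinite contexts *)

Section Support.
Variable L : lang.

Lemma reindex_term V (vs : V -> lsort L) W (ws : W -> lsort L) (T T' : Type)
    (f : T -> T') (g : T' -> W) x :
  exists t : term (vjoin vs (fun i => ws (g i))) (vjoin vs (fun i => ws (g (f i))) x),
    forall (N : str L) (e : forall v, N (vs v)) (d : forall w, N (ws w)),
      eval (N := N) t (ejoin e (fun i => d (g i))) = ejoin e (fun i => d (g (f i))) x.
Proof.
by case: x => [v|i]; [exists (tvar (vjoin vs (fun i => ws (g i))) (inl v))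
  |exists (tvar (vjoin vs (fun i => ws (g i))) (inr (f i)))].
Qed.

Lemma reindex_fm V (vs : V -> lsort L) W (ws : W -> lsort L) (T T' : Type)
    (f : T -> T') (g : T' -> W) (q : formula (vjoin vs (fun i => ws (g (f i))))) :
  exists q' : formula (vjoin vs (fun i => ws (g i))),
    is_pp q' = is_pp q /\ forall (N : str L) (e : forall v, N (vs v)) (d : forall w, N (ws w)),
    sat (N := N) q' (ejoin e (fun i => d (g i))) <-> sat q (ejoin e (fun i => d (g (f i)))).
Proof.
have [G hG] := dchoice (reindex_term vs ws f g).
exists (fsub q G); split=> [|N e d]; first by rewrite is_pp_fsub.
by rewrite sat_fsub (_ : (fun v => eval (G v) _) = ejoin e (fun i => d (g (f i)))) //; apply: fext => x.
Qed.

Lemma finite_support_terms V (vs : V -> lsort L) W (ws : W -> lsort L) (I : finType)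
    (ss : I -> lsort L) (t : forall i, term (vjoin vs ws) (ss i)) :
  (forall i, exists (T : finType) (f : T -> W) (u : term (vjoin vs (fun x => ws (f x))) (ss i)),
    forall (N : str L) e d, eval (N := N) u (ejoin e (fun x => d (f x))) = eval (t i) (ejoin e d)) ->
  exists (T : finType) (f : T -> W) (u : forall i, term (vjoin vs (fun x => ws (f x))) (ss i)),
    forall (N : str L) e d i, eval (N := N) (u i) (ejoin e (fun x => d (f x))) = eval (t i) (ejoin e d).
Proof.
move=> /dchoice[T /dchoice[f /dchoice[u hu]]].
pose g (x : {i & T i}) := f (projT1 x) (projT2 x).
have [G hG] := dchoice (fun i => dchoice (reindex_term vs ws (existT T i) g)).
exists {i & T i}, g, (fun i => tsub (G i) (u i)) => N e d i.
by rewrite eval_tsub -hu; congr eval; apply: fext => x; rewrite hG.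
Qed.

Lemma finite_support_term V (vs : V -> lsort L) W (ws : W -> lsort L) s
    (t : term (vjoin vs ws) s) :
  exists (T : finType) (f : T -> W) (u : term (vjoin vs (fun x => ws (f x))) s),
    forall (N : str L) e d, eval (N := N) u (ejoin e (fun x => d (f x))) = eval t (ejoin e d).
Proof.
elim: t => [[v|w]|g a /finite_support_terms[T [f [u hu]]]].
- by exists void, (of_void W), (tvar (vjoin vs (fun i => ws (of_void W i))) (inl v)).
- by exists unit, (fun=> w), (tvar (vjoin vs (fun i : unit => ws w)) (inr tt)).
by exists T, f, (tapp u) => N e d /=; congr sfun; apply: fext => i; exact: hu.
Qed.

(** The induction carries a substitution [F] because a bound variable has to join the side [V],
    which is kept whole, while only the side [W] is cut down to a finite type. That being p.p. is
    preserved serves to apply the fundamental system in arbitrary contexts. *)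
Lemma finite_support_fin U (us : U -> lsort L) (p : formula us)
    V (vs : V -> lsort L) W (ws : W -> lsort L) (F : forall u, term (vjoin vs ws) (us u)) :
  exists (T : finType) (f : T -> W) (q : formula (vjoin vs (fun i => ws (f i)))),
    is_pp q = is_pp p /\ forall (N : str L) e d,
    sat (N := N) q (ejoin e (fun i => d (f i))) <-> sat p (fun u => eval (F u) (ejoin e d)).
Proof.
elim: p V vs F => {U us}
    [U us|U us s t u|U us r a|U us p IH|U us p IHp q IHq|U us s p IH] V vs F /=.
- by exists void, (of_void W), (ftrue _).
- have [T [f [t' ht]]] := finite_support_terms
    (fun b : bool => finite_support_term (tsub F (if b then t else u))).
  exists T, f, (feq (t' true) (t' false)); split=> // N e d /=.
  by rewrite !ht !eval_tsub.
- have [T [f [t ht]]] := finite_support_terms (fun i => finite_support_term (tsub F (a i))).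
  exists T, f, (frel t); split=> // N e d /=.
  rewrite (_ : (fun i => eval (t i) _) = (fun i => eval (a i) (fun u => eval (F u) (ejoin e d)))) //.
  by apply: fext => i; rewrite ht eval_tsub.
- have [T [f [q [_ hq]]]] := IH _ _ F.
  by exists T, f, (fnot q); split=> // N e d /=; rewrite hq.
- have [T [f [p' [pp hp]]]] := IHp _ _ F.
  have [T' [f' [q' [qq hq]]]] := IHq _ _ F.
  pose g x := match x with inl i => f i | inr i => f' i end.
  have [p1 [pp1 hp1]] := reindex_fm (ws := ws) (f := inl : T -> T + T') (g := g) p'.
  have [q1 [qq1 hq1]] := reindex_fm (ws := ws) (f := inr : T' -> T + T') (g := g) q'.
  exists (T + T')%type, g, (fand p1 q1).
  split=> [|N e d] /=; first by rewrite pp1 qq1 pp qq.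
  by rewrite -hp -hq (hp1 N e d) (hq1 N e d).
(* [R] and [F'] place the bound variable on the side [V]; [G] below returns it to the binder. *)
- pose R x := match x return term (vjoin (vcons s vs) ws) (vjoin vs ws x) with
    | inl v => tvar (vjoin (vcons s vs) ws) (inl (Some v))
    | inr k => tvar (vjoin (vcons s vs) ws) (inr k) end.
  pose F' o := match o return term (vjoin (vcons s vs) ws) (vcons s us o) with
    | Some u => tsub R (F u) | None => tvar (vjoin (vcons s vs) ws) (inl None) end.
  have [T [f [q [qq hq]]]] := IH _ _ F'.
  pose ts := vcons s (vjoin vs (fun x => ws (f x))).
  pose G x := match x return term ts (vjoin (vcons s vs) (fun k => ws (f k)) x) with
    | inl None => tvar ts None
    | inl (Some v) => tvar ts (Some (inl v))
    | inr k => tvar ts (Some (inr k)) end.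
  exists T, f, (fex (fsub q G)); split=> [|N e d] /=; first by rewrite is_pp_fsub.
  have E a : sat (fsub q G) (econs a (ejoin e (fun i => d (f i)))) <->
      sat p (econs a (fun u => eval (F u) (ejoin e d))).
    rewrite sat_fsub (_ : (fun v => eval (G v) _) =
      ejoin (econs (vs := vs) a e) (fun i => d (f i))); last by apply: fext => -[[]|].
    rewrite hq (_ : (fun u => eval (F' u) _) =
      econs a (fun u => eval (F u) (ejoin e d))) //; apply: fext => -[u|] //=.
    by rewrite eval_tsub; congr eval; apply: fext => -[].
  by split=> -[a /E]; exists a.
Qed.

Lemma finite_support U (us : U -> lsort L) (p : formula us)
    V (vs : V -> lsort L) W (ws : W -> lsort L) (F : forall u, term (vjoin vs ws) (us u)) :
  exists n (f : 'I_n -> W) (q : formula (vjoin vs (fun i => ws (f i)))),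
    is_pp q = is_pp p /\ forall (N : str L) e d,
    sat (N := N) q (ejoin e (fun i => d (f i))) <-> sat p (fun u => eval (F u) (ejoin e d)).
Proof.
have [T [f [q [qq hq]]]] := finite_support_fin p F.
pose g (i : 'I_#|T|) := f (enum_val i).
pose vg := vjoin vs (fun i => ws (g i)).
have H x : exists t : term vg (vjoin vs (fun k => ws (f k)) x),
    forall (N : str L) (e : forall v, N (vs v)) (d : forall w, N (ws w)),
      eval t (ejoin e (fun i => d (g i))) = ejoin e (fun k => d (f k)) x.
  case: x => [v|k]; first by exists (tvar vg (inl v)).
  have E : enum_val (enum_rank k) = k by rewrite enum_rankK.
  (* Generalising the rank lets the equation be eliminated, so that the sort of the variable needs
     no transport. *)
  move: (enum_rank k) E => i <-; exists (tvar vg (inr i)); by [].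
have [G hG] := dchoice H.
exists #|T|, g, (fsub q G); split=> [|N e d]; first by rewrite is_pp_fsub.
rewrite sat_fsub -hq (_ : (fun v => eval (G v) _) = ejoin e (fun k => d (f k))) //.
by apply: fext => x; rewrite hG.
Qed.

Variable N : str L.

Lemma Def_support V (vs : V -> lsort L) W (ws : W -> lsort L)
    (Q : (forall x, N (vjoin vs ws x)) -> Prop) : Def Q ->
  exists n (f : 'I_n -> W) (q : formula (vjoin vs (fun i => ws (f i)))),
    forall e d, sat q (ejoin e (fun i => d (f i))) <-> Q (ejoin e d).
Proof.
move=> [p hp].
have [n [f [q [_ hq]]]] := finite_support p (fun x => tvar (vjoin vs ws) x).
exists n, f, q => e d; rewrite hq -hp.
by rewrite (_ : (fun u => eval _ _) = ejoin e d) //; apply: fext.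
Qed.

(* Equations between the coordinates with equal indices make the choice of
   a finite tuple extend to the whole context. *)
Lemma Def_exinf V (vs : V -> lsort L) W (ws : W -> lsort L) (d0 : forall w, N (ws w))
    (P : (forall w, N (ws w)) -> (forall v, N (vs v)) -> Prop) :
  Def (vs := vjoin vs ws) (fun e => P (fun i => e (inr i)) (fun v => e (inl v))) ->
  Def (fun e => exists d, P d e).
Proof.
move=> /Def_support[n [f [q hq]]].
pose ok (d : forall i, N (ws (f i))) := forall i j, forall E : f i = f j,
  eq_rect (f i) (fun w => N (ws w)) (d i) (f j) E = d j.
have H : Def (fun e : forall v, N (vs v) => exists d, ok d /\ sat q (ejoin e d)).
  apply: Def_exs; apply: Def_and; last first.
    apply: Def_ext (Def_sat N q) _ => e.
    by rewrite (_ : ejoin _ _ = e) //; apply: fext => -[].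
  apply: Def_all => i; apply: Def_all => j.
  case: (pselect (f i = f j)) => E; last first.
    by apply: Def_ext (Def_const True) _ => e; split=> // _ E'.
  pose us := vjoin vs (fun i => ws (f i)).
  have T w (E' : f i = w) : TFun (vs := us)
      (fun e => eq_rect (f i) (fun w => N (ws w)) (e (inr i)) w E').
    by case: w / E' => /=; coord.
  apply: Def_ext (Def_eq (T _ E) (TFun_var (vs := us) (inr j))) _ => e.
  by split=> [<- E'|]; rewrite ?(Prop_irrelevance E' E).
apply: Def_ext H _ => e; split=> [[d [okd]]|[d h]]; last first.
  exists (fun i => d (f i)); split; last by apply/hq.
  by move=> i j E; case: (f j) / E.
(* On the range of [f] the value comes from a chosen preimage, which is harmless by [ok]; elsewhere
   the formula does not look, and the default [d0] is taken. *)
pose D w : N (ws w) := match pselect (exists i, f i = w) with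
  | left h => eq_rect (f (projT1 (cid h))) (fun w => N (ws w)) (d (projT1 (cid h))) w
                (projT2 (cid h))
  | right _ => d0 w end.
have hD i : D (f i) = d i.
  rewrite /D; case: pselect => [h|[]]; last by exists i.
  by case: (cid h) => j E /=; rewrite okd.
rewrite -(_ : (fun i => D (f i)) = d); last by apply: fext.
by move=> /hq; exists D.
Qed.

End Support.

Lemma Def_join L (N : str L) U (us : U -> lsort L) U' (us' : U' -> lsort L)
    V (vs : V -> lsort L) (Q : (forall x, N (vjoin us us' x)) -> Prop)
    (F : forall u, (forall v, N (vs v)) -> N (us u))
    (G : forall u, (forall v, N (vs v)) -> N (us' u)) :
  Def Q -> (forall u, TFun (F u)) -> (forall u, TFun (G u)) ->
  Def (fun e => Q (ejoin (fun u => F u e) (fun u => G u e))).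
Proof.
move=> hQ hF hG.
pose H x := match x return (forall v, N (vs v)) -> N (vjoin us us' x) with
  | inl u => F u | inr u => G u end.
have hH x : TFun (H x) by case: x.
apply: Def_ext (Def_subst hQ hH) _ => e.
by rewrite (_ : (fun u => H u e) = ejoin (fun u => F u e) (fun u => G u e)) //;
  apply: fext => -[].
Qed.

(** * Imaginaries through representatives in the home sorts *)

Section Imaginaries.
Variables (L : lang) (N : str L).

(** The counterpart of [TFun] for values in M^eq: an imaginary depending on home variables must be
    the class of a tuple of terms. *)
Definition erep V (vs : V -> lsort L) (s : lsort (eqlang N)) :
    ((forall v, N (vs v)) -> eqstr N s) -> Prop :=
  match s return ((forall v, N (vs v)) -> eqstr N s) -> Prop with
  | inl s => fun f => @TFun L N V vs s f
  | inr E => fun f => exists g : forall i, (forall v, N (vs v)) -> N (eq_s (e := E) i),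
      (forall i, TFun (g i)) /\ forall e, f e = cls (@eq_rel L N E) (fun i => g i e)
  end.

Lemma erep_term U (us : U -> lsort (eqlang N)) V (vs : V -> lsort L)
    (F : forall u, (forall v, N (vs v)) -> eqstr N (us u)) s (t : term us s) :
  (forall u, erep (F u)) -> erep (fun e => eval t (fun u => F u e)).
Proof.
move=> hF; elim: t => [u|[f|E] a IH]; first exact: hF.
  exact: (@TFun_app L N V vs f (fun i e => @eval _ (eqstr N) _ _ _ (a i) (fun u => F u e))).
by exists (fun i e => @eval _ (eqstr N) _ _ _ (a i) (fun u => F u e)).
Qed.

Lemma erep_subst V (vs : V -> lsort L) W (ws : W -> lsort L) s
    (f : (forall v, N (vs v)) -> eqstr N s) (r : forall v, (forall w, N (ws w)) -> N (vs v)) :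
  erep f -> (forall v, TFun (r v)) -> erep (fun e => f (fun v => r v e)).
Proof.
case: s f => [s|E] f; first by move=> hf hr; exact: TFun_subst hf hr.
move=> [g [hg hf]] hr; exists (fun i e => g i (fun v => r v e)); split=> // i.
exact: TFun_subst (hg i) hr.
Qed.

Lemma cls_eq (E : eqsort N) (x y : forall i, N (eq_s (e := E) i)) :
  cls (@eq_rel L N E) x = cls (@eq_rel L N E) y <-> eq_rel x y.
Proof.
have [R S T] := eq_equiv E; split=> [[h]|h].
  by move: (f_equal (fun P => P y) h) => /= ->; exact: R.
apply: eq_exist; apply/funext => z; apply/propext; split=> hz.
  exact: T (S _ _ h) hz.
exact: T h hz.
Qed.

(** M^eq induces no new definable sets on the home sorts: equality in a quotient sort becomes the
    defining equivalence relation, and a quantifier over it becomes a block of quantifiers over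
    representatives. *)
Lemma Def_imaginary U (us : U -> lsort (eqlang N)) (p : formula us)
    V (vs : V -> lsort L) (F : forall u, (forall v, N (vs v)) -> eqstr N (us u)) :
  (forall u, erep (F u)) -> Def (fun e => sat p (fun u => F u e)).
Proof.
elim: p V vs F => {U us}
    [U us|U us s t u|U us r a|U us p IH|U us p IHp q IHq|U us s p IH] V vs F hF /=.
- exact: Def_const.
- have := erep_term t hF; have := erep_term u hF; case: s t u => [s|E] t u.
    by move=> hu ht; exact: (@Def_eq L N V vs s _ _ ht hu).
  move=> [g [hg hu]] [g' [hg' ht]].
  apply: Def_ext (Def_join (Def_sat N (eq_fm E)) hg' hg) _ => e.
  by rewrite ht hu cls_eq.
- exact: (@Def_rel L N V vs r _ (fun i => erep_term (a i) hF)).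
- exact: Def_not (IH _ _ _ hF).
- exact: Def_and (IHp _ _ _ hF) (IHq _ _ _ hF).
case: s p IH => [s|E] p IH.
  pose G o := match o return (forall v, N (vcons s vs v)) ->
      eqstr N (vcons (S := lsort (eqlang N)) (inl s) us o) with
    | Some u => fun e => F u (fun v => e (Some v)) | None => fun e => e None end.
  have hG o : erep (G o).
    case: o => [u|]; last by exists (tvar (vcons s vs) None).
    exact: (erep_subst (ws := vcons s vs) (hF u) (fun v => TFun_var (vs := vcons s vs) (Some v))).
  apply: (@Def_ex L N V vs s (fun a e => sat p (econs (N := eqstr N) (s := inl s) a
    (fun u => F u e)))).
  apply: Def_ext (IH _ _ G hG) _ => e.
  by rewrite (_ : (fun u => G u e) = econs (N := eqstr N) (vs := us) (s := inl s) (e None)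
       (fun u => F u (fun v => e (Some v)))) //; apply: fext => -[].
pose ws := vjoin vs (eq_s (e := E)).
pose G o := match o return (forall v, N (ws v)) ->
    eqstr N (vcons (S := lsort (eqlang N)) (inr E) us o) with
  | Some u => fun e => F u (fun v => e (inl v))
  | None => fun e => cls (@eq_rel L N E) (fun i => e (inr i)) end.
have hG o : erep (G o).
  case: o => [u|].
    exact: (erep_subst (ws := ws) (hF u) (fun v => TFun_var (vs := ws) (inl v))).
  by exists (fun i e => e (inr i)); split=> // i; coord.
have H : Def (fun e => exists d, sat p (econs (N := eqstr N) (vs := us) (s := inr E)
    (cls (@eq_rel L N E) d) (fun u => F u e))).
  apply: Def_exs; apply: Def_ext (IH _ _ G hG) _ => e.
  rewrite (_ : (fun u => G u e) = econs (N := eqstr N) (vs := us) (s := inr E)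
    (cls (@eq_rel L N E) (fun i => e (inr i))) (fun u => F u (fun v => e (inl v)))) //.
  by apply: fext => -[].
apply: Def_ext H _ => e; split=> [[d hd]|[[c [d E']] h]].
  by exists (cls (@eq_rel L N E) d).
exists d; move: h; congr (sat p _); congr econs.
exact: eq_exist.
Qed.

Lemma Def_eqstr U (us : U -> lsort (eqlang N)) (Q : (forall u, eqstr N (us u)) -> Prop)
    V (vs : V -> lsort L) (F : forall u, (forall v, N (vs v)) -> eqstr N (us u)) :
  Def Q -> (forall u, erep (F u)) -> Def (fun e => Q (fun u => F u e)).
Proof.
by move=> [p hp] hF; apply: Def_ext (Def_imaginary p hF) _ => e; apply: hp.
Qed.

Definition hval (H : set (elt N)) : forall x : {x | H x}, N (tp_ctx x) :=
  fun x => projT2 (sval x).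

(** Each parameter is the unique solution of a formula over [H]. It is replaced by a quantified
    variable that satisfies this formula, and the resulting formula of M^eq is then pulled back to
    the home sorts. *)
Lemma Def_dcl (H : set (elt N)) U (us : U -> lsort (eqlang N)) (p : pform (eqstr N) us)
    W (ws : W -> lsort L) (F : forall u, (forall w, N (ws w)) -> eqstr N (us u)) :
  params_in (dcl (@home L N @` H)) p -> (forall u, erep (F u)) ->
  exists q : formula (vjoin ws (tp_ctx (X := H))),
    forall e, sat q (ejoin e (hval (H := H))) <-> psat p (fun u => F u e).
Proof.
move=> hp hF.
have {hp}[p' hp] := dchoice hp.
have hd i j : exists f : (forall v, N (vjoin ws (tp_ctx (X := H)) v)) ->
    eqstr N (pf_s (p := p' i) j),
    erep f /\ forall e, f (ejoin e (hval (H := H))) = pf_par (p' i) j.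
  have [/(_ j)[x Hx E] _] := hp i.
  (* The goal is restated for an element together with its sort, so that the equation [E] between
     dependent pairs can be rewritten. *)
  pose P (z : elt (eqstr N)) := exists f : (forall v, N (vjoin ws (tp_ctx (X := H)) v)) ->
    eqstr N (projT1 z), erep f /\ forall e, f (ejoin e (hval (H := H))) = projT2 z.
  rewrite -/(P (Elt (pf_par (p' i) j))) -E.
  exists (fun e => e (inr (exist _ x Hx))); split=> //.
  exact: (TFun_var (vs := vjoin ws (tp_ctx (X := H))) (inr (exist _ x Hx))).
have {hd}[f hf] := dchoice (fun i => dchoice (hd i)).
pose zs (x : {i & 'I_(pf_n (p' i))}) := pf_s (p := p' (projT1 x)) (projT2 x).
have hQ : Def (N := eqstr N) (vs := vjoin us zs) (fun z =>
    exists y : forall i, eqstr N (pf_s (p := p) i), (forall i, sat (pf_fm (p' i))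
      (ejoin (vs := ctx1 (pf_s (p := p) i)) (fun=> y i) (fun j => z (inr (existT _ i j)))))
    /\ sat (pf_fm p) (ejoin (fun u => z (inl u)) y)).
  pose ys := vjoin (vjoin us zs) (pf_s (p := p)).
  apply: Def_exs; apply: Def_and.
    apply: Def_all => i.
    apply: (@Def_join _ (eqstr N) _ _ _ _ _ ys _ (fun (_ : unit) e => e (inr i))
      (fun j e => e (inl (inr (existT _ i j)))) (Def_sat _ _)) => [_|j]; coord.
  apply: (@Def_join _ (eqstr N) _ _ _ _ _ ys _ (fun u e => e (inl (inl u)))
      (fun j e => e (inr j)) (Def_sat _ _)) => u; coord.
pose G x := match x return (forall v, N (vjoin ws (tp_ctx (X := H)) v)) ->
    eqstr N (vjoin us zs x) with
  | inl u => fun e => F u (fun w => e (inl w))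
  | inr (existT i j) => f i j end.
have hG x : erep (G x).
  case: x => [u|[i j]]; last by have [] := hf i j.
  exact: (erep_subst (hF u) (fun w => TFun_var (vs := vjoin ws (tp_ctx (X := H))) (inl w))).
have [q hq] := Def_eqstr hQ hG.
exists q => e; rewrite hq; split=> [[y [hy]]|h].
  have -> // : y = pf_par p.
  apply: fext => i; have [_ /(_ (y i))[+ _]] := hp i; apply.
  move: (hy i); rewrite /psat; congr (sat _ _); congr ejoin.
  by apply: fext => j /=; have [_ ->] := hf i j.
exists (pf_par p); split=> // i.
have [_ /(_ (pf_par p i))[_]] := hp i => /(_ erefl); congr (sat _ _); congr ejoin.
by apply: fext => j /=; have [_ ->] := hf i j.
Qed.

End Imaginaries.

(** * Definability over a set of parameters *)

Section DefinableOver.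
Variables (L : lang) (N : str L) (G : set (elt N)).

(** All of [G] enters as a context of variables evaluated at themselves, so that two predicates over
    [G] share their parameters. The passage to a finite tuple of parameters is made in
    [pform_DefG]. *)
Definition DefG V (vs : V -> lsort L) (P : (forall v, N (vs v)) -> Prop) :=
  exists Q, Def (vs := vjoin vs (tp_ctx (X := G))) Q /\
    forall e, P e <-> Q (ejoin e (hval (H := G))).

Section Closure.
Variables (V : Type) (vs : V -> lsort L).
Implicit Types P Q : (forall v, N (vs v)) -> Prop.

Lemma DefG_Def P : Def P -> DefG P.
Proof.
move=> h; exists (fun e => P (fun v => e (inl v))); split=> //.
exact: (Def_subst h (fun v => TFun_var (vs := vjoin vs (tp_ctx (X := G))) (inl v))).
Qed.

Lemma DefG_ext P Q : DefG P -> (forall e, P e <-> Q e) -> DefG Q.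
Proof. by move=> [R [hR h]] E; exists R; split=> // e; rewrite -E. Qed.

Lemma DefG_not P : DefG P -> DefG (fun e => ~ P e).
Proof. by move=> [R [hR h]]; exists (fun e => ~ R e); split; [exact: Def_not|move=> e; rewrite h]. Qed.

Lemma DefG_and P Q : DefG P -> DefG Q -> DefG (fun e => P e /\ Q e).
Proof.
move=> [R [hR h]] [S [hS h']]; exists (fun e => R e /\ S e).
by split; [exact: Def_and|move=> e; rewrite h h'].
Qed.

Lemma DefG_iff P Q : DefG P -> DefG Q -> DefG (fun e => P e <-> Q e).
Proof.
move=> [R [hR h]] [S [hS h']]; exists (fun e => R e <-> S e).
by split; [exact: Def_iff|move=> e; rewrite h h'].
Qed.

Lemma DefG_all (T : finType) (P : T -> (forall v, N (vs v)) -> Prop) :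
  (forall t, DefG (P t)) -> DefG (fun e => forall t, P t e).
Proof.
move=> /choice[R h]; exists (fun e => forall t, R t e); split.
  by apply: Def_all => t; have [] := h t.
by move=> e; split=> H t; have [_ E] := h t; apply/E.
Qed.

Lemma DefG_pform (p : pform N vs) : params_in G p -> DefG (psat p).
Proof.
move=> hp; pose ws := vjoin vs (tp_ctx (X := G)).
pose P i : {x | G x} := exist _ (Elt (pf_par p i)) (hp i).
exists (fun e => sat (pf_fm p) (ejoin (fun v => e (inl v)) (fun i => e (inr (P i))))).
split=> //; apply: (@Def_join _ N _ _ _ _ _ ws _ (fun v e => e (inl v))
  (fun i e => e (inr (P i))) (Def_sat N (pf_fm p))) => v; coord.
Qed.

Lemma pform_DefG P : DefG P -> exists p : pform N vs,
  params_in G p /\ forall e, psat p e <-> P e.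
Proof.
move=> [Q [/Def_support[n [f [q hq]]] h]].
exists (PForm q (fun i => hval (f i))); split=> [i|e] /=.
  by rewrite /hval; case: (f i) => -[s x] hx.
by rewrite h -hq.
Qed.

End Closure.

Lemma DefG_subst U (us : U -> lsort L) (P : (forall u, N (us u)) -> Prop)
    V (vs : V -> lsort L) (F : forall u, (forall v, N (vs v)) -> N (us u)) :
  DefG P -> (forall u, exists f, @TFun L N _ (vjoin vs (tp_ctx (X := G))) (us u) f /\
    forall e, F u e = f (ejoin e (hval (H := G)))) ->
  DefG (fun e => P (fun u => F u e)).
Proof.
move=> [Q [hQ h]] /dchoice[f hf].
pose ws := vjoin vs (tp_ctx (X := G)).
exists (fun e => Q (ejoin (fun u => f u e) (fun y => e (inr y)))); split.
  apply: (@Def_join _ N _ _ _ _ _ ws _ f (fun y e => e (inr y)) hQ) => u.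
    by have [] := hf u.
  coord.
move=> e; rewrite h (_ : (fun u => F u e) = fun u => f u (ejoin e (hval (H := G)))) //.
by apply: fext => u; have [_ ->] := hf u.
Qed.

Lemma DefG_reindex U (us : U -> lsort L) (P : (forall u, N (us u)) -> Prop)
    V (vs : V -> lsort L) (F : forall u, (forall v, N (vs v)) -> N (us u)) :
  DefG P -> (forall u, TFun (F u)) -> DefG (fun e => P (fun u => F u e)).
Proof.
move=> hP hF; apply: DefG_subst hP _ => u.
exists (fun e => F u (fun v => e (inl v))); split=> //.
exact: TFun_subst (hF u) (fun v => TFun_var (vs := vjoin vs (tp_ctx (X := G))) (inl v)).
Qed.

Lemma DefG_exinf V (vs : V -> lsort L) W (ws : W -> lsort L) (d0 : forall w, N (ws w))
    (P : (forall w, N (ws w)) -> (forall v, N (vs v)) -> Prop) :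
  DefG (vs := vjoin vs ws) (fun e => P (fun i => e (inr i)) (fun v => e (inl v))) ->
  DefG (fun e => exists d, P d e).
Proof.
move=> [Q [hQ h]].
pose us := vjoin (vjoin vs (tp_ctx (X := G))) ws.
exists (fun e => exists d, Q (ejoin (ejoin (vs := vs) (fun v => e (inl v)) d)
  (fun y => e (inr y)))).
split; last first.
  by move=> e; split=> -[d hd]; exists d; apply/(h (ejoin e d)).
apply: (Def_exinf d0).
pose F x := match x return (forall u, N (us u)) -> N (vjoin (vjoin vs ws) (tp_ctx (X := G)) x) with
  | inl (inl v) => fun e => e (inl (inl v)) | inl (inr w) => fun e => e (inr w)
  | inr y => fun e => e (inl (inr y)) end.
have hF x : TFun (F x).
  by case: x => [[v|w]|y]; [coord
    |coord|coord].
apply: Def_ext (Def_subst hQ hF) _ => e.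
by rewrite (_ : (fun u => F u e) = ejoin (ejoin (vs := vs) (ws := ws) (fun v => e (inl (inl v)))
  (fun w => e (inr w))) (fun y => e (inl (inr y)))) //; apply: fext => -[[]|].
Qed.

End DefinableOver.

(** * Forking in a reduct *)

Section Reduct.
Variables (L1 L : lang) (N1 : str L1) (N : str L) (h : lsort L1 -> lsort L).
Variables (to : forall s, N1 s -> N (h s)) (fr : forall s, N (h s) -> N1 s).
Hypothesis frK : forall s (x : N1 s), fr (to x) = x.
Hypothesis toK : forall s (x : N (h s)), to (fr x) = x.
Hypothesis interp_fun : forall f : fsym L1,
  TFun (vs := fun i => h (fdom (f := f) i))
    (fun y : forall i, N _ => to (sfun (fun i => fr (y i)))).
Hypothesis interp_rel : forall r : rsym L1,
  Def (vs := fun i => h (rdom (r := r) i))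
    (fun y : forall i, N _ => srel (fun i => fr (y i))).

Definition trace (X : set (elt N)) : set (elt N1) := [set x | X (Elt (to (projT2 x)))].

Variables (X D G : set (elt N)).

Definition restrict (v : forall x, N (tp_ctx (X := X) x)) :
    forall x, N1 (tp_ctx (X := trace X) x) :=
  fun x => fr (v (exist _ (Elt (to (projT2 (sval x)))) (svalP x))).

Lemma expand_fm n (s : 'I_n -> lsort L1) (fm : formula (vjoin (tp_ctx (X := trace X)) s)) :
  exists fm' : formula (vjoin (tp_ctx (X := X)) (fun i => h (s i))),
    forall v d, sat fm' (ejoin v d) <-> sat fm (ejoin (restrict v) (fun i => fr (d i))).
Proof.
pose ws := vjoin (tp_ctx (X := X)) (fun i => h (s i)).
pose y (x : {x | trace X x}) : {x | X x} := exist _ (Elt (to (projT2 (sval x)))) (svalP x).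
pose F x := match x return (forall w, N (ws w)) -> N (h (vjoin (tp_ctx (X := trace X)) s x)) with
  | inl x => fun e => e (inl (y x)) | inr i => fun e => e (inr i) end.
have hF x : TFun (F x).
  by case: x => [x|i]; [coord
    |coord].
have [q hq] := Def_interp frK toK interp_fun interp_rel fm hF.
exists q => v d; rewrite hq (_ : (fun u => fr (F u _)) = ejoin (restrict v) (fun i => fr (d i))) //.
by apply: fext => -[].
Qed.

Hypothesis indiscernible_expand : forall m (s : 'I_m -> lsort L1) (b : nat -> forall i, N1 (s i)),
  indiscernible (trace G) b -> indiscernible G (s := fun i => h (s i)) (fun k i => to (b k i)).

(** By [indiscernible_expand] the sequence witnessing division in the reduct stays indiscernible in
    the full structure. Its instances stay inconsistent, since a common solution would restrict to
    one in the reduct. *)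
Lemma forks_expand : type_forks (trace G) (tp (trace X) (trace D)) -> type_forks G (tp X D).
Proof.
move=> [q [[n [p [hp hpq]]] [m [r [hr hqr]]]]].
pose ex n s (fm : formula (vjoin (tp_ctx (X := trace X)) s)) := projT1 (cid (@expand_fm n s fm)).
have exP n' s fm v d : sat (@ex n' s fm) (ejoin v d) <->
    sat fm (ejoin (restrict v) (fun i => fr (d i))).
  exact: (projT2 (cid (@expand_fm n' s fm))).
pose hat (p : pform N1 (tp_ctx (X := trace X))) : pform N (tp_ctx (X := X)) :=
  PForm (ex _ _ (pf_fm p)) (fun i => to (pf_par p i)).
have hatP p' v : psat (hat p') v <-> psat p' (restrict v).
  rewrite /psat exP (_ : (fun i => fr (to (pf_par p' i))) = pf_par p') //.
  by apply: fext => i; rewrite frK.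
exists (hat q); split.
  exists n, (fun k => hat (p k)); split=> [k|v hv].
    have [hd hs] := hp k; split=> [i|]; first exact: hd i.
    apply/hatP; move: hs; congr psat; apply: fext => x.
    by rewrite /restrict /= frK.
  by apply/hatP; apply: hpq => k; apply/hatP.
exists m, (fun k => hat (r k)); split=> [k|v /hatP/hqr[k hk]]; last by exists k; apply/hatP.
have [b [b0 bI bC]] := hr k.
exists (fun j i => to (b j i)); split.
- by apply: fext => i; rewrite b0.
- exact: indiscernible_expand.
move=> hC; apply: bC => n' p' hp'.
have [f hf] := choice hp'.
have [v hv] := hC n' (fun j => PForm (ex _ _ (pf_fm (r k))) (fun i => to (b (f j) i)))
  (fun j => ex_intro _ (f j) erefl).
exists (restrict v) => j; have := hv j; rewrite hf /psat exP /=.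
by congr (sat _ (ejoin _ _)); apply: fext => i; rewrite frK.
Qed.

End Reduct.

Section DclClosed.
Variables (L : lang) (N : str L) (D : set (elt (eqstr N))).
Hypothesis dclD : D = dcl D.

Definition home_part : set (elt N) := [set x | D (home x)].

Lemma dcl_fun (f : fsym L) (a : forall i, N (fdom (f := f) i)) :
  (forall i, home_part (Elt (a i))) -> home_part (Elt (sfun a)).
Proof.
move=> ha; rewrite /home_part /= dclD.
pose ws := vjoin (ctx1 (inl (fcod f) : lsort (eqlang N))) (fun i => inl (fdom (f := f) i)).
pose fm := @feq (eqlang N) _ ws (inl (fcod f)) (@tvar (eqlang N) _ ws (inl tt))
  (@tapp (eqlang N) _ ws (inl f) (fun i => @tvar (eqlang N) _ ws (inr i))).
exists (@PForm (eqlang N) (eqstr N) unit _ _ _ fm a).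
by split=> [i|y]; [exact: ha|split].
Qed.

Lemma generated_home_part x : generated home_part x -> home_part x.
Proof. by elim=> // f a _ IH; exact: dcl_fun. Qed.

End DclClosed.

(** * Saturation and indiscernible sequences *)

Section Ramsey.

Definition increasing (h : nat -> nat) := forall i j, (i < j)%N -> (h i < h j)%N.

Lemma increasing_comp g h : increasing g -> increasing h -> increasing (g \o h).
Proof. by move=> hg hh i j ij; apply/hg/hh. Qed.

Lemma increasingS h : (forall i, (h i < h i.+1)%N) -> increasing h.
Proof. by move=> hS i j ij; apply: (homo_ltn ltn_trans). Qed.

Lemma sorted_increasing h s : increasing h -> sorted ltn s -> sorted ltn (map h s).
Proof. by move=> hh; exact: homo_sorted. Qed.

(** The pair [x] packs an arity with a relation, so that relations of different arities fit in one
    list. *)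
Definition homogeneous (h : nat -> nat) (x : nat * (seq nat -> Prop)) :=
  forall s s', sorted ltn s -> sorted ltn s' -> size s = x.1 -> size s' = x.1 ->
    (x.2 (map h s) <-> x.2 (map h s')).

Lemma pigeonhole (P : nat -> Prop) :
  exists h, increasing h /\ forall i j, P (h i) <-> P (h j).
Proof.
case: (pselect (forall m, exists k, (m <= k)%N /\ P k)) => [/choice[f hf]|].
  pose h := fix h i := if i is j.+1 then f (h j).+1 else f 0%N.
  exists h; split=> [|i j].
    by apply: increasingS => i /=; have [] := hf (h i).+1.
  have H k : P (h k) by case: k => [|k]; [have [] := hf 0%N|have [] := hf (h k).+1].
  by split.
move=> /existsNP[m hm]; exists (addn m); split=> [i j ij|i j]; first by rewrite ltn_add2l.
have H k : ~ P (m + k)%N by move=> hk; apply: hm; exists (m + k)%N; rewrite leq_addr.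
by split=> /H.
Qed.

(** Iterated thinning makes the truth of [R] on increasing sequences from the diagonal [x] depend on
    the first element only; the pigeonhole principle then removes this dependence. *)
Lemma ramsey n (R : seq nat -> Prop) : exists h, increasing h /\ homogeneous h (n, R).
Proof.
elim: n R => [|n IH] R.
  by exists id; split=> // s s' _ _ /size0nil-> /size0nil->.
have IHg (g : nat -> nat) := IH (fun s => R (g 0%N :: map (g \o succn) s)).
have [F hF] := choice IHg.
(* Drops the first element of the subsequence [g] and thins the rest until [R (g 0 :: _)] is
   constant on it. *)
pose next g := g \o succn \o F g.
pose g k := iter k next id.
have hg k : increasing (g k).
  elim: k => // k IHk; apply: increasing_comp; last by have [] := hF (g k).
  exact: increasing_comp.
pose x k := g k 0%N.
have hx : increasing x.
  by apply: increasingS => k; apply: hg.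
have xg m j y : exists i, g (m + j)%N y = g m i.
  elim: j y => [|j IHj] y; first by exists y; rewrite addn0.
  by rewrite addnS; exact: IHj.
have cst k s s' : path ltn k s -> path ltn k s' -> size s = n -> size s' = n ->
    R (map x (k :: s)) <-> R (map x (k :: s')).
  (* The elements of the diagonal after [x k] all lie on the subsequence [g k.+1], at the increasing
     positions [c]. *)
  have [c hc] := choice (fun j => xg k.+1 j 0%N).
  have ci : increasing c.
    move=> i j ij; rewrite ltnNge; apply/negP => ji.
    have : (g k.+1 (c j) <= g k.+1 (c i))%N.
      by move: ji; rewrite leq_eqVlt => /predU1P[->//|/hg/ltnW].
    rewrite -!hc leqNgt => /negP; apply; apply: (hx (k.+1 + i)%N (k.+1 + j)%N).
    by rewrite ltn_add2l.
  pose u e := c (e - k.+1)%N.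
  have E t : path ltn k t -> map x t = map (g k \o succn) (map (F (g k)) (map u t)) /\
      sorted ltn (map u t).
    move=> pt; have ht e : e \in t -> (k < e)%N by exact: (allP (order_path_min ltn_trans pt)).
    split.
      rewrite -!map_comp; apply/eq_in_map => e /ht ke.
      by rewrite /u /= -[in LHS](subnKC ke); exact: hc.
    have /homo_sorted_in : {in [pred e | (k < e)%N] &, {homo u : y z / (y < z)%N}}.
      by move=> y z /= ky kz yz; apply: ci; exact: ltn_sub2r (leq_ltn_trans ky yz) yz.
    by apply; [apply/allP => e /ht|exact: path_sorted pt].
  move=> /E[/= -> st] /E[-> st'] zt zt'.
  have [_ hh] := hF (g k); have := hh (map u s) (map u s') st st'.
  by rewrite !size_map; exact.
have [h' [h'i hC]] := pigeonhole (fun k => R (map x (k :: iota k.+1 n))).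
exists (x \o h'); split=> [|s s']; first exact: increasing_comp.
rewrite !(map_comp x h') => /(sorted_increasing h'i) ss /(sorted_increasing h'i) ss' zs zs'.
have H t : sorted ltn (map h' t) -> size t = n.+1 -> exists i,
    R (map x (map h' t)) <-> R (map x (h' i :: iota (h' i).+1 n)).
  case: t => // i t pt [zt]; exists i; apply: cst => //; rewrite ?size_map ?size_iota //.
  have : sorted ltn (iota (h' i) n.+1) by exact: iota_ltn_sorted.
  by [].
have [i Hi] := H _ ss zs; have [j Hj] := H _ ss' zs'.
exact: iff_trans Hi (iff_trans (hC i j) (iff_sym Hj)).
Qed.

Lemma ramsey_seq (l : seq (nat * (seq nat -> Prop))) :
  exists h, increasing h /\ forall x, List.In x l -> homogeneous h x.
Proof.
elim: l => [|[n R] l [h [hi hh]]]; first by exists id; split=> // ? [].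
have [g [gi hg]] := ramsey n (fun s => R (map h s)).
exists (h \o g); split=> [|x]; first exact: increasing_comp.
case=> [<-|/hh hx] s s' ss ss' zs zs'; rewrite !(map_comp h g); first exact: hg.
by apply: hx; rewrite ?size_map //; exact: sorted_increasing.
Qed.

Lemma mkseq_ord n (a : 'I_n -> nat) : (forall i j : 'I_n, (i < j)%N -> (a i < a j)%N) ->
  exists s, [/\ sorted ltn s, size s = n & forall i : 'I_n, nth 0%N s i = a i].
Proof.
move=> ha; pose F k := odflt 0%N (omap a (insub k)).
have FE (i : 'I_n) : F i = a i by rewrite /F valK.
exists (mkseq F n); split; rewrite ?size_mkseq //; last by move=> i; rewrite nth_mkseq.
apply/(sortedP 0%N) => i; rewrite size_mkseq => hi.
rewrite !nth_mkseq //; last exact: ltnW.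
by rewrite (FE (Ordinal hi)) (FE (Ordinal (ltnW hi))); exact: ha.
Qed.

End Ramsey.

Section ParamTerms.
Variables (L : lang) (N : str L).

Lemma DefG_mono (G G' : set (elt N)) V (vs : V -> lsort L) (P : (forall v, N (vs v)) -> Prop) :
  G `<=` G' -> DefG G P -> DefG G' P.
Proof.
move=> GG' [Q [hQ h]]; pose ws := vjoin vs (tp_ctx (X := G')).
pose y (x : {x | G x}) : {x | G' x} := exist _ (sval x) (GG' _ (svalP x)).
exists (fun e => Q (ejoin (fun v => e (inl v)) (fun x => e (inr (y x))))); split=> //.
apply: (@Def_join _ N _ _ _ _ _ ws _ (fun v e => e (inl v)) (fun x e => e (inr (y x))) hQ) => x; coord.
Qed.

Definition TFunG (G : set (elt N)) V (vs : V -> lsort L) s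
    (F : (forall v, N (vs v)) -> N s) :=
  exists f, @TFun L N _ (vjoin vs (tp_ctx (X := G))) s f /\
    forall e, F e = f (ejoin e (hval (H := G))).

Lemma TFunG_TFun G V (vs : V -> lsort L) s (F : (forall v, N (vs v)) -> N s) :
  TFun F -> TFunG G F.
Proof.
move=> hF; exists (fun e => F (fun v => e (inl v))); split=> //.
exact: TFun_subst hF (fun v => TFun_var (vs := vjoin vs (tp_ctx (X := G))) (inl v)).
Qed.

Lemma TFunG_param (G : set (elt N)) V (vs : V -> lsort L) s (a : N s) :
  G (Elt a) -> TFunG G (fun _ : forall v, N (vs v) => a).
Proof.
move=> h; exists (fun e => e (inr (exist _ (Elt a) h))); split=> //.
coord.
Qed.

Lemma DefG_eq G V (vs : V -> lsort L) s (f g : (forall v, N (vs v)) -> N s) :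
  TFunG G f -> TFunG G g -> DefG G (fun e => f e = g e).
Proof.
move=> [f' [hf Ef]] [g' [hg Eg]]; exists (fun e => f' e = g' e); split; first exact: Def_eq.
by move=> e; rewrite Ef Eg.
Qed.

End ParamTerms.

Lemma countable_setU T (X Y : set T) : countable X -> countable Y -> countable (X `|` Y).
Proof.
move=> hX hY; have -> : X `|` Y = \bigcup_(b in [set: bool]) (if b then X else Y).
  apply/seteqP; split=> [x [h|h]|x [[] _ h]]; [by exists true|by exists false|by left|by right].
by apply: bigcup_countable => // -[].
Qed.

(** * Realising finitely satisfiable families *)

Section Saturation.
Variables (L : lang) (N : str L) (G : set (elt N)).
Hypothesis sat1 : forall E : set (elt N), countable E ->
  forall s (P : set (pform N (ctx1 s))), (forall p, P p -> params_in (G `|` E) p) ->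
  consistent P -> exists y : N s, forall p, P p -> psat p (fun=> y).

(** The type [T] may be empty, so this property includes that [X] has a point. *)
Definition fip X (F : set (X -> Prop)) := forall (T : finType) (P : T -> X -> Prop),
  (forall t, F (P t)) -> exists x, forall t, P t x.

Lemma sat_set E s (F : set (N s -> Prop)) : countable E ->
  (forall P, F P -> DefG (G `|` E) (vs := ctx1 s) (fun e => P (e tt))) -> fip F ->
  exists y, forall P, F P -> P y.
Proof.
move=> hE hF fipF.
pose Q := [set p : pform N (ctx1 s) | params_in (G `|` E) p /\
  exists2 P, F P & forall e, psat p e <-> P (e tt)].
have [|n p hp|y hy] := sat1 (P := Q) hE; first by move=> p [].
  have /choice[P hP] : forall k, exists P, F P /\ forall e, psat (p k) e <-> P (e tt).
    by move=> k; have [_ [P ? ?]] := hp k; exists P.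
  have [y hy] := fipF _ P (fun k => (hP k).1).
  by exists (fun=> y) => k; have [_ E'] := hP k; apply/E'.
exists y => P FP; have [p [hp hpE]] := pform_DefG (hF P FP).
by have /hpE := hy p (conj hp (ex_intro2 _ _ P FP hpE)).
Qed.

(** Saturation in one variable is iterated. The first coordinate realises the finite conjunctions of
    [F] with the other coordinates quantified out, and joins the countable set [E] of parameters for
    the rest. *)
Lemma sat_tuple n (ts : 'I_n -> lsort L) E (F : set ((forall i, N (ts i)) -> Prop)) :
  countable E -> (forall P, F P -> DefG (G `|` E) P) -> fip F ->
  exists y, forall P, F P -> P y.
Proof.
elim: n ts E F => [|n IH] ts E F hE hF fipF.
  have [y _] := fipF void (fun=> fun=> True) (fun v => match v with end).
  exists y => P FP; have [z /(_ tt)] := fipF unit (fun=> P) (fun=> FP).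
  by congr P; apply: fext => -[].
(* The empty conjunction gives a point, whose coordinates are the defaults required by
   [DefG_exinf]. *)
have [y0 _] := fipF void (fun=> fun=> True) (fun v => match v with end).
pose dc (y : N (ts ord0)) d := dcons (S := fun i => N (ts i)) y d.
pose F1 := [set Q : N (ts ord0) -> Prop | exists (T : finType) P, (forall t : T, F (P t)) /\
  Q = fun y => exists d, forall t, P t (dc y d)].
have [||y hy] := @sat_set E _ F1 hE.
- move=> Q [T [P [hP ->]]]; apply: (DefG_exinf (fun i => y0 (lift ord0 i))).
  apply: DefG_all => t.
  pose ws := vjoin (ctx1 (ts ord0)) (fun i => ts (lift ord0 i)).
  apply: (DefG_reindex (vs := ws) (F := fun i e => dc (e (inl tt)) (fun j => e (inr j)) i)
    (hF _ (hP t))) => i.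
  apply: TFun_dcons => [|j]; first coord.
  coord.
- move=> T Q /choice[T' /dchoice[P hP]].
  have [|y hy] := fipF {t : T & T' t} (fun x => P (projT1 x) (projT2 x)).
    by case=> t t'; have [h _] := hP t; exact: h.
  exists (y ord0) => t; have [_ ->] := hP t.
  exists (fun j => y (lift ord0 j)) => t'.
  by rewrite /dc (dcons_eta (S := fun i => N (ts i))); exact: hy (existT _ t t').
pose F2 := [set Q : (forall i, N (ts (lift ord0 i))) -> Prop | exists2 P, F P &
  Q = fun d => P (dc y d)].
have [|||d hd] := IH _ (E `|` [set Elt y]) F2.
- by apply: countable_setU.
- move=> Q [P FP ->].
  have hP : DefG (G `|` (E `|` [set Elt y])) P.
    by apply: DefG_mono (hF P FP) => x [?|?]; [left|right; left].
  apply: DefG_subst hP _ => i.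
  case: (unliftP ord0 i) => [j|] E'; subst i.
    have [f [hf Ef]] := TFunG_TFun (G `|` (E `|` [set Elt y]))
      (TFun_var (N := N) (vs := fun i => ts (lift ord0 i)) j).
    by exists f; split=> // e; rewrite -Ef /dc dconsS.
  have [|f [hf Ef]] := @TFunG_param _ _ (G `|` (E `|` [set Elt y])) _
    (fun i => ts (lift ord0 i)) _ y; first by right; right.
  by exists f; split=> // e; rewrite -Ef /dc dcons0.
- move=> T Q hQ.
  have /choice[P hP] : forall t, exists P, F P /\ Q t = fun d => P (dc y d).
    by move=> t; have [P ? ?] := hQ t; exists P.
  have [|d hd] := hy (fun y => exists d, forall t, P t (dc y d)).
    by exists T, P; split=> // t; have [] := hP t.
  by exists d => t; have [_ ->] := hP t.
exists (dc y d) => P FP.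
exact: (hd (fun d => P (dc y d)) (ex_intro2 _ _ P FP erefl)).
Qed.

End Saturation.

Section TermsG.
Variables (L : lang) (N : str L) (G : set (elt N)).

Lemma TFunG_app V (vs : V -> lsort L) (f : fsym L)
    (F : forall i, (forall v, N (vs v)) -> N (fdom (f := f) i)) :
  (forall i, TFunG G (F i)) -> TFunG G (fun e => sfun (fun i => F i e)).
Proof.
move=> /dchoice[g hg]; exists (fun e => sfun (fun i => g i e)); split.
  by apply: TFun_app => i; have [] := hg i.
by move=> e; congr sfun; apply: fext => i; have [_ ->] := hg i.
Qed.

Lemma TFun_cast V (vs : V -> lsort L) v s (h : vs v = s) :
  TFun (vs := vs) (fun e => eq_rect (vs v) (car N) (e v) s h).
Proof. by case: s / h => /=; exact: TFun_var. Qed.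

End TermsG.

(** * Indiscernible sequences through a given tuple *)

Section Sequences.
Variables (L : lang) (N : str L) (G : set (elt N)).
Hypothesis sat1 : forall E : set (elt N), countable E ->
  forall s (P : set (pform N (ctx1 s))), (forall p, P p -> params_in (G `|` E) p) ->
  consistent P -> exists y : N s, forall p, P p -> psat p (fun=> y).
Variables (r : nat) (ts : 'I_r -> lsort L).

Definition row_ctx (I : Type) (x : I * 'I_r) := ts x.2.
Notation Z := (forall x : nat * 'I_r, N (row_ctx x)).
Implicit Types (z : Z) (P : Z -> Prop).

Lemma DefG_bound H P : DefG H (vs := @row_ctx nat) P ->
  exists m, forall z z', (forall i t, (i < m)%N -> z (i, t) = z' (i, t)) -> P z -> P z'.
Proof.
move=> [Q [hQ h]].
pose ws := vjoin (tp_ctx (X := H)) (@row_ctx nat).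
have hQ' : Def (vs := ws) (fun e => Q (ejoin (fun x => e (inr x)) (fun y => e (inl y)))).
  apply: (@Def_join _ N _ _ _ _ _ ws _ (fun x e => e (inr x)) (fun y e => e (inl y)) hQ) => x; coord.
have [n [f [q hq]]] := Def_support hQ'.
exists (\max_(i < n) (f i).1).+1 => z z' zz'; rewrite !h.
move=> /(hq (hval (H := H)) z) hz; apply/(hq (hval (H := H)) z'); move: hz.
congr (sat q (ejoin _ _)); apply: fext => i.
have hi : ((f i).1 < (\max_(i < n) (f i).1).+1)%N by rewrite ltnS; exact: leq_bigmax.
by have := zz' _ (f i).2 hi; case: (f i).
Qed.

(** The rows are chosen one by one under the invariant [ext j]: every finite part of [S] has a
    solution with the same first [j] rows. The limit satisfies each predicate of [S], because each
    looks at finitely many rows only. *)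
Lemma sat_sequence E (S : set (Z -> Prop)) : countable E ->
  (forall P, S P -> DefG (G `|` E) (vs := @row_ctx nat) P) -> fip S ->
  exists z, forall P, S P -> P z.
Proof.
move=> hE hS fipS.
pose ext j z := forall (T : finType) (P : T -> Z -> Prop), (forall t, S (P t)) ->
  exists z', (forall (i : 'I_j) t, z' (i : nat, t) = z (i : nat, t)) /\ forall t, P t z'.
have step j z : ext j z -> exists z',
    (forall (i : 'I_j) t, z' (i : nat, t) = z (i : nat, t)) /\ ext j.+1 z'.
  move=> hz.
  pose F := [set Q : (forall i, N (ts i)) -> Prop | exists (T : finType) (P : T -> Z -> Prop),
    (forall t : T, S (P t)) /\ Q = fun d => exists z' : Z,
      (forall (i : 'I_j) t, z' (i : nat, t) = z (i : nat, t)) /\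
      (forall t, z' (j, t) = d t) /\ forall t, P t z'].
  pose E' := E `|` (fun p => Elt (z p)) @` [set: nat * 'I_r].
  have hE' : countable E'.
    by apply: countable_setU => //; apply: card_le_trans (card_image_le _ _) _; exact: countableP.
  have [||d hd] := sat_tuple sat1 (F := F) hE'.
  - move=> Q [T [P [hP ->]]]; apply: (DefG_exinf z).
    pose ws := vjoin ts (@row_ctx nat).
    have zv x : @TFunG _ N (G `|` E') _ ws _ (fun e => e (inr x)).
      exact: TFunG_TFun (TFun_var (vs := ws) (inr x)).
    apply: DefG_and; last apply: DefG_and.
    + apply: DefG_all => i; apply: DefG_all => t; apply: (DefG_eq (zv _)).
      by apply: TFunG_param; right; right; exists (i : nat, t).
    + apply: DefG_all => t; apply: (DefG_eq (zv _)).
      exact: TFunG_TFun (TFun_var (vs := ws) (inl t)).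
    + apply: DefG_all => t; have hPt : DefG (G `|` E') (vs := @row_ctx nat) (P t).
        by apply: DefG_mono (hS _ (hP t)) => x [?|?]; [left|right; left].
      exact: (DefG_subst hPt zv).
  - move=> T Q /choice[T' /dchoice[P hP]].
    have [|z' [zz' hz']] := hz {t : T & T' t} (fun x => P (projT1 x) (projT2 x)).
      by case=> t t'; have [h _] := hP t; exact: h.
    exists (fun i => z' (j, i)) => t; have [_ ->] := hP t.
    by exists z'; split=> //; split=> // t'; exact: hz' (existT _ t t').
  pose z1 : Z := fun x => if x.1 == j then d x.2 else z x.
  have z1j t : z1 (j, t) = d t by rewrite /z1 /= eqxx.
  have z1i (i : 'I_j) t : z1 (i : nat, t) = z (i : nat, t).
    by rewrite /z1 /= ltn_eqF.
  exists z1; split=> // T P hP.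
  have [|z' [zz' [dz' hz']]] := hd (fun d => exists z' : Z,
      (forall (i : 'I_j) t, z' (i : nat, t) = z (i : nat, t)) /\
      (forall t, z' (j, t) = d t) /\ forall t, P t z'); first by exists T, P.
  exists z'; split=> // i t; have := ltn_ord i; rewrite ltnS leq_eqVlt => /predU1P[E0|hi].
    by rewrite E0 dz' z1j.
  by have := zz' (Ordinal hi) t; have := z1i (Ordinal hi) t => /= -> ->.
have [z0 _] := fipS void (fun=> fun=> True) (fun v => match v with end).
have e0 : ext 0%N z0 by move=> T P /fipS[z hz]; exists z; split=> // -[].
pose nx j z := match pselect (exists z', (forall (i : 'I_j) t, z' (i : nat, t) = z (i : nat, t))
   /\ ext j.+1 z') with left h => projT1 (cid h) | right _ => z end.
pose zz := fix zz j := if j is i.+1 then nx i (zz i) else z0.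
have zzP j : ext j (zz j) /\ forall (i : 'I_j) t, zz j.+1 (i : nat, t) = zz j (i : nat, t).
  elim: j => [|j [IH _]]; last first.
    have e1 : ext j.+1 (zz j.+1).
      rewrite /= /nx; case: pselect => [h|[]]; last exact: step.
      by have [] := projT2 (cid h).
    split=> //; rewrite [zz j.+2]/= /nx; case: pselect => [h|[]]; last exact: step.
    by have [] := projT2 (cid h).
  by split=> // -[].
pose z : Z := fun x => zz x.1.+1 x.
have zE j i t : (i < j)%N -> zz j (i, t) = z (i, t).
  elim: j => // j IH; rewrite ltnS leq_eqVlt => /predU1P[->|ij] //.
  have [_ h] := zzP j; rewrite -IH //; exact: (h (Ordinal ij) t).
exists z => P SP; have [m hm] := DefG_bound (hS P SP).
have [em _] := zzP m; have [z' [h1 h2]] := em unit (fun=> P) (fun=> SP).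
apply: hm (h2 tt) => i t im; rewrite -(zE _ _ _ im); exact: (h1 (Ordinal im) t).
Qed.

Definition incr n (a : 'I_n -> nat) := forall i j : 'I_n, (i < j)%N -> (a i < a j)%N.

Definition rows n (b : nat -> forall t, N (ts t)) (a : 'I_n -> nat) :
    forall x : 'I_n * 'I_r, N (row_ctx x) := fun x => b (a x.1) x.2.

Definition indG (b : nat -> forall t, N (ts t)) :=
  forall n (P : (forall x : 'I_n * 'I_r, N (row_ctx x)) -> Prop), DefG G (vs := @row_ctx _) P ->
  forall a a', incr a -> incr a' -> P (rows b a) <-> P (rows b a').

(* Ramsey's theorem and compactness: it suffices to find a sequence with the pattern
   [K] in each formula of the type of [c]. *)
Lemma indiscernible_through (c : forall t, N (ts t)) k
    (K : (forall x : 'I_k * 'I_r, N (row_ctx x)) -> Prop) :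
  DefG G (vs := @row_ctx _) K ->
  (forall chi : (forall t, N (ts t)) -> Prop, DefG G chi -> chi c ->
     exists s : nat -> forall t, N (ts t),
       (forall i, chi (s i)) /\ forall a, incr a -> K (rows s a)) ->
  exists b, [/\ b 0%N = c, indG b & forall a, incr a -> K (rows b a)].
Proof.
move=> hK hc.
pose zrow n (z : Z) (a : 'I_n -> nat) : forall x : 'I_n * 'I_r, N (row_ctx x) :=
  fun x => z (a x.1, x.2).
pose S1 := [set P : Z -> Prop | exists n (Q : (forall x : 'I_n * 'I_r, N (row_ctx x)) -> Prop) a a',
  [/\ DefG G (vs := @row_ctx _) Q, incr a, incr a' &
   P = fun z => Q (zrow n z a) <-> Q (zrow n z a')]].
(* [S1] asks for indiscernibility, [S2] for the pattern [K] on all increasing rows, and [P3] for [c]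
   as the initial row. *)
pose S2 := [set P : Z -> Prop | exists a, incr a /\ P = fun z => K (zrow k z a)].
pose P3 (z : Z) := forall t, z (0%N, t) = c t.
pose S := S1 `|` S2 `|` [set P3].
pose E := (fun t => Elt (c t)) @` [set: 'I_r].
have hE : countable E.
  by apply: card_le_trans (card_image_le _ _) _; exact: countableP.
have hrow n (Q : (forall x : 'I_n * 'I_r, N (row_ctx x)) -> Prop) a : DefG G (vs := @row_ctx _) Q ->
    DefG G (vs := @row_ctx nat) (fun z => Q (zrow n z a)).
  move=> hQ; apply: (DefG_reindex (vs := @row_ctx nat) (F := fun x z => z (a x.1, x.2)) hQ) => x.
  coord.
have S12 P : (S1 `|` S2) P -> DefG G (vs := @row_ctx nat) P.
  case=> [[n [Q [a [a' [hQ _ _ ->]]]]]|[a [_ ->]]]; last exact: hrow.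
  by apply: DefG_iff; exact: hrow.
have hS P : S P -> DefG (G `|` E) (vs := @row_ctx nat) P.
  case=> [/S12|->]; first by apply: DefG_mono => x; left.
  apply: DefG_all => t; apply: DefG_eq.
    exact: TFunG_TFun (TFun_var (vs := @row_ctx nat) (0%N, t)).
  by apply: TFunG_param; right; exists t.
have fipS : fip S.
  move=> T P hP.
  pose Xi z := forall t, (S1 `|` S2) (P t) -> P t z.
  have hXi : DefG G (vs := @row_ctx nat) Xi.
    apply: DefG_all => t; case: (pselect ((S1 `|` S2) (P t))) => h.
      by apply: DefG_ext (S12 _ h) _ => z; split=> [|/(_ h)].
    by apply: DefG_ext (DefG_Def _ (Def_const True)) _.
  pose eta (y : forall t, N (ts t)) := exists z : Z, (forall t, z (0%N, t) = y t) /\ Xi z.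
  have heta : DefG G eta.
    apply: (DefG_exinf (fun x : nat * 'I_r => c x.2 : N (row_ctx x))).
    pose ws := vjoin ts (@row_ctx nat).
    apply: DefG_and.
      apply: DefG_all => t; apply: DefG_eq.
        exact: TFunG_TFun (TFun_var (vs := ws) (inr (0%N, t))).
      exact: TFunG_TFun (TFun_var (vs := ws) (inl t)).
    exact: (DefG_reindex (vs := ws) (F := fun x e => e (inr x)) hXi
      (fun x => TFun_var (vs := ws) (inr x))).
  suff [z [z0 hz]] : eta c.
    exists z => t; case: (hP t) => [h|E3]; first exact: hz.
    by rewrite E3.
  apply: contrapT => hn.
  have [s [hs hKs]] := hc _ (DefG_not heta) hn.
  have H t : exists x : nat * (seq nat -> Prop), forall h, increasing h -> homogeneous h x ->
      (S1 `|` S2) (P t) -> P t (fun x => s (h x.1) x.2).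
    case: (pselect (S1 (P t))) => [[n [Q [a [a' [hQ ha ha' ->]]]]]|nh].
      exists (n, fun l => Q (fun x => s (nth 0%N l x.1) x.2)) => h hi hh _.
      have [l [sl zl nl]] := mkseq_ord ha; have [l' [sl' zl' nl']] := mkseq_ord ha'.
      have := hh l l' sl sl' zl zl'; rewrite /= => hQQ.
      have E1 : (fun x : 'I_n * 'I_r => s (nth 0%N (map h l) x.1) x.2) =
          zrow n (fun x => s (h x.1) x.2) a.
        by apply: fext => x; rewrite /zrow (nth_map 0%N) ?zl // nl.
      have E2 : (fun x : 'I_n * 'I_r => s (nth 0%N (map h l') x.1) x.2) =
          zrow n (fun x => s (h x.1) x.2) a'.
        by apply: fext => x; rewrite /zrow (nth_map 0%N) ?zl' // nl'.
      by move: hQQ; rewrite E1 E2.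
    exists (0%N, fun=> True) => h hi _ [//|[a [ha ->]]].
    by apply: (hKs (h \o a)) => i j ij; apply/hi/ha.
  have [x hx] := choice H.
  have [h [hi hh]] := ramsey_seq (map x (enum T)).
  apply: (hs (h 0%N)); exists (fun x => s (h x.1) x.2); split=> // t.
  apply: hx => //; apply: hh; apply: List.in_map.
  have : t \in enum T by rewrite mem_enum.
  by elim: (enum T) => //= u l IH; rewrite inE => /predU1P[->|/IH]; [left|right].
have [z hz] := sat_sequence hE hS fipS.
exists (fun i t => z (i, t)); split=> [|n P hP a a' ha ha'|a ha].
- by apply: fext => t; apply: (hz P3); right.
- by apply: (hz (fun z => P (zrow n z a) <-> P (zrow n z a'))); left; left; exists n, P, a, a'.
- by apply: (hz (fun z => K (zrow k z a))); left; right; exists a.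
Qed.

End Sequences.

(** * Saturation over countably many additional parameters *)

Section TrivialSorts.
Local Open Scope card_scope.
Variables (L : lang) (N : str L).

Let ctx0 (i : 'I_0) : lsort L := match notF (ltn_ord i) with end.

Fixpoint and_true V (vs : V -> lsort L) n : formula vs :=
  if n is m.+1 then fand (ftrue vs) (and_true vs m) else ftrue vs.

Lemma sat_and_true V (vs : V -> lsort L) n (e : forall v, N (vs v)) : sat (and_true vs n) e.
Proof. by elim: n => //= n IH. Qed.

Fixpoint and_depth V (vs : V -> lsort L) (p : formula vs) : nat :=
  if p is fand _ q then (and_depth q).+1 else 0%N.

Lemma and_true_depth V (vs : V -> lsort L) n : and_depth (and_true vs n) = n.
Proof. by elim: n => //= n ->. Qed.

Lemma true_equiv n : RelationClasses.Equivalence (fun x y : forall i, N (ctx0 i) =>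
  sat (and_true (vjoin ctx0 ctx0) n) (ejoin x y)).
Proof. by split; [move=> x|move=> x y _|move=> x y z _ _]; exact: sat_and_true. Qed.

(* The sentences [and_true n] define infinitely many sorts of [eqstr N] with a
   single element. *)
Definition true_sort n : eqsort N := EqSort (true_equiv n).

Definition true_elt n : elt (eqstr N) := @Elt _ (eqstr N) (inr (true_sort n))
  (cls (@eq_rel _ N (true_sort n)) (fun i : 'I_0 => match notF (ltn_ord i) with end)).

Lemma true_elt_inj : injective true_elt.
Proof.
move=> n m /(f_equal (fun x => match projT1 x with
  | inl _ => 0%N | inr E => and_depth (eq_fm E) end)).
by rewrite /= !and_true_depth.
Qed.

Lemma true_elt_dcl (D : set (elt (eqstr N))) n : dcl D (true_elt n).
Proof.
exists (@PForm (eqlang N) (eqstr N) unit _ 0 (fun i : 'I_0 => match notF (ltn_ord i) with end)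
  (@ftrue (eqlang N) _ _) (fun i : 'I_0 => match notF (ltn_ord i) with end)).
split=> [[]|[c [x E]]] //; split=> // _; apply: eq_exist; rewrite E.
by congr (@eq_rel _ N (true_sort n)); apply: fext => -[].
Qed.

Lemma home_inj : injective (@home L N).
Proof.
pose unhome (z : elt (eqstr N)) : option (elt N) := let: existT s a := z in
  match s return eqstr N s -> option (elt N) with
  | inl s => fun a => Some (@Elt _ N s a) | inr _ => fun=> None end a.
have unhomeK x : unhome (home x) = Some x by case: x.
by move=> x y E; apply: Some_inj; rewrite -!unhomeK E.
Qed.

Variables (G : set (elt N)) (D : set (elt (eqstr N))).
Hypothesis dclD : D = dcl D.
Hypothesis GD : G `<=` home_part D.

(** The elements of [E] outside [G] are sent to the trivial imaginaries, which any set closed under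
    [dcl] contains. Hence saturation above the cardinal of Delta always allows countably many
    further parameters. *)
Lemma card_home_part E : countable E -> (G `|` E) #<= D.
Proof.
move=> /countable_injP[k kE].
pose f x := if pselect (G x) then home x else true_elt (k x).
suff [g] : $|{injfun (G `|` E) >-> D}| by exact: inj_card_le.
apply/injfunPex; exists f.
  move=> x GEx; rewrite /f; case: (pselect (G x)) => [/GD//|nx].
  by rewrite dclD; exact: true_elt_dcl.
have hE x : (G `|` E) x -> ~ G x -> x \in E by move=> [//|Ex] _; rewrite inE.
move=> x y; rewrite !inE /f => hx hy.
case: (pselect (G x)) => [Gx|nx]; case: (pselect (G y)) => [Gy|ny].
- exact: home_inj.
- by move=> /(f_equal (@projT1 _ _)).
- by move=> /(f_equal (@projT1 _ _)).
- by move=> /true_elt_inj; apply: kE; apply: hE.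
Qed.

Hypothesis satN : saturated_succ N D.

Lemma saturated_home_part E : countable E ->
  forall s (P : set (pform N (ctx1 s))), (forall p, P p -> params_in (G `|` E) p) ->
  consistent P -> exists y : N s, forall p, P p -> psat p (fun=> y).
Proof. by move=> /card_home_part hE s P; exact: satN. Qed.

End TrivialSorts.

Section ReductParameters.
Variables (L1 L : lang) (N1 : str L1) (N : str L) (h : lsort L1 -> lsort L).
Variables (to : forall s, N1 s -> N (h s)) (fr : forall s, N (h s) -> N1 s).
Hypothesis frK : forall s (x : N1 s), fr (to x) = x.
Hypothesis toK : forall s (x : N (h s)), to (fr x) = x.
Hypothesis interp_fun : forall f : fsym L1,
  TFun (vs := fun i => h (fdom (f := f) i))
    (fun y : forall i, N _ => to (sfun (fun i => fr (y i)))).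
Hypothesis interp_rel : forall r : rsym L1,
  Def (vs := fun i => h (rdom (r := r) i))
    (fun y : forall i, N _ => srel (fun i => fr (y i))).
Variable G : set (elt N).

Lemma DefG_reduct U (us : U -> lsort L1) (Q : (forall u, N1 (us u)) -> Prop)
    V (vs : V -> lsort L) (F : forall u, (forall v, N (vs v)) -> N (h (us u))) :
  DefG (trace to G) Q -> (forall u, TFunG G (F u)) ->
  DefG G (fun e => Q (fun u => fr (F u e))).
Proof.
move=> [R [hR hQ]] /dchoice[f hf].
pose ws := vjoin vs (tp_ctx (X := G)).
pose y (x : {x | trace to G x}) : {x | G x} := exist _ (Elt (to (projT2 (sval x)))) (svalP x).
pose F' x := match x return (forall w, N (ws w)) ->
    N (h (vjoin us (tp_ctx (X := trace to G)) x)) with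
  | inl u => f u | inr x => fun e => e (inr (y x)) end.
have hF' x : TFun (F' x).
  by case: x => [u|x]; [have [] := hf u|coord].
exists (fun e => R (fun u => fr (F' u e))); split.
  exact: (Def_reduct frK toK interp_fun interp_rel hR hF').
move=> e; rewrite hQ (_ : ejoin _ _ = fun u => fr (F' u (ejoin e (hval (H := G))))) //.
by apply: fext => -[u|x] /=; [have [_ ->] := hf u|rewrite /hval /= frK].
Qed.

(** A formula of the reduct about the images under terms over [G] is a formula over [G] about the
    rows of [b], so it cannot distinguish increasing tuples of indices. *)
Lemma indiscernible_reduct r (ts : 'I_r -> lsort L) (b : nat -> forall t, N (ts t))
    m (s : 'I_m -> lsort L1) (f : forall j, (forall t, N (ts t)) -> N (h (s j))) :
  indG G b -> (forall j, TFunG G (f j)) ->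
  indiscernible (trace to G) (fun k j => fr (f j (b k))).
Proof.
move=> hb hf n p hp a a' ha ha'.
pose P (z : forall x : 'I_n * 'I_r, N (ts x.2)) :=
  psat p (fun ij => fr (f ij.2 (fun t => z (ij.1, t)))).
have hP : DefG G (vs := row_ctx ts (I := 'I_n)) P.
  have := DefG_reduct (vs := row_ctx ts (I := 'I_n))
    (F := fun ij z => f ij.2 (fun t => z (ij.1, t))) (DefG_pform hp).
  apply=> -[i j]; have [g [hg E]] := hf j.
  pose ws := vjoin (row_ctx ts (I := 'I_n)) (tp_ctx (X := G)).
  pose H x := match x return (forall w, N (ws w)) -> N (vjoin ts (tp_ctx (X := G)) x) with
    | inl t => fun e => e (inl (i, t)) | inr y => fun e => e (inr y) end.
  exists (fun e => g (fun x => H x e)); split.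
    apply: TFun_subst hg _ => -[t|y]; first coord.
    coord.
  by move=> e; rewrite E; congr g; apply: fext => -[].
exact: hb _ P hP a a' ha ha'.
Qed.

End ReductParameters.

(** * Dividing formulas and non-forking types *)

Section Dividing.
Variables (L : lang) (N : str L) (G : set (elt N)).

(** The formula is the instance of [Q] at [d0]. The context [ws] may be infinite, but the instance
    keeps finitely many coordinates of [d0]; so indiscernibility of [d] is only asked of finite
    subtuples. *)
Lemma pform_at V (vs : V -> lsort L) W (ws : W -> lsort L)
    (Q : (forall x, N (vjoin vs ws x)) -> Prop) (d0 : forall w, N (ws w)) : Def Q ->
  exists q : pform N vs, (forall x, psat q x <-> Q (ejoin x d0)) /\
    (~ divides G q -> forall d : nat -> forall w, N (ws w), d 0%N = d0 ->
     (forall n (f : 'I_n -> W), indiscernible G (fun k i => d k (f i))) ->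
     forall m, exists x, forall i, (i < m)%N -> Q (ejoin x (d i))).
Proof.
move=> /Def_support[n [f [fm hfm]]].
exists (PForm fm (fun i => d0 (f i))); split=> [x|nd d dE hd m]; first exact: hfm.
apply: contrapT => hn; apply: nd; exists (fun k i => d k (f i)); split => //=.
  by rewrite dE.
move=> hC; apply: hn.
have [x hx] := hC m (fun k => PForm fm (fun i => d k (f i))) (fun k => ex_intro _ (k : nat) erefl).
by exists x => i im; apply/hfm; exact: hx (Ordinal im).
Qed.

(** Otherwise [th] would imply the disjunction of the dividing formulas among the [q t], and the
    type would fork. *)
Lemma nonforking_realized (X D : set (elt N)) (th : pform N (tp_ctx (X := X)))
    (T : finType) (q : T -> pform N (tp_ctx (X := X))) :
  ~ type_forks G (tp X D) -> tp X D th ->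
  exists v, psat th v /\ forall t, psat (q t) v -> ~ divides G (q t).
Proof.
move=> nf hth; apply: contrapT => hn; apply: nf; exists th; split.
  exists 1%N, (fun=> th); split=> [_|v hv]; first exact: hth.
  exact: hv ord0.
pose S := [pred t | `[< divides G (q t) >]].
exists #|S|, (fun k => q (enum_val k)); split=> [k|v hv].
  by have := enum_valP k; rewrite inE.
apply: contrapT => hk; apply: hn; exists v; split=> // t ht hd; apply: hk.
have tS : t \in S by rewrite inE.
by exists (enum_rank_in tS t); rewrite enum_rankK_in.
Qed.

End Dividing.

Section HomeFormulas.
Variables (L : lang) (N : str L).

Lemma Def_home U (us : U -> lsort L) (Q : (forall u, N (us u)) -> Prop)
    V (vs : V -> lsort (eqlang N)) (F : forall u, (forall v, eqstr N (vs v)) -> N (us u)) :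
  Def Q -> (forall u, @TFun _ (eqstr N) _ vs (inl (us u)) (F u)) ->
  Def (N := eqstr N) (vs := vs) (fun e => Q (fun u => F u e)).
Proof.
move=> hQ hF.
apply: (@Def_reduct L (eqlang N) N (eqstr N) inl (fun s x => x) (fun s x => x)
  (fun s x => erefl) (fun s x => erefl)) hQ hF => [f|r].
  by exists (@tapp (eqlang N) _ _ (inl f) (fun i => @tvar (eqlang N) _
    (fun i => inl (fdom (f := f) i)) i)).
by exists (@frel (eqlang N) _ _ r (fun i => @tvar (eqlang N) _
  (fun i => inl (rdom (r := r) i)) i)).
Qed.

Variable G : set (elt N).

Definition home_param (x : {x | G x}) : lsort (eqlang N) := inl (tp_ctx x).
Definition home_val (x : {x | G x}) : eqstr N (home_param x) := hval x.

Lemma pform_home V (vs : V -> lsort (eqlang N))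
    (Q : (forall x, eqstr N (vjoin vs home_param x)) -> Prop) : Def Q ->
  exists p : pform (eqstr N) vs, params_in (@home _ N @` G) p /\
    forall e, psat p e <-> Q (ejoin e home_val).
Proof.
move=> /Def_support[n [f [q hq]]].
exists (PForm q (fun i => home_val (f i))); split=> [i|e] /=; last exact: hq.
rewrite /home_val /home_param /hval.
by case: (f i) => -[s x] hx; exists (existT _ s x).
Qed.

End HomeFormulas.

Lemma finite_list T (l : seq T) : finite_set [set x | List.In x l].
Proof.
elim: l => [|x l IH] /=; first by rewrite (_ : [set _ | _] = set0) //; apply/seteqP.
rewrite (_ : [set _ | _] = [set x] `|` [set y | List.In y l]).
  by rewrite finite_setU; split=> //; exact: finite_set1.
by apply/seteqP; split=> y [->|h]; [left|right|left|right].
Qed.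

(** * Dividing formulas of M^eq witnessed by sequences in the home sorts *)

Section HomeCover.
Variables (L : lang) (N : str L).

Lemma cover_sort (s : lsort (eqlang N)) : exists n (ts : 'I_n -> lsort L)
  (F : (forall t, N (ts t)) -> eqstr N s), erep F /\ forall d, exists c, F c = d.
Proof.
case: s => [s|E].
  exists 1%N, (fun=> s), (fun c => c ord0); split; first exact: (TFun_var (vs := fun _ : 'I_1 => s)).
  by move=> d; exists (fun=> d).
exists (eq_n E), (@eq_s L N E), (fun c => cls (@eq_rel L N E) c); split.
  by exists (fun i c => c i); split=> // i; exact: TFun_var.
by move=> [c [x hx]]; exists x; exact: eq_exist.
Qed.

Lemma cover_sorts m (ss : 'I_m -> lsort (eqlang N)) : exists n (ts : 'I_n -> lsort L)
  (F : forall j, (forall t, N (ts t)) -> eqstr N (ss j)),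
  (forall j, erep (F j)) /\ forall d, exists c, forall j, F j c = d j.
Proof.
have /dchoice[n /dchoice[ts /dchoice[F hF]]] := fun j => cover_sort (ss j).
pose T : finType := {j : 'I_m & 'I_(n j)}.
pose us (y : T) := ts (projT1 y) (projT2 y).
pose ts' (k : 'I_#|T|) := us (enum_val k).
have /dchoice[g hg] : forall y : T, exists g : (forall k, N (ts' k)) -> N (us y),
    TFun g /\ forall d : (forall y, N (us y)), g (fun k => d (enum_val k)) = d y.
  move=> y; have E : enum_val (enum_rank y) = y by rewrite enum_rankK.
  move: (enum_rank y) E => k <-; exists (fun c => c k); split=> //.
  coord.
exists #|T|, ts', (fun j c => F j (fun i => g (existT _ j i) c)); split=> [j|d].
  have [h _] := hF j.
  by apply: (erep_subst (ws := ts') h) => i; have [] := hg (existT _ j i).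
have /dchoice[c hc] : forall j, exists c, F j c = d j by move=> j; have [_] := hF j; exact.
exists (fun k => c (projT1 (enum_val k)) (projT2 (enum_val k))) => j; rewrite -hc; congr (F j _).
apply: fext => i; have [_ h] := hg (existT _ j i).
exact: (h (fun y => c (projT1 y) (projT2 y))).
Qed.

Lemma TFun_erep V (vs : V -> lsort L) s (f : (forall v, N (vs v)) -> eqstr N s)
    W (ws : W -> lsort (eqlang N)) (H : forall v, (forall w, eqstr N (ws w)) -> N (vs v)) :
  erep f -> (forall v, @TFun _ (eqstr N) _ ws (inl (vs v)) (H v)) ->
  @TFun _ (eqstr N) _ ws s (fun e => f (fun v => H v e)).
Proof.
have home u (g : (forall v, N (vs v)) -> N u) : TFun g ->
    (forall v, @TFun _ (eqstr N) _ ws (inl (vs v)) (H v)) ->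
    @TFun _ (eqstr N) _ ws (inl u) (fun e => g (fun v => H v e)).
  move=> [t ht] hH; apply: TFun_ext (_ : @TFun _ (eqstr N) _ ws (inl u)
    (fun e => eval t (fun v => H v e))) _ => [|e]; last exact: ht.
  elim: t {ht} => [v|k a IH] //=.
  exact: (@TFun_app _ (eqstr N) _ ws (inl k) (fun i e => eval (a i) (fun v => H v e))).
case: s f => [s|E] f; first exact: home.
move=> [g [hg hf]] hH.
apply: TFun_ext (@TFun_app _ (eqstr N) _ ws (inr E) (fun i e => g i (fun v => H v e))
  (fun i => home _ _ (hg i) hH)) _ => e.
by rewrite hf.
Qed.

Variables (Gamma : set (elt (eqstr N))).
Local Notation G := (home_part Gamma).
Hypothesis satG : forall E : set (elt N), countable E ->
  forall s (P : set (pform N (ctx1 s))), (forall p, P p -> params_in (G `|` E) p) ->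
  consistent P -> exists y : N s, forall p, P p -> psat p (fun=> y).

(** The classes of the new sequence [b] need not be the given witness [d]: it only inherits that any
    [m] instances are inconsistent. It is found by [indiscernible_through], applied to home
    representatives of conjugates of [c0] over [d]. *)
Lemma divides_home U (us : U -> lsort (eqlang N)) (p : pform (eqstr N) us)
    W (ws : W -> lsort L) (x0 : forall w, N (ws w))
    (H : forall u, (forall w, N (ws w)) -> eqstr N (us u))
    r (ts : 'I_r -> lsort L) (F : forall j, (forall t, N (ts t)) -> eqstr N (pf_s (p := p) j))
    (c0 : forall t, N (ts t)) :
  (forall u, erep (H u)) -> (forall j, erep (F j)) ->
  (forall d, exists c, forall j, F j c = d j) -> (forall j, F j c0 = pf_par p j) ->
  divides Gamma p ->
  exists (b : nat -> forall t, N (ts t)) m, [/\ indG G b, b 0%N = c0 &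
    ~ exists x, forall i, (i < m)%N ->
        sat (pf_fm p) (ejoin (fun u => H u x) (fun j => F j (b i)))].
Proof.
move=> hH hF surj Fc0 [d [d0 dI dC]].
(* An inconsistent finite set of instances involves bounded indices, so some initial segment is
   already inconsistent. *)
have [m hm] : exists m, ~ exists v, forall i, (i < m)%N -> sat (pf_fm p) (ejoin v (d i)).
  apply: contrapT => hn; apply: dC => n q /choice[k hk].
  have : exists v, forall i, (i < (\max_(j < n) k j).+1)%N -> sat (pf_fm p) (ejoin v (d i)).
    by apply: contrapT => h; apply: hn; eexists; exact: h.
  move=> [v hv]; exists v => j; rewrite hk; apply: hv.
  by rewrite ltnS; exact: leq_bigmax.
have incr_inconsistent a : @incr m a ->
    ~ exists v, forall i : 'I_m, sat (pf_fm p) (ejoin v (d (a i))).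
  move=> ha; pose zs (y : 'I_m * 'I_(pf_n p)) := pf_s (p := p) y.2.
  pose R (z : forall y, eqstr N (zs y)) := exists v, forall i : 'I_m,
    sat (pf_fm p) (ejoin v (fun j => z (i, j))).
  have hR : Def (N := eqstr N) (vs := zs) R.
    apply: (Def_exinf (fun u => H u x0)); apply: Def_all => i.
    pose ys := vjoin zs us.
    apply: (@Def_join _ (eqstr N) _ _ _ _ _ ys _ (fun u e => e (inr u))
      (fun j e => e (inl (i, j))) (Def_sat _ (pf_fm p))) => u; coord.
  have [q [hq qE]] := pform_DefG (DefG_Def Gamma hR).
  have := dI m q hq a (fun i => i) ha (fun i j ij => ij); rewrite !qE => [[h _]] h'.
  have [v hv] := h h'; apply: hm; exists v => i im; exact: hv (Ordinal im).
pose K (z : forall y : 'I_m * 'I_r, N (row_ctx ts y)) := ~ exists x, forall i : 'I_m,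
  sat (pf_fm p) (ejoin (fun u => H u x) (fun j => F j (fun t => z (i, t)))).
have hK : DefG G (vs := row_ctx ts (I := 'I_m)) K.
  apply: DefG_Def; apply: Def_not; apply: (Def_exinf x0); apply: Def_all => i.
  pose ys := vjoin (row_ctx ts (I := 'I_m)) ws.
  pose FF y := match y return (forall v, N (ys v)) -> eqstr N (vjoin us (pf_s (p := p)) y) with
    | inl u => fun e => H u (fun w => e (inr w))
    | inr j => fun e => F j (fun t => e (inl (i, t))) end.
  have hFF y : erep (FF y).
    case: y => [u|j].
      exact: (erep_subst (ws := ys) (hH u) (fun w => TFun_var (vs := ys) (inr w))).
    exact: (erep_subst (ws := ys) (hF j) (fun t => TFun_var (vs := ys) (inl (i, t)))).
  apply: Def_ext (Def_imaginary (pf_fm p) hFF) _ => e.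
  rewrite (_ : (fun y => FF y e) = ejoin (N := eqstr N) (fun u => H u (fun w => e (inr w)))
    (fun j => F j (fun t => e (inl (i, t))))) //.
  by apply: fext => -[].
have [|b [b0 bI bK]] := indiscernible_through satG (c := c0) hK.
  move=> chi [Q [hQ QE]] chi0.
  pose zs (y : 'I_1 * 'I_(pf_n p)) := pf_s (p := p) y.2.
  pose ys := vjoin zs (home_param (G := G)).
  have hR : Def (N := eqstr N) (vs := ys) (fun e => exists c : forall t, N (ts t),
      (forall j, F j c = e (inl (ord0, j))) /\ Q (ejoin c (fun y => e (inr y)))).
    pose vs := vjoin ys (fun t => inl (ts t)).
    apply: (@Def_exs _ (eqstr N) _ (fun t => inl (ts t))); apply: Def_and.
      apply: Def_all => j; apply: (@Def_eq _ (eqstr N) _ vs).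
        exact: (TFun_erep (ws := vs) (H := fun t e => e (inr t)) (hF j)
          (fun t => TFun_var (N := eqstr N) (vs := vs) (inr t))).
      coord.
    pose FF y := match y return (forall v, eqstr N (vs v)) -> N (vjoin ts (tp_ctx (X := G)) y) with
      | inl t => fun e => e (inr t) | inr y => fun e => e (inl (inr y)) end.
    have hFF y : @TFun _ (eqstr N) _ vs (inl (vjoin ts (tp_ctx (X := G)) y)) (FF y).
      by case: y => [t|y]; [coord
        |coord].
    apply: Def_ext (Def_home hQ hFF) _ => e.
    rewrite (_ : (fun y => FF y e) = ejoin (N := N) (fun t => e (inr t))
      (fun y => e (inl (inr y)))) //.
    by apply: fext => -[].
  have [q [hq qE]] := pform_home hR.
  have hqG : params_in Gamma q by move=> i; have [y hy <-] := hq i.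
  have inc (a : 'I_1 -> nat) : incr a by move=> [[|]//] ? [[|]//].
  (* That some representative satisfies [chi] is a condition over Gamma on the imaginary; it holds
     at [d 0] because of [c0], hence at each [d i]. *)
  have hs i : exists c, (forall j, F j c = d i j) /\ chi c.
    have := dI 1%N q hqG (fun=> 0%N) (fun=> i) (inc _) (inc _); rewrite !qE => -[h _].
    have [|c [hc1 hc2]] := h; last by exists c; split=> //; apply/QE.
    by exists c0; split=> [j|]; [rewrite Fc0 d0|apply/QE].
  have [s hs'] := choice hs.
  exists s; split=> [i|a ha]; first by have [] := hs' i.
  move=> [x hx]; apply: (incr_inconsistent a ha); exists (fun u => H u x) => i.
  have := hx i; rewrite /rows (_ : (fun j => F j (fun t => s (a i) t)) = d (a i)) //.
  by apply: fext => j; have [-> _] := hs' (a i).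
exists b, m; split=> // -[x hx]; apply: (bK (fun i => i)) => //.
by exists x => i; exact: hx (ltn_ord i).
Qed.

End HomeCover.

(** * Abelian structures *)

Section AbelianTerms.
Variables (L : lang) (X : abelian L).
Implicit Types (V : Type).
Local Open Scope ring_scope.

Lemma ab_funD (f : fsym (ablang L)) (x y : forall i, ab_car X (fdom (l := ablang L) (f := f) i)) :
  @sfun _ (abstr X) f (fun i => x i + y i) =
  (@sfun _ (abstr X) f x : ab_car X _) + @sfun _ (abstr X) f y.
Proof.
exact: (@ab_term L X _ (fun i => fdom (f := f) i) _
  (@tapp (ablang L) _ _ f (fun i => tvar _ i)) x y).
Qed.

Local Notation ev t := (@eval _ (abstr X) _ _ _ t).

(** The axiom on terms concerns finite tuples of variables; in an arbitrary context, additivity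
    follows by induction from that of the function symbols. *)
Lemma ab_evalD V (vs : V -> lsort (ablang L)) s (t : term vs s)
    (x y : forall v, ab_car X (vs v)) :
  ev t (fun v => x v + y v) = (ev t x : ab_car X s) + ev t y.
Proof.
elim: t => //= f a IH; rewrite -ab_funD; congr (@sfun _ (abstr X) f _).
by apply: fext => i; apply: IH.
Qed.

Lemma ab_eval0 V (vs : V -> lsort (ablang L)) s (t : term vs s) :
  ev t (fun v => 0 : ab_car X (vs v)) = 0 :> ab_car X s.
Proof.
apply: (@addrI _ (ev t (fun v => 0 : ab_car X (vs v)) : ab_car X s)).
by rewrite addr0 -ab_evalD; congr (ev t _); apply: fext => v; rewrite addr0.
Qed.

Lemma ab_evalN V (vs : V -> lsort (ablang L)) s (t : term vs s)
    (x : forall v, ab_car X (vs v)) : ev t (fun v => - x v) = - (ev t x : ab_car X s).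
Proof.
apply: (@addrI _ (ev t x : ab_car X s)); rewrite subrr -ab_evalD -[RHS](ab_eval0 t).
by congr (ev t _); apply: fext => v; rewrite subrr.
Qed.

Lemma ab_evalB V (vs : V -> lsort (ablang L)) s (t : term vs s)
    (x y : forall v, ab_car X (vs v)) :
  ev t (fun v => x v - y v) = (ev t x : ab_car X s) - ev t y.
Proof. by rewrite -ab_evalN -ab_evalD. Qed.

Lemma ppN (p : ppform L) (x : forall i, ab_car X (pp_s (p := p) i)) :
  ppsat x -> ppsat (fun i => - x i).
Proof.
move=> h; have := ab_ppB (@ab_pp0 L X p) h; congr ppsat.
by apply: fext => i; rewrite sub0r.
Qed.

Lemma ppD (p : ppform L) (x y : forall i, ab_car X (pp_s (p := p) i)) :
  ppsat x -> ppsat y -> ppsat (fun i => x i + y i).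
Proof.
move=> hx /ppN hy; have := ab_ppB hx hy; congr ppsat.
by apply: fext => i; rewrite opprK.
Qed.

Lemma pp_cls_eq (p : ppform L) (x y : forall i, ab_car X (pp_s (p := p) i)) :
  cls (@ppmod L X p) x = cls (@ppmod L X p) y <-> ppsat (fun i => y i - x i).
Proof.
split=> [[h]|h].
  have := f_equal (fun P => P y) h; rewrite /ppmod => /= ->.
  by have := @ab_pp0 L X p; congr ppsat; apply: fext => i; rewrite subrr.
apply: eq_exist; apply/funext => z; apply/propext; rewrite /ppmod; split=> hz.
  by have := ab_ppB hz h; congr ppsat; apply: fext => i; rewrite opprB addrA subrK.
by have := ppD hz h; congr ppsat; apply: fext => i; rewrite addrA subrK.
Qed.

End AbelianTerms.

Lemma TFun_reduct_id L (N : str L) (X : expansion N) U (us : U -> lsort L) V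
    (vs : V -> lsort (xlang (x_ext X)))
    (F : forall u, (forall v, xstr X (vs v)) -> N (us u)) s (t : term us s) :
  (forall u, @TFun _ (xstr X) _ vs (inl (us u)) (F u)) ->
  @TFun _ (xstr X) _ vs (inl s) (fun e => eval t (fun u => F u e)).
Proof.
move=> hF; elim: t => [u|f a IH] //=.
exact: (@TFun_app _ (xstr X) _ vs (inl f) (fun i e => eval (a i) (fun u => F u e))).
Qed.

Lemma Def_expansion L (N : str L) (X : expansion N) U (us : U -> lsort L)
    (Q : (forall u, N (us u)) -> Prop) V (vs : V -> lsort (xlang (x_ext X)))
    (F : forall u, (forall v, xstr X (vs v)) -> N (us u)) :
  Def Q -> (forall u, @TFun _ (xstr X) _ vs (inl (us u)) (F u)) ->
  Def (N := xstr X) (fun e => Q (fun u => F u e)).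
Proof.
move=> hQ hF.
apply: (@Def_reduct _ _ N (xstr X) inl (fun s x => x) (fun s x => x)) hQ hF => // [f|r].
  by exists (tapp (f := inl f : fsym (xlang (x_ext X)))
    (fun i => @tvar (xlang (x_ext X)) _ (fun i : 'I_(far f) => inl (fdom i)) i)).
by exists (frel (r := inl r : rsym (xlang (x_ext X)))
    (fun i => @tvar (xlang (x_ext X)) _ (fun i : 'I_(rar r) => inl (rdom i)) i)).
Qed.

(** * P.p.-formulas for systems of cosets *)

Section AbelianFormulas.
Variable L : lang.
Local Open Scope ring_scope.

Definition zterm V (vs : V -> lsort L) (s : lsort L) : @term (ablang L) V vs s :=
  @tapp (ablang L) V vs (gzero s)
    (fun i : 'I_0 => match notF (ltn_ord i) with end).

Definition addterm V (vs : V -> lsort L) (s : lsort L) (t u : @term (ablang L) V vs s) :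
    @term (ablang L) V vs s :=
  @tapp (ablang L) V vs (gadd s) (fun i : 'I_2 => if i == ord0 then t else u).

Variables (V : Type) (vs : V -> lsort L) (s : lsort L) (n : nat) (phi : 'I_n -> ppform L).
Variable t : forall l i, @term (ablang L) _ (vcons s vs) (pp_s (p := phi l) i).

(* A term in a variable [b] of sort [s] and in variables [x] is the sum of its
   values at [(0, x)], computed by [const_part], and at [(b, 0)], computed by [lin_part]. *)
Definition const_part l i : @term (ablang L) V vs (pp_s (p := phi l) i) :=
  tsub (fun o => match o return @term (ablang L) V vs (vcons s vs o) with
    | Some v => @tvar (ablang L) V vs v | None => zterm vs s end) (t i).

Definition lin_part W (ws : W -> lsort L) (u : @term (ablang L) W ws s) l i :
    @term (ablang L) W ws (pp_s (p := phi l) i) :=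
  tsub (fun o => match o return @term (ablang L) W ws (vcons s vs o) with
    | Some v => zterm ws (vs v) | None => u end) (t i).

Variable J : 'I_n -> bool.

Definition coset_index := {l : 'I_n & 'I_(pp_n (phi l))}.
Definition coset_index_sort (x : coset_index) : lsort L := pp_s (p := phi (projT1 x)) (projT2 x).

(** This is the p.p.-formula to which the fundamental system is applied: the variables [y] stand for
    the constant parts of the terms, and one [b] must put [y] plus the linear part into [phi l] for
    every [l] in [J]. *)
Definition translate_fm : @formula (ablang L) _ coset_index_sort :=
  @fex (ablang L) _ coset_index_sort s (fands (fun l => if J l then
    @fsub (ablang L) _ _ (pp_fm (phi l)) _ (vcons s coset_index_sort) (fun i =>
      addterm (@tvar (ablang L) _ (vcons s coset_index_sort)
                 (Some (existT (fun l => 'I_(pp_n (phi l))) l i)))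
        (lin_part (@tvar (ablang L) _ (vcons s coset_index_sort) None) i))
    else @ftrue (ablang L) _ _)).

Lemma translate_fm_pp : is_pp translate_fm.
Proof.
apply: is_pp_fands => l; case: (J l) => //; rewrite is_pp_fsub; exact: pp_pp.
Qed.

(** The homogeneous system attached to [translate_fm]. Its context is ['I_1], so that it can be
    packed as a [ppform] and purity can be applied to it. *)
Definition lin_fm : @formula (ablang L) 'I_1 (fun=> s) :=
  fands (fun l => if J l then @fsub (ablang L) _ _ (pp_fm (phi l)) _ (fun=> s)
     (fun i => lin_part (@tvar (ablang L) 'I_1 (fun=> s) ord0) i)
    else @ftrue (ablang L) _ _).

Lemma lin_fm_pp : is_pp lin_fm.
Proof.
apply: is_pp_fands => l; case: (J l) => //; rewrite is_pp_fsub; exact: pp_pp.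
Qed.

Variable X : abelian L.
Local Notation ev t := (@eval _ (abstr X) _ _ _ t).

Definition lin_val l (i : 'I_(pp_n (phi l))) (b : ab_car X s) : ab_car X (pp_s (p := phi l) i) :=
  ev (t i) (@econs _ (abstr X) V vs s b (fun=> 0)).

Lemma eval_lin_part W (ws : W -> lsort L) (u : @term (ablang L) W ws s) l
    (i : 'I_(pp_n (phi l))) (e : forall w, ab_car X (ws w)) :
  ev (lin_part u i) e = lin_val i (ev u e).
Proof.
rewrite /lin_part (@eval_tsub _ (abstr X)) /lin_val.
by congr (ev _ _); apply: fext => -[].
Qed.

Lemma lin_valB l (i : 'I_(pp_n (phi l))) b b' : lin_val i (b - b') = lin_val i b - lin_val i b'.
Proof.
rewrite /lin_val -ab_evalB; congr (ev _ _); apply: fext => -[v|] //=.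
by rewrite subr0.
Qed.

Lemma lin_valD l (i : 'I_(pp_n (phi l))) b b' : lin_val i (b + b') = lin_val i b + lin_val i b'.
Proof.
rewrite /lin_val -ab_evalD; congr (ev _ _); apply: fext => -[v|] //=.
by rewrite addr0.
Qed.

Lemma eval_split l (i : 'I_(pp_n (phi l))) (b : ab_car X s) (x : forall v, ab_car X (vs v)) :
  ev (t i) (@econs _ (abstr X) V vs s b x) = ev (const_part i) x + lin_val i b.
Proof.
rewrite /const_part (@eval_tsub _ (abstr X)) /lin_val -ab_evalD.
by congr (ev _ _); apply: fext => -[v|] /=; rewrite ?addr0 ?add0r.
Qed.

Lemma sat_translate_fm (y : forall x, ab_car X (coset_index_sort x)) :
  @sat _ (abstr X) _ _ translate_fm y <-> exists b, forall l, J l ->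
    @ppsat L X (phi l) (fun i => y (existT _ l i) + lin_val i b).
Proof.
have E b : sat (fands (fun l => if J l then
    @fsub (ablang L) _ _ (pp_fm (phi l)) _ (vcons s coset_index_sort) (fun i =>
      addterm (@tvar (ablang L) _ (vcons s coset_index_sort)
                 (Some (existT (fun l => 'I_(pp_n (phi l))) l i)))
        (lin_part (@tvar (ablang L) _ (vcons s coset_index_sort) None) i))
    else @ftrue (ablang L) _ _)) (@econs _ (abstr X) _ coset_index_sort s b y) <->
    forall l, J l -> @ppsat L X (phi l) (fun i => y (existT _ l i) + lin_val i b).
  rewrite sat_fands; split=> h l; have := h l; case: (J l) => //.
    move=> /(@sat_fsub _ (abstr X)) + _; rewrite /ppsat; congr sat; apply: fext => i /=.
    by congr (_ + _); exact: eval_lin_part.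
  move=> /(_ isT) h'; apply/(@sat_fsub _ (abstr X)); move: h'; rewrite /ppsat; congr sat.
  by apply: fext => i /=; congr (_ + _); rewrite eval_lin_part.
by split=> -[b /E]; exists b.
Qed.

Lemma ppsat_lin_fm (z : forall i : 'I_1, ab_car X s) :
  @ppsat L X (PPForm lin_fm_pp) z <->
  forall l, J l -> @ppsat L X (phi l) (fun i => lin_val i (z ord0)).
Proof.
rewrite /ppsat /= sat_fands; split=> h l; have := h l; case: (J l) => //.
  move=> /(@sat_fsub _ (abstr X)) + _; congr sat; apply: fext => i /=.
  exact: eval_lin_part.
move=> /(_ isT) h'; apply/(@sat_fsub _ (abstr X)); move: h'; congr sat.
by apply: fext => i /=; rewrite eval_lin_part.
Qed.

End AbelianFormulas.

(** * The pure exact sequence *)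

Section PureSequence.
Variables (L : lang) (A B C : abelian L).
Variables (iota : forall s, ab_car A s -> ab_car B s).
Variables (nu : forall s, ab_car B s -> ab_car C s).
Variables (Phi : set (ppform L)).
Variables (As : expansion (xstr (quot_expansion A Phi))).
Variables (Cs : expansion (abstr C)).
Hypothesis PE : pure_exact iota nu.
Hypothesis FS : fundamental_system B Phi.

Local Notation LA := (xlang (x_ext As)).
Local Notation LC := (xlang (x_ext Cs)).
Local Notation ML := (Mlang As Cs).
Local Notation AA := (xstr As).
Local Notation BB := (abstr B).
Local Notation CC := (xstr Cs).
Local Notation MM := (Mstr iota nu As Cs).
Local Notation inA := (inA iota nu Cs).
Local Notation inB := (inB iota nu As Cs).
Local Notation inC := (inC iota nu As).
Local Notation sortA := (MA (lsort (ablang L)) (lsort LC)).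
Local Notation sortB := (MB (lsort LA) (lsort LC)).
Local Notation sortC := (MC (lsort LA) (lsort (ablang L))).
Local Notation evA t := (@eval _ (abstr A) _ _ _ t).
Local Notation evB t := (@eval _ (abstr B) _ _ _ t).
Local Notation evC t := (@eval _ (abstr C) _ _ _ t).

Section SequenceGroup.
Local Open Scope ring_scope.

Lemma iota_eval V (vs : V -> lsort (ablang L)) s (t : term vs s)
    (x : forall v, abstr A (vs v)) :
  iota (eval t x) = @eval _ (abstr B) _ _ _ t (fun v => iota (x v)).
Proof.
have [[hf _] _ _] := pe_iota_emb PE.
elim: t => //= f a IH; rewrite (hf f); congr (@sfun _ (abstr B) f _).
exact: fext.
Qed.

Lemma nu_eval V (vs : V -> lsort (ablang L)) s (t : term vs s)
    (x : forall v, abstr B (vs v)) :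
  nu (eval t x) = @eval _ (abstr C) _ _ _ t (fun v => nu (x v)).
Proof.
have [hf _] := pe_nu_hom PE.
elim: t => //= f a IH; rewrite (hf f); congr (@sfun _ (abstr C) f _).
exact: fext.
Qed.

Lemma nuD s (x y : ab_car B s) : nu (x + y) = nu x + nu y.
Proof.
have [hf _] := pe_nu_hom PE.
exact: (hf (gadd s) (fun i : 'I_2 => if i == ord0 then x else y)).
Qed.

Lemma nuN s (x : ab_car B s) : nu (- x) = - nu x.
Proof. by have [hf _] := pe_nu_hom PE; exact: (hf (gopp s) (fun=> x)). Qed.

Lemma nu0 s : nu (0 : ab_car B s) = 0.
Proof. by apply: (@addrI _ (nu (0 : ab_car B s))); rewrite -nuD !addr0. Qed.

Lemma iotaD s (x y : ab_car A s) : iota (x + y) = iota x + iota y.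
Proof.
have [[hf _] _ _] := pe_iota_emb PE.
exact: (hf (gadd s) (fun i : 'I_2 => if i == ord0 then x else y)).
Qed.

Lemma nu_iota s (x : ab_car A s) : nu (iota x) = 0.
Proof. by apply/(pe_exact PE); exists x. Qed.

Section Rho.
Variable p : ppform L.
Implicit Types (y : forall i, ab_car B (pp_s (p := p) i)).
Implicit Types (a : forall i, ab_car A (pp_s (p := p) i)).

(** The domain of [rho] is the preimage of p(C) under [nu]. In this form, lying in the domain is a
    condition on C* alone. *)
Definition in_dom y := @ppsat L C p (fun i => nu (y i)).

Lemma in_domP y : in_dom y <-> exists a, @ppsat L B p (fun i => y i - iota (a i)).
Proof.
rewrite /in_dom (pe_nu_pp PE); split=> [[b [a [hb ->]]]|[a h]].
  by exists a; move: hb; congr ppsat; apply: fext => i; rewrite addrK.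
by exists (fun i => y i - iota (a i)), a; split=> //; apply: fext => i; rewrite subrK.
Qed.

(** Replaces the choice made in [rho] by a membership in p(B). By purity of [iota], two
    representatives differ by an element of p(A). *)
Lemma rho_eq y a : in_dom y ->
  rho iota y = cls (@ppmod L A p) a <-> @ppsat L B p (fun i => y i - iota (a i)).
Proof.
move=> /(pe_nu_pp PE)[b [a' [hb ->]]]; rewrite (rho_in PE) // pp_cls_eq.
rewrite -(pe_iota_pure PE).
split=> h.
  have := ab_ppB hb h; congr ppsat; apply: fext => i.
  have -> : iota (a i) = iota (a i - a' i) + iota (a' i) by rewrite -iotaD subrK.
  by rewrite [iota (a i - a' i) + _]addrC opprD addrA addrK.
have := ab_ppB hb h; congr ppsat; apply: fext => i.
have -> : iota (a i) = iota (a i - a' i) + iota (a' i) by rewrite -iotaD subrK.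
move=> /=; set u := iota _; set v := iota (a' i); have E (x t z : ab_car B (pp_s i)) : x - (x + z - (t + z)) = t by rewrite opprB addrA addrCA addrK.
exact: E.
Qed.

Lemma rho_outdom y : ~ in_dom y -> rho iota y = cls (@ppmod L A p) (fun=> 0).
Proof. by rewrite /in_dom (pe_nu_pp PE) => h; exact: rho_out. Qed.

Lemma in_domD y y' : in_dom y -> in_dom y' -> in_dom (fun i => y i + y' i).
Proof. by move=> h /(ppD h); congr ppsat; apply: fext => i; rewrite nuD. Qed.

Lemma rho_add y y' a a' : in_dom y -> in_dom y' ->
  rho iota y = cls (@ppmod L A p) a -> rho iota y' = cls (@ppmod L A p) a' ->
  rho iota (fun i => y i + y' i) = cls (@ppmod L A p) (fun i => a i + a' i).
Proof.
move=> h h' /(rho_eq _ h) e /(rho_eq _ h') e'.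
apply/(rho_eq _ (in_domD h h')); have := ppD e e'; congr ppsat; apply: fext => i.
by rewrite iotaD opprD addrACA.
Qed.

End Rho.
End SequenceGroup.

(** * Separated predicates and elimination of quantifiers *)

Section QuantifierElimination.
Local Open Scope ring_scope.

Record sctx := SCtx {
  cA : Type; sA : cA -> lsort LA;
  cB : Type; sB : cB -> lsort L;
  cC : Type; sC : cC -> lsort LC }.

Record senv (K : sctx) := SEnv {
  eA : forall v : cA K, AA (sA v);
  eB : forall v : cB K, ab_car B (sB v);
  eC : forall v : cC K, CC (sC v) }.

(** Formal expressions rho_phi(t(x)) in the B-variables. They all serve as extra variables of the
    A-side [actx], in the way that all [nu x] are extra variables of the C-side [cctx]. *)
Definition rterm (K : sctx) :=
  {p : idx Phi & forall i, @term (ablang L) _ (@sB K) (pp_s (p := sval p) i)}.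

Definition rsort (K : sctx) (r : rterm K) : lsort LA := inl (inr (projT1 r)).

Definition rval (K : sctx) (e : senv K) (r : rterm K) : AA (rsort r) :=
  rho iota (fun i => evB (projT2 r i) (eB e)).

Definition actx (K : sctx) := vjoin (@sA K) (@rsort K).
Definition EA (K : sctx) (e : senv K) : forall v, AA (actx (K := K) v) := ejoin (eA e) (rval e).

Definition nu_sort (K : sctx) (v : cB K) : lsort LC := inl (sB v).
Definition cctx (K : sctx) := vjoin (@sC K) (@nu_sort K).
Definition EC (K : sctx) (e : senv K) : forall v, CC (cctx (K := K) v) :=
  ejoin (eC e) (fun v => nu (eB e v) : CC (nu_sort v)).

(** Separated predicates: finite unions of rectangles, each the product of a condition on the A-side
    and a condition on the C-side. *)
Definition SP (K : sctx) (P : senv K -> Prop) :=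
  exists (T : finType) (a : T -> formula (actx (K := K))) (c : T -> formula (cctx (K := K))),
    forall e, P e <-> exists t, sat (a t) (EA e) /\ sat (c t) (EC e).

Section Boolean.
Variable K : sctx.
Implicit Types P Q : senv K -> Prop.

Lemma SP_ext P Q : SP P -> (forall e, P e <-> Q e) -> SP Q.
Proof. by move=> [T [a [c h]]] E; exists T, a, c => e; rewrite -E h. Qed.

Lemma SP_A (Q : (forall v, AA (actx (K := K) v)) -> Prop) : Def Q -> SP (fun e => Q (EA e)).
Proof.
move=> [p hp]; exists unit, (fun=> p), (fun=> ftrue _) => e.
by rewrite -hp; split=> [h|[_ []]//]; exists tt.
Qed.

Lemma SP_C (Q : (forall v, CC (cctx (K := K) v)) -> Prop) : Def Q -> SP (fun e => Q (EC e)).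
Proof.
move=> [p hp]; exists unit, (fun=> ftrue _), (fun=> p) => e.
by rewrite -hp; split=> [h|[_ []]//]; exists tt.
Qed.

Lemma SP_some (T : finType) (P : T -> senv K -> Prop) :
  (forall t, SP (P t)) -> SP (fun e => exists t, P t e).
Proof.
move=> /choice[U] /dchoice[a] /dchoice[c] h.
exists {t : T & U t}, (fun x => a (projT1 x) (projT2 x)), (fun x => c (projT1 x) (projT2 x)) => e.
split=> [[t /h[u hu]]|[[t u] hu]]; first by exists (existT _ t u).
by exists t; apply/h; exists u.
Qed.

Lemma SP_and P Q : SP P -> SP Q -> SP (fun e => P e /\ Q e).
Proof.
move=> [T [a [c h]]] [T' [a' [c' h']]].
exists (T * T')%type, (fun x => fand (a x.1) (a' x.2)), (fun x => fand (c x.1) (c' x.2)) => e.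
rewrite h h'; split=> [[[t [? ?]] [t' [? ?]]]|[[t t'] /= [[? ?] [? ?]]]].
  by exists (t, t').
by split; [exists t|exists t'].
Qed.

(** The complement of a union of rectangles is the union, over the functions [f] that choose at each
    index which side fails, of the corresponding rectangles. *)
Lemma SP_not P : SP P -> SP (fun e => ~ P e).
Proof.
move=> [T [a [c h]]].
exists {ffun T -> bool}, (fun f : {ffun T -> bool} => fands (fun t => if f t then fnot (a t) else ftrue _)),
  (fun f : {ffun T -> bool} => fands (fun t => if f t then ftrue _ else fnot (c t))) => e.
rewrite h; split=> [hn|[f []]].
  exists [ffun t => `[< ~ sat (a t) (EA e) >]]; rewrite !sat_fands.
  split=> t; rewrite ffunE; case: asboolP => //= /contrapT ha hc; apply: hn; by exists t.
by rewrite !sat_fands => ha hc [t]; move: (ha t) (hc t); case: (f t) => /= ? ? [].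
Qed.

Lemma SP_const (X : Prop) : SP (fun _ : senv K => X).
Proof. by apply: (@SP_A (fun=> X)); apply: Def_const. Qed.

Lemma SP_all (T : finType) (P : T -> senv K -> Prop) :
  (forall t, SP (P t)) -> SP (fun e => forall t, P t e).
Proof.
move=> h; apply: SP_ext (SP_not (SP_some (fun t => SP_not (h t)))) _ => e.
split=> [hn t|ha [t]//]; by apply: contrapT => ht; apply: hn; exists t.
Qed.

End Boolean.

Lemma TFun_evalA V (vs : V -> lsort LA) U (us : U -> lsort L)
    (F : forall u, (forall v, AA (vs v)) -> ab_car A (us u)) s
    (t : @term (ablang L) U us s) :
  (forall u, @TFun _ AA V vs (inl (inl (us u))) (F u)) ->
  @TFun _ AA V vs (inl (inl s)) (fun e => evA t (fun u => F u e)).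
Proof.
move=> hF; elim: t => [u|f a IH] //=.
exact: (@TFun_app _ AA _ vs (inl (inl f)) (fun i e => evA (a i) (fun u => F u e))).
Qed.

Lemma TFun_pi V (vs : V -> lsort LA) (p : idx Phi)
    (F : forall i, (forall v, AA (vs v)) -> ab_car A (pp_s (p := sval p) i)) :
  (forall i, @TFun _ AA V vs (inl (inl (@pp_s L (sval p) i))) (F i)) ->
  @TFun _ AA V vs (inl (inr p)) (fun e => cls (@ppmod L A (sval p)) (fun i => F i e)).
Proof. exact: (@TFun_app _ AA V vs (inl (inr p)) F). Qed.

Definition KA (K : sctx) (s : lsort LA) := SCtx (vcons s (@sA K)) (@sB K) (@sC K).
Definition KB (K : sctx) (s : lsort L) := SCtx (@sA K) (vcons s (@sB K)) (@sC K).
Definition KC (K : sctx) (s : lsort LC) := SCtx (@sA K) (@sB K) (vcons s (@sC K)).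

Definition consA K s (a : AA s) (e : senv K) : senv (KA K s) :=
  @SEnv (KA K s) (econs a (eA e)) (eB e) (eC e).
Definition consB K s (b : ab_car B s) (e : senv K) : senv (KB K s) :=
  @SEnv (KB K s) (eA e) (@econs _ (abstr B) _ (@sB K) s b (eB e)) (eC e).
Definition consC K s (c : CC s) (e : senv K) : senv (KC K s) :=
  @SEnv (KC K s) (eA e) (eB e) (econs c (eC e)).

(** The quantifier distributes over the union and enters the A-factor: neither the C-factor nor the
    values of [rho] see the new variable. *)
Lemma SP_exA K s (P : senv (KA K s) -> Prop) : SP P -> SP (fun e => exists a, P (consA a e)).
Proof.
move=> [T [a [c h]]].
pose G x := match x return term (vcons s (actx (K := K))) (actx (K := KA K s) x) with
  | inl None => tvar (vcons s (actx (K := K))) None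
  | inl (Some v) => tvar (vcons s (actx (K := K))) (Some (inl v))
  | inr r => tvar (vcons s (actx (K := K))) (Some (inr r)) end.
exists T, (fun t => fex (fsub (a t) G)), c => e.
have E t x : sat (fsub (a t) G) (econs x (EA e)) <-> sat (a t) (EA (consA x e)).
  rewrite sat_fsub (_ : (fun v => eval (G v) _) = EA (consA x e)) //.
  by apply: fext => -[[]|].
split=> [[x /h[t [ha hc]]]|[t [[x /E ha] hc]]].
  by exists t; split=> //=; exists x; apply/E.
by exists x; apply/h; exists t.
Qed.

Lemma SP_exC K s (P : senv (KC K s) -> Prop) : SP P -> SP (fun e => exists c, P (consC c e)).
Proof.
move=> [T [a [c h]]].
pose G x := match x return term (vcons s (cctx (K := K))) (cctx (K := KC K s) x) with
  | inl None => tvar (vcons s (cctx (K := K))) None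
  | inl (Some v) => tvar (vcons s (cctx (K := K))) (Some (inl v))
  | inr r => tvar (vcons s (cctx (K := K))) (Some (inr r)) end.
exists T, a, (fun t => fex (fsub (c t) G)) => e.
have E t x : sat (fsub (c t) G) (econs x (EC e)) <-> sat (c t) (EC (consC x e)).
  rewrite sat_fsub (_ : (fun v => eval (G v) _) = EC (consC x e)) //.
  by apply: fext => -[[]|].
split=> [[x /h[t [ha hc]]]|[t [ha [x /E hc]]]].
  by exists t; split=> //=; exists x; apply/E.
by exists x; apply/h; exists t.
Qed.

(** Extends the fundamental system from finite tuples of variables to p.p.-formulas in any context,
    through a finite support. *)
Lemma fundamental_pp T (ts : T -> lsort L) (chi : @formula (ablang L) T ts) : is_pp chi ->
  exists k (phi : 'I_k -> idx Phi)
    (r : forall j i, @term (ablang L) T ts (pp_s (p := sval (phi j)) i)),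
    forall x, @sat _ (abstr B) _ _ chi x <->
      forall j, @ppsat L B (sval (phi j)) (fun i => evB (r j i) x).
Proof.
move=> pp.
pose vs : void -> lsort (ablang L) := fun v => match v with end.
have [n [f [q [qq hq]]]] := finite_support chi
  (fun u => @tvar (ablang L) _ (vjoin vs ts) (inr u)).
pose G x := match x return @term (ablang L) _ (fun i => ts (f i)) (@vjoin (lsort (ablang L)) _ _ vs (fun i => ts (f i)) x)
  with | inl v => match v with end | inr i => @tvar (ablang L) _ (fun i => ts (f i)) i end.
have pq : is_pp (fsub q G) by rewrite is_pp_fsub qq.
have [k [phi [t [hphi ht]]]] := FS (PPForm pq).
exists k, (fun j => exist _ (phi j) (hphi j)),
  (fun j i => tsub (fun k => @tvar (ablang L) _ ts (f k)) (t j i)) => x.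
pose e0 : forall v, abstr B (vs v) := fun v => match v with end.
have <- : sat q (ejoin e0 (fun i => x (f i))) <-> @sat _ (abstr B) _ _ chi x by exact: hq.
have := ht (fun i => x (f i)); rewrite {1}/ppsat /= sat_fsub => E.
rewrite (_ : ejoin _ _ = (fun v => @eval _ (abstr B) _ _ _ (G v) (fun i => x (f i)))); last first.
  by apply: fext => -[].
rewrite E; split=> h j; have := h j; congr ppsat; apply: fext => i.
  by rewrite eval_tsub.
by rewrite eval_tsub.
Qed.

End QuantifierElimination.

Section BStep.
Local Open Scope ring_scope.
Variables (V : Type) (vs : V -> lsort L) (s : lsort L) (n : nat) (phi : 'I_n -> ppform L).
Variable t : forall l i, @term (ablang L) _ (vcons s vs) (pp_s (p := phi l) i).
Variable J : 'I_n -> bool.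

Local Notation tvalB l b y := (fun i : 'I_(pp_n (phi l)) =>
  evB (t i) (@econs _ (abstr B) V vs s b y)).
Local Notation tvalC l c z := (fun i : 'I_(pp_n (phi l)) =>
  evC (t i) (@econs _ (abstr C) V vs s c z)).

Lemma nu_tval l b (y : forall v, ab_car B (vs v)) :
  (fun i => nu (tvalB l b y i)) = tvalC l (nu b) (fun v => nu (y v)).
Proof.
by apply: fext => i; rewrite nu_eval; congr (evC _ _); apply: fext => -[].
Qed.

Lemma nu_lin_val l (i : 'I_(pp_n (phi l))) b :
  nu (lin_val t (X := B) i b) = lin_val t i (nu b).
Proof.
rewrite /lin_val nu_eval; congr (evC _ _).
by apply: fext => -[v|] //=; rewrite nu0.
Qed.

(* The solutions [b] over a point of [C] form a coset of the group cut out by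
   [lin_fm], which surjects onto the corresponding group of [C] by purity. *)
Lemma lift_solution (y : forall v, ab_car B (vs v)) c b0
    (a : forall l, forall i : 'I_(pp_n (phi l)), ab_car A (pp_s (p := phi l) i)) :
  (forall l, J l -> @ppsat L C (phi l) (tvalC l c (fun v => nu (y v)))) ->
  (forall l, J l -> @ppsat L B (phi l) (fun i => evB (const_part t i) y - iota (a l i)
                                                 + lin_val t i b0)) ->
  exists b, nu b = c /\
    forall l, J l -> @ppsat L B (phi l) (fun i => tvalB l b y i - iota (a l i)).
Proof.
move=> hc hb0; have [b1 hb1] := pe_nu_surj PE c.
(* Both [c] and [nu b0] solve the system in C, because [nu] kills the shifts by [iota]; so their
   difference solves the homogeneous system. Purity lifts it to a solution [b2] in B, and [b0 + b2]
   is the required element. *)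
have h1 : @ppsat L C (PPForm (lin_fm_pp t J)) (fun=> nu (b1 - b0)).
  apply/ppsat_lin_fm => l Jl; have h := hc l Jl.
  have h0 := (pe_nu_pp PE _).2 (ex_intro _ _ (ex_intro _ (fun i => 0) (conj (hb0 l Jl) erefl))).
  have := ab_ppB h h0; congr ppsat; apply: fext => i.
  rewrite nuD nu_iota addr0 nuD nuD nuN nu_iota oppr0 addr0.
  rewrite nu_lin_val nu_eval eval_split opprD addrACA subrr add0r.
  by rewrite -lin_valB -nuN -hb1 -nuD.
have [b2 [a' [hb2 E]]] := (pe_nu_pp PE (p := PPForm (lin_fm_pp t J)) (fun=> b1 - b0)).1 h1.
have {}E : b1 - b0 = b2 ord0 + iota (a' ord0) := f_equal (fun g => g ord0) E.
exists (b0 + b2 ord0); split=> [|l Jl].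
  have -> : b2 ord0 = b1 - b0 - iota (a' ord0) by rewrite E addrK.
  by rewrite nuD nuD nuN nu_iota oppr0 addr0 -nuD addrC subrK.
have /ppsat_lin_fm /(_ l Jl) h2 := hb2.
have := ppD (hb0 l Jl) h2; congr ppsat; apply: fext => i /=.
by rewrite eval_split lin_valD [RHS]addrAC addrA.
Qed.

End BStep.

Section ExistsB.
Local Open Scope ring_scope.

Lemma TFun_evalC V (vs : V -> lsort LC) U (us : U -> lsort L)
    (F : forall u, (forall v, CC (vs v)) -> ab_car C (us u)) s
    (t : @term (ablang L) U us s) :
  (forall u, @TFun _ CC V vs (inl (us u)) (F u)) ->
  @TFun _ CC V vs (inl s) (fun e => evC t (fun u => F u e)).
Proof. exact: TFun_reduct_id. Qed.

Lemma Def_ppC V (vs : V -> lsort LC) (p : ppform L)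
    (F : forall i, (forall v, CC (vs v)) -> ab_car C (pp_s (p := p) i)) :
  (forall i, @TFun _ CC V vs (inl (pp_s (p := p) i)) (F i)) ->
  Def (N := CC) (vs := vs) (fun e => @ppsat L C p (fun i => F i e)).
Proof. by apply: (Def_expansion (X := Cs)); exact: Def_sat. Qed.

Variables (K : sctx) (s : lsort L).

Definition econsC (c : ab_car C s) (z : forall v, CC (cctx (K := K) v)) :
    forall x, CC (cctx (K := KB K s) x) :=
  fun x => match x return CC (cctx (K := KB K s) x) with
  | inl v => z (inl v) | inr None => c | inr (Some v) => z (inr v) end.

Lemma econsC_EC b (e : senv K) : econsC (nu b) (EC e) = EC (consB b e).
Proof. by apply: fext => -[v|[v|]]. Qed.

Section Pair.
Variables (n : nat) (f : 'I_n -> rterm (KB K s)).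
Variables (alpha : formula (vjoin (@sA (KB K s)) (fun l => rsort (f l)))).
Variable gamma : formula (cctx (K := KB K s)).

Let phi l : idx Phi := projT1 (f l).
Let sphi l := sval (phi l).
Let t l i : @term (ablang L) _ (vcons s (@sB K)) (pp_s (p := sphi l) i) :=
  projT2 (f l) i.
Let cst (e : senv K) (x : coset_index sphi) : ab_car B (coset_index_sort x) :=
  evB (const_part t (projT2 x)) (eB e).

Variables (k : nat) (phi' : 'I_k -> idx Phi).

(** The expressions in which the eliminated variable no longer occurs: the terms [r], obtained by
    applying the fundamental system to [translate_fm], evaluated at the constant parts. *)
Definition fund_rterm (r : forall m i, @term (ablang L) _ (@coset_index_sort L n sphi)
    (pp_s (p := sval (phi' m)) i)) (m : 'I_k) : rterm K :=
  existT _ (phi' m) (fun i => tsub (fun x => const_part t (projT2 x)) (r m i)).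

Definition pick_cls (J : 'I_n -> bool) (a : forall x, ab_car A (@coset_index_sort L n sphi x))
    l : AA (rsort (f l)) :=
  cls (@ppmod L A (sphi l)) (fun i => if J l then a (existT _ l i) else 0).

(** Here [a] represents the values that the expressions indexed by [J] are to take; the others take
    the class of 0. The equations say that some [b] in B realises these values: they translate
    solvability of the system shifted by [iota a]. *)
Definition cond_A (J : 'I_n -> bool) (r : forall m i, @term (ablang L) _
    (@coset_index_sort L n sphi) (pp_s (p := sval (phi' m)) i))
    (z : forall v, AA (actx (K := K) v)) :=
  exists a : forall x, ab_car A (@coset_index_sort L n sphi x),
    (forall m, z (inr (fund_rterm r m)) =
      cls (@ppmod L A (sval (phi' m))) (fun i => evA (r m i) a)) /\
    sat (N := AA) alpha (ejoin (fun v => z (inl v)) (pick_cls J a)).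

Definition cond_C (J : 'I_n -> bool) (z : forall v, CC (cctx (K := K) v)) :=
  exists c : ab_car C s, sat (N := CC) gamma (econsC c z) /\
    forall l, J l <-> @ppsat L C (sphi l)
      (fun i => evC (t i) (@econs _ (abstr C) _ (@sB K) s c (fun v => z (inr v)))).

Lemma Def_cond_A J r : Def (cond_A J r).
Proof.
apply: (Def_exinf (N := AA) (ws := fun x => inl (inl (@coset_index_sort L n sphi x)))
  (fun x => 0 : ab_car A (coset_index_sort x))).
set vs := vjoin _ _.
have ha x : @TFun _ AA _ vs (inl (inl (@coset_index_sort L n sphi x))) (fun e => e (inr x)).
  coord.
apply: Def_and.
  apply: Def_all => m.
  apply: (@Def_eq _ AA _ vs (inl (inr (phi' m)))); first coord.
  by apply: TFun_pi => i; exact: TFun_evalA.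
apply: (@Def_join _ AA _ _ _ _ _ vs _ (fun v e => e (inl (inl v)))
   (fun l e => pick_cls J (fun x => e (inr x)) l) (Def_sat AA alpha)) => [v|l].
  coord.
rewrite /pick_cls; apply: (@TFun_pi _ vs (phi l)
  (fun i e => if J l then e (inr (existT _ l i)) else 0)) => i.
case: (J l); first exact: (ha (existT _ l i)).
have := @TFun_evalA _ vs _ _ (fun v : void => match v with end) _
  (zterm (fun v : void => match v with end) (pp_s (p := sphi l) i)).
by apply; case.
Qed.

Lemma Def_cond_C J : Def (cond_C J).
Proof.
set vs := vcons (inl s : lsort LC) (cctx (K := K)).
apply: (@Def_ex _ CC _ _ (inl s)); apply: Def_and.
  pose F x := match x return (forall v, CC (vs v)) -> CC (cctx (K := KB K s) x) with
    | inl v => fun e => e (Some (inl v)) | inr None => fun e => e None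
    | inr (Some v) => fun e => e (Some (inr v)) end.
  have hF x : TFun (F x).
    by case: x => [v|[v|]]; [coord
      |coord|coord].
  apply: Def_ext (Def_subst (Def_sat CC gamma) hF) _ => e.
  by rewrite (_ : (fun u => F u e) = econsC (e None) (fun v => e (Some v))) //;
    apply: fext => -[v|[v|]].
apply: Def_all => l; apply: Def_iff; first exact: Def_const.
apply: Def_ppC => i.
apply: (@TFun_evalC _ vs _ (vcons s (@sB K)) (fun o e =>
  @econs _ (abstr C) _ (@sB K) s (e None) (fun v => e (Some (inr v))) o)) => -[v|].
  exact: (TFun_var (vs := vs) (Some (inr v))).
exact: (TFun_var (vs := vs) None).
Qed.

Section Elimination.
Variables (J : 'I_n -> bool) (r : forall m i, @term (ablang L) _
  (@coset_index_sort L n sphi) (pp_s (p := sval (phi' m)) i)).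
Hypothesis fundamental : forall y, @sat _ (abstr B) _ _ (translate_fm t J) y <->
  forall m, @ppsat L B (sval (phi' m)) (fun i => evB (@r m i) y).
Variable e : senv K.

Let tval b l i := evB (t i) (@econs _ (abstr B) _ (@sB K) s b (eB e)) :
  ab_car B (pp_s (p := sphi l) i).

Lemma rval_consB b l : rval (consB b e) (f l) = rho iota (tval b (l := l)).
Proof. by []. Qed.

Lemma rval_fund m :
  rval e (fund_rterm (@r) m) = rho iota (fun i => evB (@r m i) (cst e)).
Proof.
by rewrite /rval /=; congr rho; apply: fext => i; rewrite (@eval_tsub _ (abstr B)).
Qed.

Lemma translate_shift (a : forall x, ab_car A (@coset_index_sort L n sphi x)) m :
  (fun i => evB (@r m i) (fun x => cst e x - iota (a x))) =
  (fun i => evB (@r m i) (cst e) - iota (evA (@r m i) a)).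
Proof. by apply: fext => i; rewrite ab_evalB iota_eval. Qed.

Lemma solve_translate (a : forall x, ab_car A (@coset_index_sort L n sphi x)) b :
  (forall l, J l -> @ppsat L B (sphi l) (fun i => tval b i - iota (a (existT _ l i)))) ->
  forall m, @ppsat L B (sval (phi' m)) (fun i => evB (@r m i) (cst e) - iota (evA (@r m i) a)).
Proof.
move=> h m; rewrite -translate_shift.
move: m; apply/fundamental; apply/sat_translate_fm; exists b => l Jl.
move: (h l Jl); congr ppsat; apply: fext => i.
by rewrite /tval eval_split addrAC.
Qed.

(** [cond_A] gives a solution [b0] with the prescribed values of [rho], lying over an arbitrary
    point of C, and [cond_C] gives the point [c]. By [lift_solution], [b0] can be moved over [c]
    without changing these values, so the two conditions do not interact. *)
Lemma exists_pair :
  (exists b, [/\ forall l, J l <-> in_dom (tval b (l := l)),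
     sat (N := AA) alpha (ejoin (eA e) (fun l => rval (consB b e) (f l))) &
     sat gamma (EC (consB b e))]) <->
  cond_C J (EC e) /\ cond_A J (@r) (EA e).
Proof.
have domE b l : in_dom (tval b (l := l)) <-> @ppsat L C (sphi l) (fun i => evC (t i)
    (@econs _ (abstr C) _ (@sB K) s (nu b) (fun v => nu (eB e v)))).
  by rewrite /in_dom /tval (nu_tval t).
split=> [[b [hJ ha hc]]|[[c [hc hJ]] [a [hr ha]]]].
  split; first by exists (nu b); rewrite econsC_EC; split=> // l; rewrite hJ domE.
  have /dchoice[a' ha'] : forall l, exists a : forall i, ab_car A (pp_s (p := sphi l) i),
      J l -> @ppsat L B (sphi l) (fun i => tval b i - iota (a i)).
    move=> l; case: (boolP (J l)) => [/hJ/in_domP[a h]|_]; first by exists a.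
    by exists (fun=> 0).
  exists (fun x => a' (projT1 x) (projT2 x)).
  have hs := solve_translate (a := fun x => a' (projT1 x) (projT2 x)) ha'.
  split=> [m|].
    rewrite /= rval_fund; apply/rho_eq; last exact: hs.
    by apply/in_domP; exists (fun i => evA (@r m i) (fun x => a' (projT1 x) (projT2 x))).
  move: ha; congr (sat (N := AA) _ _); congr ejoin; apply: fext => l.
  rewrite rval_consB /pick_cls; case: (boolP (J l)) => Jl /=.
    by apply/rho_eq; [apply/hJ|exact: ha'].
  by apply: rho_outdom => /hJ; apply/negP.
(* Any lift of [c] shows that the tuples [r (cst e)] lie in the domain of [rho]; outside the domain,
   the equations of [cond_A] would not express membership in p(B). *)
have [b1 hb1] := pe_nu_surj PE c.
have hd l : J l -> exists a : forall i, ab_car A (pp_s (p := sphi l) i),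
    @ppsat L B (sphi l) (fun i => tval b1 i - iota (a i)).
  by move=> /hJ h; apply/in_domP/domE; rewrite hb1.
have /dchoice[a' ha'] : forall l, exists a : forall i, ab_car A (pp_s (p := sphi l) i),
    J l -> @ppsat L B (sphi l) (fun i => tval b1 i - iota (a i)).
  move=> l; case: (boolP (J l)) => [/hd[x h]|_]; first by exists x.
  by exists (fun=> 0).
have hs' := solve_translate (a := fun x => a' (projT1 x) (projT2 x)) ha'.
have : sat (N := abstr B) (translate_fm t J) (fun x => cst e x - iota (a x)).
  apply/fundamental => m; rewrite translate_shift; apply/rho_eq.
    by apply/in_domP; exists (fun i => evA (@r m i) (fun x => a' (projT1 x) (projT2 x))).
  by rewrite -rval_fund; exact: hr.
move=> /sat_translate_fm[b0 hb0].
have [b [hb hsol]] := lift_solution (t := t) (J := J) (y := eB e) (c := c) (b0 := b0)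
  (a := fun l i => a (existT _ l i)) (fun l Jl => (hJ l).1 Jl) hb0.
have hJb l : J l <-> in_dom (tval b (l := l)) by rewrite domE hb hJ.
exists b; split=> //; last by rewrite -econsC_EC hb.
move: ha; congr (sat (N := AA) _ _); congr ejoin; apply: fext => l.
rewrite rval_consB /pick_cls; case: (boolP (J l)) => Jl /=; symmetry.
  by apply/rho_eq; [apply/hJb|exact: hsol].
by apply: rho_outdom => /hJb; apply/negP.
Qed.

End Elimination.
End Pair.

(** A formula of the A-side contains finitely many expressions [rho_phi(t)]. The disjunction runs
    over the sets [J] of those whose arguments lie in the domain. *)
Lemma SP_exB (P : senv (KB K s) -> Prop) : SP P -> SP (fun e => exists b, P (consB b e)).
Proof.
move=> [T [al [ga hP]]].
have H u : SP (fun e : senv K => exists b : ab_car B s,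
    sat (al u) (EA (consB b e)) /\ sat (ga u) (EC (consB b e))).
  have [n [f [al' hal]]] := Def_support (Def_sat AA (al u)).
  pose t l i : @term (ablang L) _ (vcons s (@sB K))
    (pp_s (p := sval (projT1 (f l))) i) := projT2 (f l) i.
  have /dchoice[k] : forall J : {ffun 'I_n -> bool}, _ :=
    fun J => fundamental_pp (translate_fm_pp t J).
  move=> /dchoice[phi'] /dchoice[r hr].
  have H : SP (fun e : senv K => exists J : {ffun 'I_n -> bool},
      cond_C f (ga u) J (EC e) /\ cond_A al' J (r J) (EA e)).
    apply: SP_some => J; apply: SP_and; last exact: SP_A (Def_cond_A al' J (r J)).
    exact: SP_C (Def_cond_C f (ga u) J).
  apply: SP_ext H _ => e.
  split=> [[J /(exists_pair al' (ga u) (hr J) e)[b [_ ha hc]]]|[b [ha hc]]].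
    by exists b; split=> //; apply/hal.
  pose J := [ffun l => `[< in_dom (fun i => evB (@t l i)
    (@econs _ (abstr B) _ (@sB K) s b (eB e))) >]].
  exists J; apply/(exists_pair al' (ga u) (hr J) e); exists b; split=> // [l|]; last by apply/hal.
  by rewrite /J ffunE; split=> /asboolP.
apply: SP_ext (SP_some H) _ => e; split=> [[u [b h]]|[b /hP[u h]]].
  by exists b; apply/hP; exists u.
by exists u, b.
Qed.

End ExistsB.

(** * Every formula of the sequence is separated *)

Section SequenceFormulas.
Local Open Scope ring_scope.

Implicit Type K : sctx.

Definition rep K (s : lsort ML) : (senv K -> MM s) -> Prop :=
  match s return (senv K -> MM s) -> Prop with
  | MA s => fun f => exists t : term (actx (K := K)) s, forall e, f e = eval t (EA e)
  | MB s => fun f => exists t : @term (ablang L) _ (@sB K) s,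
      forall e, f e = evB t (eB e)
  | MC s => fun f => exists t : term (cctx (K := K)) s, forall e, f e = eval t (EC e)
  end.

Definition rep_map K K' (r : senv K' -> senv K) :=
  forall s (f : senv K -> MM s), rep f -> rep (fun e => f (r e)).

(** The premise is stated for every context [K'] over [K] and every represented [a]. It is used with
    the context having one more variable, and spares its callers the three cases of the sort. *)
Lemma SP_exM K s (P : MM s -> senv K -> Prop) :
  (forall K' (r : senv K' -> senv K) (a : senv K' -> MM s),
     rep_map r -> rep a -> SP (fun e => P (a e) (r e))) ->
  SP (fun e => exists a, P a e).
Proof.
case: s P => s P H.
- pose r (e : senv (KA K s)) : senv K := @SEnv K (fun v => eA e (Some v)) (eB e) (eC e).
  have hr : rep_map r.
    case=> s' f [t ht].
    + pose G x := match x return term (actx (K := KA K s)) (actx (K := K) x) with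
        | inl v => tvar (actx (K := KA K s)) (inl (Some v))
        | inr x => tvar (actx (K := KA K s)) (inr x) end.
      exists (tsub G t) => e; rewrite ht eval_tsub; congr (eval t _).
      by apply: fext => -[].
    + by exists t => e; rewrite ht.
    + exists t => e; rewrite ht; congr (eval t _).
  have hb : rep (s := MA _ _ s) (fun e : senv (KA K s) => eA e None).
    by exists (tvar (actx (K := KA K s)) (inl None)).
  apply: SP_ext (SP_exA (H _ r _ hr hb)) _ => -[xA xB xC].
  by split=> -[a h]; exists a.
- pose r (e : senv (KB K s)) : senv K := @SEnv K (eA e) (fun v => eB e (Some v)) (eC e).
  pose U v := @tvar (ablang L) _ (@sB (KB K s)) (Some v).
  have hr : rep_map r.
    case=> s' f [t ht].
    + pose G x := match x return term (actx (K := KB K s)) (actx (K := K) x) with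
        | inl v => tvar (actx (K := KB K s)) (inl v)
        | inr x => tvar (actx (K := KB K s))
            (inr (existT _ (projT1 x) (fun i => tsub U (projT2 x i)))) end.
      exists (tsub G t) => e; rewrite ht eval_tsub; congr (eval t _).
      apply: fext => -[v|x] //=; rewrite /rval; congr rho; apply: fext => i /=.
      by rewrite (@eval_tsub _ (abstr B)).
    + by exists (tsub U t) => e; rewrite ht (@eval_tsub _ (abstr B)).
    + pose G x := match x return term (cctx (K := KB K s)) (cctx (K := K) x) with
        | inl v => tvar (cctx (K := KB K s)) (inl v)
        | inr x => tvar (cctx (K := KB K s)) (inr (Some x)) end.
      exists (tsub G t) => e; rewrite ht eval_tsub; congr (eval t _).
      by apply: fext => -[].
  have hb : rep (s := MB _ _ s) (fun e : senv (KB K s) => eB e None).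
    by exists (@tvar (ablang L) _ (@sB (KB K s)) None).
  apply: SP_ext (SP_exB (H _ r _ hr hb)) _ => -[xA xB xC].
  by split=> -[a h]; exists a.
- pose r (e : senv (KC K s)) : senv K := @SEnv K (eA e) (eB e) (fun v => eC e (Some v)).
  have hr : rep_map r.
    case=> s' f [t ht].
    + by exists t => e; rewrite ht.
    + by exists t => e; rewrite ht.
    + pose G x := match x return term (cctx (K := KC K s)) (cctx (K := K) x) with
        | inl v => tvar (cctx (K := KC K s)) (inl (Some v))
        | inr x => tvar (cctx (K := KC K s)) (inr x) end.
      exists (tsub G t) => e; rewrite ht eval_tsub; congr (eval t _).
      by apply: fext => -[].
  have hb : rep (s := MC _ _ s) (fun e : senv (KC K s) => eC e None).
    by exists (tvar (cctx (K := KC K s)) (inl None)).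
  apply: SP_ext (SP_exC (H _ r _ hr hb)) _ => -[xA xB xC].
  by split=> -[a h]; exists a.
Qed.

Lemma SP_exsM n (ws : 'I_n -> lsort ML) K
    (P : (forall i, MM (ws i)) -> senv K -> Prop) :
  (forall K' (r : senv K' -> senv K) (w : forall i, senv K' -> MM (ws i)),
     rep_map r -> (forall i, rep (w i)) -> SP (fun e => P (fun i => w i e) (r e))) ->
  SP (fun e => exists w, P w e).
Proof.
elim: n ws K P => [|n IH] ws K P H.
  have d0 (i : 'I_0) : False by case: i.
  have h : SP (fun e => P (fun i => False_rect _ (d0 i)) e).
    exact: (H K id (fun i e => False_rect _ (d0 i)) (fun s f h => h)
              (fun i => False_rect _ (d0 i))).
  apply: SP_ext h _ => e; split=> [h|[w h]]; first by eexists; exact: h.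
  by move: h; congr P; apply: fext => -[].
have h : SP (fun e => exists a, exists w, P (dcons (S := fun i => MM (ws i)) a w) e).
  apply: SP_exM => K1 r1 a hr1 ha; apply: IH => K2 r2 w hr2 hw.
  apply: (H K2 (fun e => r1 (r2 e))
    (fun i e => dcons (S := fun i => MM (ws i)) (a (r2 e)) (fun j => w j e) i)).
    by move=> s f hf; exact: hr2 (hr1 _ _ hf).
  move=> i; case: (unliftP ord0 i) => [j|] E; subst i.
    rewrite (_ : (fun e => _) = w j) //; apply: funext => e; exact: dconsS.
  rewrite (_ : (fun e => _) = (fun e => a (r2 e))); first exact: hr2.
  by apply: funext => e; exact: dcons0.
apply: SP_ext h _ => e; split=> [[a [w h]]|[w h]]; first by eexists; exact: h.
exists (w ord0), (fun j => w (lift ord0 j)).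
by rewrite (dcons_eta (S := fun i => MM (ws i))).
Qed.

(** The fundamental system reduces the claim to formulas of Phi. There, membership of [y - iota a]
    in phi(B) means that [y] lies in the domain of [rho], a condition on C*, and that [rho y] is the
    class of [a], a condition on A*. *)
Lemma SP_shift K (p : ppform L) (F : forall i, senv K -> ab_car B (pp_s (p := p) i))
    (a : forall i, senv K -> ab_car A (pp_s (p := p) i)) :
  (forall i, rep (s := MB _ _ (@pp_s L p i)) (F i)) ->
  (forall i, rep (s := MA _ _ (inl (inl (@pp_s L p i)))) (a i)) ->
  SP (fun e => @ppsat L B p (fun i => F i e - iota (a i e))).
Proof.
move=> /dchoice[t ht] /dchoice[u hu].
have [k [phi [r [hphi hr]]]] := FS p.
pose ph j : idx Phi := exist _ (phi j) (hphi j).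
pose R j : rterm K := existT _ (ph j) (fun i => tsub t (r j i)).
have h : SP (fun e => forall j, @ppsat L C (phi j) (fun i => evC (tsub t (r j i)) (fun v => EC e (inr v)))
    /\ EA e (inr (R j)) = cls (@ppmod L A (phi j)) (fun i => evA (r j i) (fun i => eval (u i) (EA e)))).
  apply: SP_all => j; apply: SP_and.
    apply: (SP_C (Q := fun z => @ppsat L C (phi j) (fun i => evC (tsub t (r j i)) (fun v => z (inr v))))).
    apply: Def_ppC => i; apply: (@TFun_evalC _ (cctx (K := K)) _ (@sB K)
      (fun v z => z (inr v))) => v.
    coord.
  apply: (SP_A (Q := fun z => z (inr (R j)) = cls (@ppmod L A (phi j))
    (fun i => evA (r j i) (fun i => eval (u i) z)))).
  apply: (@Def_eq _ AA _ (actx (K := K)) (inl (inr (ph j)))); first coord.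
  apply: (@TFun_pi _ (actx (K := K)) (ph j)) => i.
  apply: (@TFun_evalA _ (actx (K := K)) _ _ (fun i z => eval (u i) z)) => i'.
  by exists (u i').
apply: SP_ext h _ => e; rewrite hr.
have Et j i : evB (tsub t (r j i)) (eB e) = evB (r j i) (fun i => F i e).
  by rewrite (@eval_tsub _ (abstr B)); congr (evB _ _); apply: fext => i'; rewrite ht.
have Eu j i : evA (r j i) (fun i => eval (u i) (EA e)) = evA (r j i) (fun i => a i e).
  by congr (evA _ _); apply: fext => i'; rewrite hu.
have D j : @ppsat L C (phi j) (fun i => evC (tsub t (r j i)) (fun v => EC e (inr v))) <->
    in_dom (fun i => evB (r j i) (fun i => F i e)).
  rewrite /in_dom; suff -> : (fun i => nu (evB (r j i) (fun i => F i e))) =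
    (fun i => evC (tsub t (r j i)) (fun v => EC e (inr v))) by [].
  by apply: fext => i; rewrite -Et nu_eval.
have E j : (fun i => evB (r j i) (fun i => F i e - iota (a i e))) =
   (fun i => evB (r j i) (fun i => F i e) - iota (evA (r j i) (fun i => a i e))).
  by apply: fext => i; rewrite ab_evalB iota_eval.
have R' j : EA e (inr (R j)) = rho iota (fun i => evB (r j i) (fun i => F i e)).
  by rewrite /= /rval /=; congr rho; apply: fext => i; rewrite Et.
split=> h j; have := h j.
  by rewrite D R' E => -[hd]; move/(rho_eq _ hd); congr ppsat; apply: fext => i; rewrite Eu.
rewrite E D R' => h'.
have hd : in_dom (fun i => evB (r j i) (fun i => F i e)).
  by apply/in_domP; exists (fun i => evA (r j i) (fun i => a i e)).
split=> //; apply/(rho_eq _ hd); move: h'; congr ppsat; apply: fext => i.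
by rewrite Eu.
Qed.

Lemma rep_zeroA K (s : lsort L) : rep (K := K) (s := MA _ _ (inl (inl s))) (fun=> 0 : ab_car A s).
Proof.
have [|t ht] := @TFun_evalA _ (actx (K := K)) _ _ (fun v : void => match v with end)
  _ (zterm (fun v : void => match v with end) s); first by case.
by exists t => e; rewrite ht.
Qed.

Lemma SP_pp K (p : ppform L) (F : forall i, senv K -> ab_car B (pp_s (p := p) i)) :
  (forall i, rep (s := MB _ _ (@pp_s L p i)) (F i)) -> SP (fun e => @ppsat L B p (fun i => F i e)).
Proof.
move=> hF; apply: SP_ext (SP_shift hF (fun i => rep_zeroA K _)) _ => e; have -> // : (fun i => F i e - iota (0 : ab_car A _)) = (fun i => F i e).
apply: fext => i.
suff -> : iota (0 : ab_car A (pp_s i)) = 0 by rewrite subr0.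
by apply: (@addrI _ (iota (0 : ab_car A (pp_s i)))); rewrite -iotaD !addr0.
Qed.

Lemma SP_eqM K s (f g : senv K -> MM s) : rep f -> rep g -> SP (fun e => f e = g e).
Proof.
case: s f g => s f g [t ht] [u hu].
- apply: SP_ext (SP_A (Def_eq (ex_intro _ t (fun=> erefl)) (ex_intro _ u (fun=> erefl)))) _ => e.
  by rewrite ht hu.
(* Equality in B is a p.p.-formula in two variables. *)
- pose p := @PPForm L 2 (fun=> s) (@feq (ablang L) _ (fun=> s) s
    (@tvar (ablang L) _ (fun=> s) ord0) (@tvar (ablang L) _ (fun=> s) ord_max)) isT.
  have := @SP_pp K p (fun i => if i == ord0 then f else g).
  move=> H; apply: SP_ext (H _) _ => // i.
  by case: (_ == _); [exists t|exists u].
- apply: SP_ext (SP_C (Def_eq (ex_intro _ t (fun=> erefl)) (ex_intro _ u (fun=> erefl)))) _ => e.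
  by rewrite ht hu.
Qed.

(** Graphs are used because [iota x] is not a term in the B-variables, so terms of the sequence are
    not closed under [rep]. [SP_term] unfolds nested terms by quantifying over the values of the
    subterms. *)
Lemma SP_graph K (f : fsym (ML)) (F : forall i, senv K -> MM (fdom (f := f) i))
    (y : senv K -> MM (fcod f)) :
  (forall i, rep (F i)) -> rep y -> SP (fun e => sfun (fun i => F i e) = y e).
Proof.
case: f F y => [f|f|f|s|s|p] F y /dchoice[t ht] hy.
- apply: SP_eqM hy; exists (@tapp LA _ (actx (K := K)) f t) => e /=; congr (sfun (s := AA) _); apply: fext => i; exact: ht.
- apply: SP_eqM hy; exists (@tapp (ablang L) _ (@sB K) f t) => e /=; congr (sfun (s := abstr B) _); apply: fext => i; exact: ht.
- apply: SP_eqM hy; exists (@tapp LC _ (cctx (K := K)) f t) => e /=; congr (sfun (s := CC) _); apply: fext => i; exact: ht.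
- have [u hu] := hy.
  (* The graph of [iota] is the shift [y - iota x] of the p.p.-formula [y = 0]. *)
  pose p := @PPForm L 1 (fun=> s) (@feq (ablang L) _ (fun=> s) s
    (@tvar (ablang L) _ (fun=> s) ord0) (zterm (fun=> s) s)) isT.
  have H := @SP_shift K p (fun i => y) (fun i => F ord0) (fun=> hy)
    (fun i => ex_intro _ (t ord0) (ht ord0)).
  apply: SP_ext H _ => e; rewrite /ppsat /=; split=> [h|<-]; last by rewrite subrr.
  by symmetry; apply/eqP; rewrite -subr_eq0; apply/eqP.
- have h : rep (s := MC _ _ (inl s)) (fun e => nu (F ord0 e)).
    have [|u hu] := @TFun_evalC _ (cctx (K := K)) _ (@sB K)
      (fun v z => z (inr v)) _ (t ord0).
      by move=> v; coord.
    by exists u => e; rewrite hu ht nu_eval.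
  exact: SP_eqM h hy.
- have h : rep (s := MA _ _ (inl (inr p))) (fun e => rho iota (fun i => F i e)).
    exists (tvar (actx (K := K)) (inr (existT _ p t))) => e /=.
    by rewrite /rval; congr rho; apply: fext => i; rewrite ht.
  exact: SP_eqM h hy.
Qed.

Lemma SP_rel K (r : rsym (ML)) (F : forall i, senv K -> MM (rdom (r := r) i)) :
  (forall i, rep (F i)) -> SP (fun e => srel (fun i => F i e)).
Proof.
case: r F => r F hF.
- have [t ht] := dchoice hF.
  apply: SP_ext (SP_A (Def_sat AA (@frel LA _ (actx (K := K)) r t))) _ => e /=.
  by rewrite (_ : (fun i => eval (t i) (EA e)) = (fun i => F i e)) //;
    apply: fext => i; rewrite ht.
- pose p := @PPForm L (rar r) (rdom (r := r)) (@frel (ablang L) _ (rdom (r := r)) r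
    (fun i => @tvar (ablang L) _ (rdom (r := r)) i)) isT.
  exact: (@SP_pp K p F).
- have [t ht] := dchoice hF.
  apply: SP_ext (SP_C (Def_sat CC (@frel LC _ (cctx (K := K)) r t))) _ => e /=.
  by rewrite (_ : (fun i => eval (t i) (EC e)) = (fun i => F i e)) //;
    apply: fext => i; rewrite ht.
Qed.

Lemma SP_term V (vs : V -> lsort ML) s (t : term vs s) K
    (F : forall v, senv K -> MM (vs v)) (y : senv K -> MM s) :
  (forall v, rep (F v)) -> rep y -> SP (fun e => eval t (fun v => F v e) = y e).
Proof.
elim: t K F y => [v|f a IH] K F y hF hy; first exact: SP_eqM.
have h : SP (fun e => exists w : forall i, MM (fdom (f := f) i),
    (forall i, eval (a i) (fun v => F v e) = w i) /\ sfun w = y e).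
  apply: SP_exsM => K' r w hr hw; apply: SP_and.
    by apply: SP_all => i; apply: IH => // v; exact: hr.
  exact: SP_graph hw (hr _ _ hy).
apply: SP_ext h _ => e; split=> [[w [hw <-]]|h].
  rewrite -(_ : (fun i => eval (a i) (fun v => F v e)) = w) //.
  by apply: fext => i; exact: hw.
by exists (fun i => eval (a i) (fun v => F v e)).
Qed.

(* Every predicate of the sequence is a Boolean combination of predicates of
   [As], evaluated at the variables and at the [rho_phi (t x)], and of predicates
   of [Cs], evaluated at the variables and at the [nu x]. *)
Lemma SP_formula V (vs : V -> lsort ML) (p : formula vs) K
    (F : forall v, senv K -> MM (vs v)) :
  (forall v, rep (F v)) -> SP (fun e => sat p (fun v => F v e)).
Proof.
elim: p K F => {V vs}
    [V vs|V vs s t u|V vs r a|V vs p IH|V vs p IHp q IHq|V vs s p IH] K F hF /=.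
- exact: SP_const.
- have h : SP (fun e => exists w : MM s, eval t (fun v => F v e) = w /\
      eval u (fun v => F v e) = w).
    by apply: SP_exM => K' r w hr hw; apply: SP_and; apply: SP_term => // v; exact: hr.
  by apply: SP_ext h _ => e; split=> [[w [-> ->]]|->] //; eexists.
- have h : SP (fun e => exists w : forall i, MM (rdom (r := r) i),
      (forall i, eval (a i) (fun v => F v e) = w i) /\ srel w).
    apply: SP_exsM => K' r' w hr hw; apply: SP_and; last exact: SP_rel.
    by apply: SP_all => i; apply: SP_term => // v; exact: hr.
  apply: SP_ext h _ => e; split=> [[w [hw]]|h'].
    rewrite -(_ : (fun i => eval (a i) (fun v => F v e)) = w) //.
    by apply: fext => i; exact: hw.
  by exists (fun i => eval (a i) (fun v => F v e)).
- exact: SP_not (IH _ _ hF).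
- exact: SP_and (IHp _ _ hF) (IHq _ _ hF).
- apply: SP_exM => K' r a hr ha.
  pose G o := match o return senv K' -> MM (vcons s vs o) with
    | Some v => fun e => F v (r e) | None => a end.
  have hG o : rep (G o) by case: o => [v|]; [exact: hr _ _ (hF v)|exact: ha].
  apply: SP_ext (IH _ G hG) _ => e.
  rewrite (_ : (fun v => G v e) = econs (vs := vs) (a e) (fun v => F v (r e))) //.
  by apply: fext => -[].
Qed.

End SequenceFormulas.

(** * Induced structure on A* and C* *)

Section InducedStructure.
Variable G : set (elt MM).
Hypothesis closedG : forall x, generated G x -> G x.

Definition setA : set (elt AA) := [set x | G (inA x)].
Definition setB : set (elt BB) := [set x | G (inB x)].
Definition setC : set (elt CC) := [set x | G (inC x)].

Lemma generated_evalB (X : set (elt MM)) V (vs : V -> lsort L)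
    (e : forall v, ab_car B (vs v)) s (t : @term (ablang L) V vs s) :
  (forall v, generated X (inB (@Elt _ BB _ (e v)))) ->
  generated X (inB (@Elt _ BB s (@eval _ BB _ _ _ t e))).
Proof.
move=> h; elim: t => [v|f a IH] //=.
exact: (@gen_fun _ MM X (MfB _ _ _ f) (fun i => @eval _ BB _ _ _ (a i) e)).
Qed.

Variables (VA : Type) (va : VA -> lsort LA) (VC : Type) (vc : VC -> lsort LC).

Definition ind_ctx : sctx := @SCtx
  _ (vjoin va (tp_ctx (X := setA))) _ (tp_ctx (X := setB)) _ (vjoin vc (tp_ctx (X := setC))).

Definition ind_env (xA : forall v, AA (va v)) (xC : forall v, CC (vc v)) : senv ind_ctx :=
  @SEnv ind_ctx (ejoin xA (hval (H := setA))) (hval (H := setB))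
    (ejoin xC (hval (H := setC))).

Lemma rep_param (y : {y | G y}) : exists f : senv ind_ctx -> MM (tp_ctx y),
  rep f /\ forall xA xC, f (ind_env xA xC) = hval y.
Proof.
case: y => [[[s|s|s] a] h].
- pose v : cA ind_ctx := inr (exist (fun x => setA x) (existT _ s a) h).
  exists (fun e => eA e v); split=> //.
  by exists (tvar (actx (K := ind_ctx)) (inl v)).
- pose v : cB ind_ctx := exist (fun x => setB x) (existT _ s a) h.
  exists (fun e => eB e v); split=> //.
  by exists (@tvar (ablang L) _ (@sB ind_ctx) v).
- pose v : cC ind_ctx := inr (exist (fun x => setC x) (existT _ s a) h).
  exists (fun e => eC e v); split=> //.
  by exists (tvar (cctx (K := ind_ctx)) (inl v)).
Qed.

Lemma param_A (r : rterm ind_ctx) : exists t : term (vjoin va (tp_ctx (X := setA))) (rsort r),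
  forall xA xC, eval t (ejoin xA (hval (H := setA))) = rval (ind_env xA xC) r.
Proof.
pose a := rho iota (fun i => @eval _ BB _ _ _ (projT2 r i) (hval (H := setB))).
have h : setA (@Elt _ AA (rsort r) a).
  apply: closedG; apply: (@gen_fun _ MM G (Mrho _ _ _ (projT1 r))
    (fun i => @eval _ BB _ _ _ (projT2 r i) (hval (H := setB)))) => i.
  by apply: generated_evalB => -[[s x] hx]; exact: gen_base.
by exists (tvar (vjoin va (tp_ctx (X := setA))) (inr (exist (fun x => setA x) _ h))).
Qed.

Lemma param_C (v : cB ind_ctx) : exists t : term (vjoin vc (tp_ctx (X := setC))) (nu_sort v),
  forall xA xC, eval t (ejoin xC (hval (H := setC))) = nu (eB (ind_env xA xC) v).
Proof.
case: v => [[s b] h].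
have hc : setC (@Elt _ CC (inl s) (nu b)).
  apply: closedG.
  exact (@gen_fun _ MM G (@Mnu L Phi _ _ _ s) (fun=> b) (fun=> @gen_base _ MM G (inB (existT _ s b)) h)).
by exists (tvar (vjoin vc (tp_ctx (X := setC))) (inr (exist (fun x => setC x) _ hc))).
Qed.

(** With free variables in A* and C* only, the B-variables are parameters of [G]. Every [rho_phi(t)]
    and every [nu x] is then evaluated in [G], which is closed under the functions of M, and becomes
    a parameter of A* or C*. *)
Lemma induced_structure (Q : (forall v, MM (vjoin (vjoin (fun v => sortA (va v))
    (fun v => sortC (vc v))) (tp_ctx (X := G)) v)) -> Prop) : Def Q ->
  exists (T : finType) (a : T -> formula (vjoin va (tp_ctx (X := setA))))
    (c : T -> formula (vjoin vc (tp_ctx (X := setC)))),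
  forall (xA : forall v, AA (va v)) (xC : forall v, CC (vc v)),
    Q (ejoin (N := MM) (ejoin (N := MM) (vs := fun v => sortA (va v)) xA
       (ws := fun v => sortC (vc v)) xC) (hval (H := G))) <->
    exists t, sat (a t) (ejoin xA (hval (H := setA))) /\ sat (c t) (ejoin xC (hval (H := setC))).
Proof.
move=> [p hp].
have [g hg] := dchoice rep_param.
pose F x := match x return senv ind_ctx -> MM (vjoin (vjoin (fun v => sortA (va v))
    (fun v => sortC (vc v))) (tp_ctx (X := G)) x) with
  | inl (inl v) => fun e => eA e (inl v)
  | inl (inr v) => fun e => eC e (inl v)
  | inr y => g y end.
have hF x : rep (F x).
  case: x => [[v|v]|y]; last by have [] := hg y.
    by exists (tvar (actx (K := ind_ctx)) (inl (inl v))).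
  by exists (tvar (cctx (K := ind_ctx)) (inl (inl v))).
have [T [a [c hT]]] := SP_formula p hF.
have [u hu] := dchoice param_A; have [w hw] := dchoice param_C.
pose GA x := match x return term (vjoin va (tp_ctx (X := setA))) (actx (K := ind_ctx) x) with
  | inl v => tvar (vjoin va (tp_ctx (X := setA))) v | inr r => u r end.
pose GC x := match x return term (vjoin vc (tp_ctx (X := setC))) (cctx (K := ind_ctx) x) with
  | inl v => tvar (vjoin vc (tp_ctx (X := setC))) v | inr r => w r end.
exists T, (fun t => fsub (a t) GA), (fun t => fsub (c t) GC) => xA xC.
rewrite -hp (_ : ejoin _ _ = fun x => F x (ind_env xA xC)); last first.
  by apply: fext => -[[v|v]|y] //=; have [_ ->] := hg y.
rewrite hT.
have EA' : (fun x => eval (GA x) (ejoin xA (hval (H := setA)))) = EA (ind_env xA xC).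
  by apply: fext => -[v|r] //=; rewrite (hu r xA xC).
have EC' : (fun x => eval (GC x) (ejoin xC (hval (H := setC)))) = EC (ind_env xA xC).
  by apply: fext => -[v|r] //=; rewrite (hw r xA xC).
by split=> -[t [ha hc]]; exists t; rewrite ?sat_fsub EA' EC' in ha hc *.
Qed.

End InducedStructure.

Section Parts.
Lemma parts_home (D : set (elt (eqstr MM))) : parts D = home_part D.
Proof.
apply/seteqP; split=> [x|[[s|s|s] a] h]; first by case=> [[|]|] [y hy <-].
- by left; left; exists (existT _ s a).
- by left; right; exists (existT _ s a).
- by right; exists (existT _ s a).
Qed.

Lemma interp_A (f : fsym LA) : TFun (N := eqstr MM)
  (vs := fun i => inl (sortA (fdom (f := f) i))) (s := inl (sortA (fcod f)))
  (fun y : forall i, eqstr MM _ => sfun (s := AA) (fun i => y i)).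
Proof.
by exists (@tapp (eqlang MM) _ _ (inl (MfA _ _ _ f)) (fun i => @tvar (eqlang MM) _
  (fun i => inl (sortA (fdom (f := f) i))) i)).
Qed.

Lemma interp_relA (r : rsym LA) : Def (N := eqstr MM)
  (vs := fun i => inl (sortA (rdom (r := r) i)))
  (fun y : forall i, eqstr MM _ => srel (s := AA) (fun i => y i)).
Proof.
by exists (@frel (eqlang MM) _ _ (MA _ _ r) (fun i => @tvar (eqlang MM) _
  (fun i => inl (sortA (rdom (r := r) i))) i)).
Qed.

Lemma interp_C (f : fsym LC) : TFun (N := eqstr MM)
  (vs := fun i => inl (sortC (fdom (f := f) i))) (s := inl (sortC (fcod f)))
  (fun y : forall i, eqstr MM _ => sfun (s := CC) (fun i => y i)).
Proof.
by exists (@tapp (eqlang MM) _ _ (inl (MfC _ _ _ f)) (fun i => @tvar (eqlang MM) _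
  (fun i => inl (sortC (fdom (f := f) i))) i)).
Qed.

Lemma interp_relC (r : rsym LC) : Def (N := eqstr MM)
  (vs := fun i => inl (sortC (rdom (r := r) i)))
  (fun y : forall i, eqstr MM _ => srel (s := CC) (fun i => y i)).
Proof.
by exists (@frel (eqlang MM) _ _ (MC _ _ r) (fun i => @tvar (eqlang MM) _
  (fun i => inl (sortC (rdom (r := r) i))) i)).
Qed.

Variable Gamma : set (elt (eqstr MM)).
Hypothesis dclG : Gamma = dcl Gamma.
Hypothesis homeG : Gamma = dcl (@home _ MM @` home_part Gamma).

Let closedG := @generated_home_part _ MM Gamma dclG.
Lemma psat_parts VA (va : VA -> lsort LA) VC (vc : VC -> lsort LC)
    V (vs : V -> lsort (eqlang MM)) (p : pform (eqstr MM) vs)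
    (F : forall u, (forall v, MM (vjoin (fun v => sortA (va v)) (fun v => sortC (vc v)) v)) ->
      eqstr MM (vs u)) :
  params_in Gamma p -> (forall u, erep (F u)) ->
  exists (T : finType) (al : T -> pform AA va) (ga : T -> pform CC vc),
    (forall t, params_in (Apart Gamma) (al t) /\ params_in (Cpart Gamma) (ga t)) /\
    forall xA xC, psat p (fun u => F u (ejoin (N := MM) xA xC)) <->
      exists t, psat (al t) xA /\ psat (ga t) xC.
Proof.
rewrite {1}homeG => hp hF; have [q hq] := Def_dcl hp hF.
have [T [al [ga hT]]] := induced_structure closedG (Def_sat MM q).
have /choice[al' hal] t := @pform_DefG _ AA (setA (home_part Gamma)) _ va
  (fun x => sat (al t) (ejoin x (hval (H := setA (home_part Gamma)))))
  (ex_intro _ _ (conj (Def_sat AA (al t)) (fun=> conj id id))).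
have /choice[ga' hga] t := @pform_DefG _ CC (setC (home_part Gamma)) _ vc
  (fun x => sat (ga t) (ejoin x (hval (H := setC (home_part Gamma)))))
  (ex_intro _ _ (conj (Def_sat CC (ga t)) (fun=> conj id id))).
exists T, al', ga'; split=> [t|xA xC]; first by split; [apply: (hal t).1|apply: (hga t).1].
rewrite -hq hT; split=> -[t [h1 h2]]; exists t; split.
- exact/(hal t).2.
- exact/(hga t).2.
- exact/(hal t).2.
- exact/(hga t).2.
Qed.

(** Applied to variables of A* alone, the separation leaves in the C-factor of each rectangle a
    sentence over [G], which does not depend on the indices. *)
Lemma indiscernible_A m (s : 'I_m -> lsort LA) (b : nat -> forall i, AA (s i)) :
  indiscernible (Apart Gamma) b ->
  indiscernible (N := eqstr MM) Gamma (s := fun i => inl (sortA (s i))) b.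
Proof.
move=> hb n p hp a a' ha ha'.
have [ij|T [al [ga [h E]]]] := @psat_parts _ (fun ij : 'I_n * 'I_m => s ij.2)
  _ (of_void (lsort LC)) _ _ p (fun ij e => e (inl ij)) hp.
  exact: (TFun_var (N := MM) (vs := vjoin (fun ij => sortA (s ij.2)) _) (inl ij)).
have xC v : CC (of_void (lsort LC) v) by case: v.
have I t := hb _ (al t) (h t).1 a a' ha ha'.
by rewrite !(E _ xC); split=> -[t [/I h1 h2]]; exists t.
Qed.

Lemma indiscernible_C m (s : 'I_m -> lsort LC) (b : nat -> forall i, CC (s i)) :
  indiscernible (Cpart Gamma) b ->
  indiscernible (N := eqstr MM) Gamma (s := fun i => inl (sortC (s i))) b.
Proof.
move=> hb n p hp a a' ha ha'.
have [ij|T [al [ga [h E]]]] := @psat_parts _ (of_void (lsort LA)) _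
  (fun ij : 'I_n * 'I_m => s ij.2) _ _ p (fun ij e => e (inr ij)) hp.
  exact: (TFun_var (N := MM) (vs := vjoin _ (fun ij => sortC (s ij.2))) (inr ij)).
have xA v : AA (of_void (lsort LA) v) by case: v.
have I t := hb _ (ga t) (h t).2 a a' ha ha'.
by rewrite !(E xA); split=> -[t [h1 /I h2]]; exists t.
Qed.

Lemma type_forks_A (X D : set (elt (eqstr MM))) :
  type_forks (Apart Gamma) (tp (Apart X) (Apart D)) -> type_forks Gamma (tp X D).
Proof.
exact: (@forks_expand LA (eqlang MM) AA (eqstr MM) (fun s => inl (sortA s))
  (fun s x => x) (fun s x => x) (fun s x => erefl) (fun s x => erefl)
  interp_A interp_relA X D Gamma indiscernible_A).
Qed.

Lemma type_forks_C (X D : set (elt (eqstr MM))) :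
  type_forks (Cpart Gamma) (tp (Cpart X) (Cpart D)) -> type_forks Gamma (tp X D).
Proof.
exact: (@forks_expand LC (eqlang MM) CC (eqstr MM) (fun s => inl (sortC s))
  (fun s x => x) (fun s x => x) (fun s x => erefl) (fun s x => erefl)
  interp_C interp_relC X D Gamma indiscernible_C).
Qed.

End Parts.

(** * Conjugates of a coset *)

Section Cosets.
Local Open Scope ring_scope.

Lemma TFun_B U (us : U -> lsort L) V (vs : V -> lsort ML)
    (F : forall u, (forall v, MM (vs v)) -> ab_car B (us u)) s (t : @term (ablang L) U us s) :
  (forall u, @TFun _ MM _ vs (sortB (us u)) (F u)) ->
  @TFun _ MM _ vs (sortB s) (fun e => @eval _ BB _ _ _ t (fun u => F u e)).
Proof.
move=> hF; elim: t => [u|f a IH] //=.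
exact: (@TFun_app _ MM _ vs (MfB _ _ _ f) (fun i e => @eval _ BB _ _ _ (a i) (fun u => F u e))).
Qed.

Lemma TFun_nu V (vs : V -> lsort ML) s (f : (forall v, MM (vs v)) -> ab_car B s) :
  @TFun _ MM _ vs (sortB s) f -> @TFun _ MM _ vs (sortC (inl s)) (fun e => nu (f e)).
Proof. by move=> hf; apply: (@TFun_app _ MM _ vs (@Mnu L Phi _ _ _ s) (fun=> f)). Qed.

Lemma interp_funA (f : fsym LA) : TFun (N := MM) (vs := fun i => sortA (fdom (f := f) i))
  (s := sortA (fcod f)) (fun y : forall i, MM _ => sfun (s := AA) (fun i => y i)).
Proof.
by exists (@tapp ML _ _ (MfA _ _ _ f) (fun i => @tvar ML _ (fun i => sortA (fdom (f := f) i)) i)).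
Qed.

Lemma interp_relA' (r : rsym LA) : Def (N := MM) (vs := fun i => sortA (rdom (r := r) i))
  (fun y : forall i, MM _ => srel (s := AA) (fun i => y i)).
Proof.
by exists (@frel ML _ _ (MA _ _ r) (fun i => @tvar ML _ (fun i => sortA (rdom (r := r) i)) i)).
Qed.

Lemma interp_funC (f : fsym LC) : TFun (N := MM) (vs := fun i => sortC (fdom (f := f) i))
  (s := sortC (fcod f)) (fun y : forall i, MM _ => sfun (s := CC) (fun i => y i)).
Proof.
by exists (@tapp ML _ _ (MfC _ _ _ f) (fun i => @tvar ML _ (fun i => sortC (fdom (f := f) i)) i)).
Qed.

Lemma interp_relC' (r : rsym LC) : Def (N := MM) (vs := fun i => sortC (rdom (r := r) i))
  (fun y : forall i, MM _ => srel (s := CC) (fun i => y i)).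
Proof.
by exists (@frel ML _ _ (MC _ _ r) (fun i => @tvar ML _ (fun i => sortC (rdom (r := r) i)) i)).
Qed.

Lemma Def_C U (us : U -> lsort LC) (Q : (forall u, CC (us u)) -> Prop) V (vs : V -> lsort ML)
    (F : forall u, (forall v, MM (vs v)) -> CC (us u)) :
  Def Q -> (forall u, @TFun _ MM _ vs (sortC (us u)) (F u)) ->
  Def (N := MM) (vs := vs) (fun e => Q (fun u => F u e)).
Proof.
exact: (@Def_reduct LC ML CC MM (fun s => sortC s) (fun s x => x) (fun s x => x)
  (fun s x => erefl) (fun s x => erefl) interp_funC interp_relC').
Qed.

Lemma indiscernible_setA (G : set (elt MM)) r (ts : 'I_r -> lsort ML)
    (b : nat -> forall t, MM (ts t)) m (s : 'I_m -> lsort LA)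
    (f : forall j, (forall t, MM (ts t)) -> AA (s j)) :
  indG G b -> (forall j, @TFunG _ MM G _ ts (sortA (s j)) (f j)) ->
  indiscernible (setA G) (fun k j => f j (b k)).
Proof.
exact: (@indiscernible_reduct LA ML AA MM (fun s => sortA s) (fun s x => x) (fun s x => x)
  (fun s x => erefl) (fun s x => erefl) interp_funA interp_relA' G r ts b m s f).
Qed.

Lemma indiscernible_setC (G : set (elt MM)) r (ts : 'I_r -> lsort ML)
    (b : nat -> forall t, MM (ts t)) m (s : 'I_m -> lsort LC)
    (f : forall j, (forall t, MM (ts t)) -> CC (s j)) :
  indG G b -> (forall j, @TFunG _ MM G _ ts (sortC (s j)) (f j)) ->
  indiscernible (setC G) (fun k j => f j (b k)).
Proof.
exact: (@indiscernible_reduct LC ML CC MM (fun s => sortC s) (fun s x => x) (fun s x => x)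
  (fun s x => erefl) (fun s x => erefl) interp_funC interp_relC' G r ts b m s f).
Qed.

Lemma Def_ppM V (vs : V -> lsort ML) (p : ppform L)
    (F : forall i, (forall v, MM (vs v)) -> ab_car C (pp_s (p := p) i)) :
  (forall i, @TFun _ MM _ vs (sortC (inl (@pp_s L p i))) (F i)) ->
  Def (N := MM) (vs := vs) (fun e => @ppsat L C p (fun i => F i e)).
Proof.
move=> hF; pose us (i : 'I_(pp_n p)) : lsort LC := inl (@pp_s L p i).
have hQ : Def (N := CC) (vs := us) (fun z => @ppsat L C p z).
  by apply: Def_ppC => i; coord.
exact: (Def_C (us := us) hQ hF).
Qed.

Variable p : ppform L.
Implicit Types (w z : forall i, ab_car C (pp_s (p := p) i)).

Definition coset_tuple (i : 'I_(pp_n p)) : lsort ML := sortC (inl (@pp_s L p i)).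

Notation CT := (forall i, MM (coset_tuple i)).

Definition coset_cls (w : CT) : eqstr MM (inr (coset_sort iota nu As Cs p)) :=
  cls (@eq_rel _ MM (coset_sort iota nu As Cs p)) w.

Lemma coset_cls_eq (w z : CT) : coset_cls w = coset_cls z <-> @ppmod L C p w z.
Proof.
rewrite /coset_cls (@cls_eq _ MM (coset_sort iota nu As Cs p)).
exact: (@sat_coset_fm L A B C iota nu Phi As Cs p w z).
Qed.

(** If finitely many cosets covered [chi], then meeting [chi] would be a condition over Gamma
    satisfied by finitely many cosets, among them that of [w], which would be algebraic. *)
Lemma coset_conjugates (Gamma : set (elt (eqstr MM))) w (chi : CT -> Prop) :
  ~ acl Gamma (coset iota nu As Cs w) -> DefG (home_part Gamma) chi -> chi w ->
  exists s : nat -> CT, (forall i, chi (s i)) /\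
    forall i j, (i < j)%N -> ~ @ppmod L C p (s i) (s j).
Proof.
move=> hw hchi cw.
have step (l : seq CT) : exists z : CT, chi z /\ forall z', List.In z' l -> ~ @ppmod L C p z' z.
  apply: contrapT => hn; apply: hw.
  have [Q [hQ hQE]] := hchi.
  pose E := coset_sort iota nu As Cs p.
  pose vs := ctx1 (inr E : lsort (eqlang MM)).
  pose ws := vjoin vs (home_param (G := home_part Gamma)).
  have hR : Def (N := eqstr MM) (vs := ws) (fun e => exists z : CT,
      coset_cls z = e (inl tt) /\ Q (ejoin z (fun y => e (inr y)))).
    pose zs := vjoin ws (fun i => inl (coset_tuple i)).
    apply: (@Def_exs _ (eqstr MM) _ (fun i => inl (coset_tuple i))); apply: Def_and.
      apply: (@Def_eq _ (eqstr MM) _ zs (inr E)); last coord.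
      exact: (@TFun_app _ (eqstr MM) _ zs (inr E) (fun i e => e (inr i))
        (fun i => TFun_var (vs := zs) (inr i))).
    pose F x := match x return (forall v, eqstr MM (zs v)) ->
        MM (vjoin coset_tuple (tp_ctx (X := home_part Gamma)) x) with
      | inl i => fun e => e (inr i) | inr y => fun e => e (inl (inr y)) end.
    have hF x : @TFun _ (eqstr MM) _ zs
        (inl (vjoin coset_tuple (tp_ctx (X := home_part Gamma)) x)) (F x).
      by case: x => [i|y]; [coord
        |coord].
    apply: Def_ext (Def_home hQ hF) _ => e.
    rewrite (_ : (fun x => F x e) = ejoin (N := MM) (vs := coset_tuple) (fun i => e (inr i))
      (fun y => e (inl (inr y)))) //.
    by apply: fext => -[].
  have [q [hq qE]] := pform_home hR.
  exists q; split.
  - by move=> i; have [x hx <-] := hq i; exact: hx.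
  - by apply/qE; exists w; split=> //; apply/hQE.
  apply: sub_finite_set (finite_list (List.map coset_cls l)) => y /qE[z [/= <- /hQE cz]].
  apply: contrapT => hin; apply: hn; exists z; split=> // z' hz' /coset_cls_eq E'.
  by apply: hin; rewrite -E'; exact: List.in_map.
have [f hf] := choice step.
pose ss := fix ss n := if n is m.+1 then f (ss m) :: ss m else [::].
have hs i j : (i < j)%N -> List.In (f (ss i)) (ss j).
  elim: j => // j IH; rewrite ltnS leq_eqVlt => /predU1P[->|/IH h]; by [left|right].
exists (fun i => f (ss i)); split=> [i|i j ij]; first by have [] := hf (ss i).
by have [_ h] := hf (ss j); apply: h; exact: hs.
Qed.

End Cosets.

(** * Dividing cosets and amalgamation *)

Section Amalgamation.
Local Open Scope ring_scope.

Lemma TFun_addC V (vs : V -> lsort LC) (s : lsort L)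
    (f g : (forall v, CC (vs v)) -> ab_car C s) :
  @TFun _ CC _ vs (inl s) f -> @TFun _ CC _ vs (inl s) g ->
  @TFun _ CC _ vs (inl s) (fun e => f e + g e).
Proof.
move=> hf hg; apply: (@TFun_app _ CC _ vs (inl (gadd s)) (fun i : 'I_2 =>
  if i == ord0 then f else g)) => i.
by case: (i == ord0).
Qed.

Lemma TFun_oppC V (vs : V -> lsort LC) (s : lsort L) (f : (forall v, CC (vs v)) -> ab_car C s) :
  @TFun _ CC _ vs (inl s) f -> @TFun _ CC _ vs (inl s) (fun e => - f e).
Proof. by move=> hf; apply: (@TFun_app _ CC _ vs (inl (gopp s)) (fun=> f)). Qed.

Section CosetDivides.
Variable Gamma : set (elt (eqstr MM)).
Hypothesis satG : forall E : set (elt MM), countable E ->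
  forall s (P : set (pform MM (ctx1 s))), (forall p, P p -> params_in (home_part Gamma `|` E) p) ->
  consistent P -> exists y : MM s, forall p, P p -> psat p (fun=> y).

(* A coset outside [acl Gamma] has infinitely many conjugates, which are pairwise
   disjoint. *)
Lemma coset_divides (p : ppform L) (w : forall i, ab_car C (pp_s (p := p) i))
    V (vs : V -> lsort LC) (T : forall i, (forall v, CC (vs v)) -> ab_car C (pp_s (p := p) i)) :
  ~ acl Gamma (coset iota nu As Cs w) ->
  (forall i, @TFun _ CC _ vs (inl (@pp_s L p i)) (T i)) ->
  exists q : pform CC vs, (forall x, psat q x <-> @ppsat L C p (fun i => T i x + w i)) /\
    divides (setC (home_part Gamma)) q.
Proof.
move=> hw hT.
pose ps (i : 'I_(pp_n p)) : lsort LC := inl (@pp_s L p i).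
have [fm hfm] : Def (N := CC) (vs := vjoin vs ps) (fun e =>
    @ppsat L C p (fun i => T i (fun v => e (inl v)) + e (inr i))).
  apply: Def_ppC => i; apply: TFun_addC; last coord.
  exact: TFun_subst (hT i) (fun v => TFun_var (vs := vjoin vs ps) (inl v)).
exists (PForm (N := CC) (pf_s := ps) fm w); split=> [x|]; first exact: (hfm (@ejoin _ CC _ _ vs ps x w)).
pose ct := coset_tuple (p := p).
pose K (z : forall x : 'I_2 * 'I_(pp_n p), MM (ct x.2)) :=
  ~ @ppmod L C p (fun i => z (ord0, i)) (fun i => z (ord_max, i)).
have hK : DefG (home_part Gamma) (vs := @row_ctx _ _ ct _) K.
  apply: DefG_Def; apply: Def_not; pose zs (x : 'I_2 * 'I_(pp_n p)) : lsort LC := ps x.2.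
  have hQ : Def (N := CC) (vs := zs) (fun z =>
      @ppmod L C p (fun i => z (ord0, i)) (fun i => z (ord_max, i))).
    apply: Def_ppC => i; apply: TFun_addC; first coord.
    exact: TFun_oppC (TFun_var (vs := zs) (ord0, i)).
  exact: (Def_C (vs := @row_ctx _ _ ct _) hQ
    (fun x => TFun_var (N := MM) (vs := @row_ctx _ _ ct _) x)).
have [|b [b0 bI bK]] := indiscernible_through satG (c := w : forall i, MM (ct i)) hK.
  move=> chi hchi cw; have [s [hs sd]] := coset_conjugates hw hchi cw.
  by exists s; split=> // a ha; exact: (sd _ _ (ha ord0 ord_max isT)).
exists b; split=> //.
  exact: (@indiscernible_setC (home_part Gamma) _ ct b _ ps
    (fun j e => e j) bI (fun j => TFunG_TFun _ (TFun_var (N := MM) (vs := ct) j))).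
move=> hC.
have [x hx] := hC 2 (fun k => PForm (N := CC) (pf_s := ps) fm (b k)) (fun k => ex_intro _ (k : nat) erefl).
have h0 := (hfm (@ejoin _ CC _ _ vs ps x (b 0%N))).1 (hx ord0).
have h1 := (hfm (@ejoin _ CC _ _ vs ps x (b 1%N))).1 (hx ord_max).
apply: (bK (fun i => i : nat)) => //.
have := ab_ppB h1 h0; rewrite /ppmod; congr ppsat; apply: fext => i.
by rewrite opprD addrACA subrr add0r.
Qed.

End CosetDivides.

Variable X : set (elt MM).

Definition to_env (xA : forall v : {x | setA X x}, AA (tp_ctx v))
    (xB : forall v : {x | setB X x}, BB (tp_ctx v))
    (xC : forall v : {x | setC X x}, CC (tp_ctx v)) (y : {y | X y}) : MM (tp_ctx y) :=
  match y return MM (tp_ctx y) with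
  | exist (existT s a) h =>
    match s return forall a : MM s, X (existT (car MM) s a) -> MM s with
    | MA s => fun a h => xA (exist (fun x => setA X x) (existT (car AA) s a) h)
    | MB s => fun a h => xB (exist (fun x => setB X x) (existT (car BB) s a) h)
    | MC s => fun a h => xC (exist (fun x => setC X x) (existT (car CC) s a) h)
    end a h
  end.

Notation XE := (forall y : {y | X y}, MM (tp_ctx y)).

Definition prA (x : XE) (v : {x | setA X x}) : AA (tp_ctx v) :=
  x (exist (fun y => X y) (inA (sval v)) (proj2_sig v)).
Definition prB (x : XE) (v : {x | setB X x}) : ab_car B (tp_ctx v) :=
  x (exist (fun y => X y) (inB (sval v)) (proj2_sig v)).
Definition prC (x : XE) (v : {x | setC X x}) : CC (tp_ctx v) :=
  x (exist (fun y => X y) (inC (sval v)) (proj2_sig v)).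

Lemma prA_to_env xA xB xC : prA (to_env xA xB xC) = xA.
Proof. by apply: fext => -[[s a] h]. Qed.

Lemma prC_to_env xA xB xC : prC (to_env xA xB xC) = xC.
Proof. by apply: fext => -[[s a] h]. Qed.

Lemma to_env_pr (x : XE) : to_env (prA x) (prB x) (prC x) = x.
Proof. by apply: fext => -[[[s|s|s] a] h]. Qed.

Lemma prA_hval : prA (hval (H := X)) = hval (H := setA X).
Proof. by apply: fext => -[[s a] h]. Qed.

Lemma prC_hval : prC (hval (H := X)) = hval (H := setC X).
Proof. by apply: fext => -[[s a] h]. Qed.

Variable D : set (elt MM).
Hypothesis closedD : forall x, generated D x -> D x.

(* The sorts of [As] and of [Cs] are orthogonal: types of their elements over [D]
   amalgamate freely. *)
Lemma amalgamation (Th : XE -> Prop) : DefG D Th ->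
  exists (T : finType) (a : T -> formula (vjoin (tp_ctx (X := setA X)) (tp_ctx (X := setA D))))
    (c : T -> formula (vjoin (tp_ctx (X := setC X)) (tp_ctx (X := setC D)))),
  forall xA xC, (exists xB, Th (to_env xA xB xC)) <->
    exists t, sat (a t) (ejoin xA (hval (H := setA D))) /\
              sat (c t) (ejoin xC (hval (H := setC D))).
Proof.
move=> hTh.
pose vs := vjoin (fun v : {x | setA X x} => sortA (tp_ctx v))
  (fun v : {x | setC X x} => sortC (tp_ctx v)).
pose bs (v : {x | setB X x}) : lsort ML := sortB (tp_ctx v).
(* Once the B-coordinates are quantified out, the free variables lie in A* and C*, and the induced
   structure applies. *)
have [Q [hQ QE]] : DefG D (vs := vs) (fun e => exists xB : forall v, MM (bs v),
    Th (to_env (fun v => e (inl v)) xB (fun v => e (inr v)))).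
  apply: (@DefG_exinf _ MM D _ vs _ bs (hval (H := setB X))).
  apply: (@DefG_reindex _ MM D _ (tp_ctx (X := X)) Th _ (vjoin vs bs) (fun y e =>
    to_env (fun v => e (inl (inl v))) (fun v => e (inr v)) (fun v => e (inl (inr v))) y) hTh)
    => -[[[s|s|s] a] h].
  - exact: (TFun_var (N := MM) (vs := vjoin vs bs)
      (inl (inl (exist (fun x => setA X x) (existT (car AA) s a) h)))).
  - exact: (TFun_var (N := MM) (vs := vjoin vs bs)
      (inr (exist (fun x => setB X x) (existT (car BB) s a) h))).
  - exact: (TFun_var (N := MM) (vs := vjoin vs bs)
      (inl (inr (exist (fun x => setC X x) (existT (car CC) s a) h)))).
have [T [a [c hT]]] := induced_structure closedD hQ.
exists T, a, c => xA xC; rewrite -hT -QE.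
by split=> -[xB h]; exists xB.
Qed.

End Amalgamation.

(** * Common solutions along indiscernible sequences *)

Section Blocks.
Local Open Scope ring_scope.

Section TFunGM.
Variables (G : set (elt MM)) (V : Type) (vs : V -> lsort ML).
Local Notation TG s := (@TFunG _ MM G _ vs s).

Lemma TFunG_addB (s : lsort L) (f g : (forall v, MM (vs v)) -> ab_car B s) :
  TG (sortB s) f -> TG (sortB s) g -> TG (sortB s) (fun e => f e + g e).
Proof.
move=> hf hg; apply: (@TFunG_app _ MM G _ vs (MfB _ _ _ (gadd s)) (fun i : 'I_2 =>
  if i == ord0 then f else g)) => i.
by case: (i == ord0).
Qed.

Lemma TFunG_oppB (s : lsort L) (f : (forall v, MM (vs v)) -> ab_car B s) :
  TG (sortB s) f -> TG (sortB s) (fun e => - f e).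
Proof. by move=> hf; apply: (@TFunG_app _ MM G _ vs (MfB _ _ _ (gopp s)) (fun=> f)). Qed.

Lemma TFunG_rho (p : idx Phi) (F : forall i, (forall v, MM (vs v)) -> ab_car B (pp_s (p := sval p) i)) :
  (forall i, TG (sortB (@pp_s L (sval p) i)) (F i)) ->
  TG (sortA (inl (inr p))) (fun e => rho iota (fun i => F i e)).
Proof. by move=> hf; apply: (@TFunG_app _ MM G _ vs (Mrho _ _ _ p) F). Qed.

Lemma DefG_in_dom (p : ppform L) (F : forall i, (forall v, MM (vs v)) -> ab_car B (pp_s (p := p) i)) :
  (forall i, TG (sortB (@pp_s L p i)) (F i)) ->
  DefG G (vs := vs) (fun e => in_dom (fun i => F i e)).
Proof.
move=> hF; pose us (i : 'I_(pp_n p)) : lsort ML := sortB (@pp_s L p i).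
have hQ : Def (N := MM) (vs := us) (fun z => in_dom z).
  apply: Def_ppM => i; apply: TFun_nu; coord.
exact: (@DefG_subst _ MM G _ us _ _ vs _ (DefG_Def G hQ) hF).
Qed.

End TFunGM.

Variable Gamma : set (elt (eqstr MM)).
Local Notation G := (home_part Gamma).
Hypothesis closedG : forall x, generated G x -> G x.
Hypothesis satG : forall E : set (elt MM), countable E ->
  forall s (P : set (pform MM (ctx1 s))), (forall p, P p -> params_in (G `|` E) p) ->
  consistent P -> exists y : MM s, forall p, P p -> psat p (fun=> y).
Hypothesis acl_coset : forall phi, Phi phi -> forall c : (forall i, ab_car C (pp_s (p := phi) i)),
  acl Gamma (coset iota nu As Cs c) -> Gamma (coset iota nu As Cs c).
Hypothesis lift_coset : forall phi, Phi phi -> forall c : (forall i, ab_car C (pp_s (p := phi) i)),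
  Gamma (coset iota nu As Cs c) -> exists beta : forall i, ab_car B (pp_s (p := phi) i),
    (forall i, setB G (@Elt _ BB _ (beta i))) /\ ppmod c (fun i => nu (beta i)).

Variable X : set (elt MM).
Hypothesis closedX : forall x, generated X x -> X x.
Hypothesis GX : G `<=` X.

Variables (r : nat) (ts : 'I_r -> lsort ML) (c0 : forall t, MM (ts t)).
Notation XE := (forall y : {y | X y}, MM (tp_ctx y)).
Notation CT := (forall t, MM (ts t)).

Definition solvable (Psi : XE -> CT -> Prop) := forall b : nat -> CT, indG G b -> b 0%N = c0 ->
  forall m, exists x, forall i, (i < m)%N -> Psi x (b i).

(* [Psi x c0] does not divide unless [x] satisfies a dividing formula among the [qA]
   and the [qC]. Unlike non-dividing, this is stable under finite disjunctions. *)
Definition block (Psi : XE -> CT -> Prop) :=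
  exists (IA IC : finType) (qA : IA -> pform AA (tp_ctx (X := setA X)))
    (qC : IC -> pform CC (tp_ctx (X := setC X))) (th : XE -> Prop),
  [/\ DefG G th, th (hval (H := X)) & forall x, th x -> Psi x c0 ->
    (forall i, psat (qA i) (prA x) -> ~ divides (setA G) (qA i)) ->
    (forall i, psat (qC i) (prC x) -> ~ divides (setC G) (qC i)) -> solvable Psi].

Lemma block_ext Psi Psi' : block Psi -> (forall x c, Psi x c <-> Psi' x c) -> block Psi'.
Proof.
move=> [IA [IC [qA [qC [th [dth hth h]]]]]] E.
exists IA, IC, qA, qC, th; split=> // x tx /E px hA hC b bI b0 m.
have [x' hx'] := h x tx px hA hC b bI b0 m.
by exists x' => i im; apply/E/hx'.
Qed.

(** All lists are joined. At a given realisation, the disjunct that holds already has common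
    solutions, and these solve the disjunction. *)
Lemma block_some (T : finType) (Psi : T -> XE -> CT -> Prop) :
  (forall t, block (Psi t)) -> block (fun x c => exists t, Psi t x c).
Proof.
move=> /choice[IA] /choice[IC] /dchoice[qA] /dchoice[qC] /choice[th h].
exists {t : T & IA t}, {t : T & IC t}, (fun x => qA (projT1 x) (projT2 x)),
  (fun x => qC (projT1 x) (projT2 x)), (fun x => forall t, th t x); split.
- by apply: DefG_all => t; have [] := h t.
- by move=> t; have [] := h t.
move=> x tx [t px] hA hC; have [_ _ /(_ x (tx t) px)] := h t.
move=> /(_ (fun i => hA (existT _ t i)) (fun i => hC (existT _ t i))) s b bI b0 m.
by have [x' hx'] := s b bI b0 m; exists x' => i im; exists t; exact: hx'.
Qed.

(** The coordinates of the parameter tuple are sorted by kind. The equation is kept as data, because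
    [ts] is an arbitrary map into the sorts; values are transported along it. *)
Definition iA := {t : 'I_r & {s | ts t = sortA s}}.
Definition iB := {t : 'I_r & {s | ts t = sortB s}}.
Definition iC := {t : 'I_r & {s | ts t = sortC s}}.
Definition aS (u : iA) : lsort LA := sval (projT2 u).
Definition bS (u : iB) : lsort L := sval (projT2 u).
Definition cS (u : iC) : lsort LC := sval (projT2 u).

Definition partA (c : CT) (u : iA) : AA (aS u) :=
  eq_rect (ts (projT1 u)) (car MM) (c (projT1 u)) (sortA (aS u)) (proj2_sig (projT2 u)).
Definition partB (c : CT) (u : iB) : ab_car B (bS u) :=
  eq_rect (ts (projT1 u)) (car MM) (c (projT1 u)) (sortB (bS u)) (proj2_sig (projT2 u)).
Definition partC (c : CT) (u : iC) : CC (cS u) :=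
  eq_rect (ts (projT1 u)) (car MM) (c (projT1 u)) (sortC (cS u)) (proj2_sig (projT2 u)).

Lemma TFun_partA u : @TFun _ MM _ ts (sortA (aS u)) (fun c => partA c u).
Proof. exact: TFun_cast. Qed.
Lemma TFun_partB u : @TFun _ MM _ ts (sortB (bS u)) (fun c => partB c u).
Proof. exact: TFun_cast. Qed.
Lemma TFun_partC u : @TFun _ MM _ ts (sortC (cS u)) (fun c => partC c u).
Proof. exact: TFun_cast. Qed.

Definition bctx : sctx := @SCtx _ (vjoin (tp_ctx (X := setA X)) aS)
  _ (vjoin (tp_ctx (X := setB X)) bS) _ (vjoin (tp_ctx (X := setC X)) cS).

Definition xB_join (x : XE) (c : CT) : forall v, ab_car B (vjoin (tp_ctx (X := setB X)) bS v) :=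
  @ejoin _ BB _ _ (tp_ctx (X := setB X)) bS (prB x) (partB c).

Definition benv (x : XE) (c : CT) : senv bctx :=
  @SEnv bctx (ejoin (prA x) (partA c)) (xB_join x c) (ejoin (prC x) (partC c)).

Lemma rep_bctx y : exists f : senv bctx -> MM (vjoin (tp_ctx (X := X)) ts y),
  rep f /\ forall x c, f (benv x c) = ejoin x c y.
Proof.
case: y => [[[[s|s|s] a] h]|t].
- pose v : cA bctx := inl (exist (fun x => setA X x) (existT _ s a) h).
  by exists (fun e => eA e v); split=> //; exists (tvar (actx (K := bctx)) (inl v)).
- pose v : cB bctx := inl (exist (fun x => setB X x) (existT _ s a) h).
  by exists (fun e => eB e v); split=> //; exists (@tvar (ablang L) _ (@sB bctx) v).
- pose v : cC bctx := inl (exist (fun x => setC X x) (existT _ s a) h).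
  by exists (fun e => eC e v); split=> //; exists (tvar (cctx (K := bctx)) (inl v)).
have H s (h : ts t = s) : exists f : senv bctx -> MM s, rep f /\
    forall x c, f (benv x c) = eq_rect (ts t) (car MM) (c t) s h.
  case: s h => s h.
  - pose v : cA bctx := inr (existT (fun t => {s | ts t = sortA s}) t (exist _ s h)).
    by exists (fun e => eA e v); split=> //; exists (tvar (actx (K := bctx)) (inl v)).
  - pose v : cB bctx := inr (existT (fun t => {s | ts t = sortB s}) t (exist _ s h)).
    by exists (fun e => eB e v); split=> //; exists (@tvar (ablang L) _ (@sB bctx) v).
  - pose v : cC bctx := inr (existT (fun t => {s | ts t = sortC s}) t (exist _ s h)).
    by exists (fun e => eC e v); split=> //; exists (tvar (cctx (K := bctx)) (inl v)).
exact: H (ts t) erefl.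
Qed.

Lemma nu_var_in (v : {v | setB X v}) :
  setC X (@Elt _ CC (inl (tp_ctx v)) (nu (hval v : ab_car B (tp_ctx v)))).
Proof.
case: v => -[s b] h; apply: closedX.
exact (@gen_fun _ MM X (@Mnu L Phi _ _ _ s) (fun=> b) (fun=> @gen_base _ MM X (inB (existT _ s b)) h)).
Qed.

Definition nu_var (v : {v | setB X v}) : {v | setC X v} := exist _ _ (nu_var_in v).
Definition nu_xsort (v : {v | setB X v}) : lsort LC := inl (tp_ctx v).
(** [nu] of a B-variable can be computed from the B-part of [x], or, as in [nu_z], read off the
    C-variable that names the element [nu v] of the substructure. Only the second is a function of
    the C-part. *)
Definition nu_x (x : XE) (v : {v | setB X v}) : CC (nu_xsort v) := nu (prB x v).
Definition nu_z (xC : forall v : {v | setC X v}, CC (tp_ctx v)) (v : {v | setB X v}) :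
  CC (nu_xsort v) := xC (nu_var v).

(* A formula only uses finitely many of the equations [nu_x x = nu_z (prC x)]. *)
Lemma nu_support V (vs : V -> lsort LC) (Q : (forall v, CC (vjoin vs nu_xsort v)) -> Prop) :
  Def Q -> exists th : XE -> Prop, [/\ DefG G th, th (hval (H := X)) &
    forall x, th x -> forall e, Q (ejoin e (nu_x x)) <-> Q (ejoin e (nu_z (prC x)))].
Proof.
move=> /Def_support[m [g [q hq]]].
exists (fun x => forall k : 'I_m, nu_x x (g k) = nu_z (prC x) (g k)); split.
- apply: DefG_Def; apply: Def_all => k; apply: (@Def_eq _ MM _ _ (sortC (nu_xsort (g k)))).
    apply: TFun_nu; exact: (TFun_var (N := MM) (vs := tp_ctx (X := X))
      (exist (fun y => X y) (inB (sval (g k))) (proj2_sig (g k)))).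
  exact: (TFun_var (N := MM) (vs := tp_ctx (X := X))
    (exist (fun y => X y) (inC (sval (nu_var (g k)))) (proj2_sig (nu_var (g k))))).
- by move=> k; rewrite /nu_x /nu_z /nu_var /prB /prC /hval /=; case: (g k) => -[s b] h.
move=> x hx e; rewrite -!hq.
by rewrite (_ : (fun i => nu_x x (g i)) = fun i => nu_z (prC x) (g i)) //; apply: fext.
Qed.

Section Pair.
Variables (n : nat) (f : 'I_n -> rterm bctx).
Variables (alpha : formula (vjoin (@sA bctx) (fun l => rsort (f l)))).
Variables (gamma : formula (cctx (K := bctx))) (J : 'I_n -> bool).

Let phi l : idx Phi := projT1 (f l).
Let sphi l : ppform L := sval (phi l).
Let t l i : @term (ablang L) _ (vjoin (tp_ctx (X := setB X)) bS) (pp_s (p := sphi l) i) :=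
  projT2 (f l) i.
Let tX l (i : 'I_(pp_n (sphi l))) : @term (ablang L) _ (tp_ctx (X := setB X)) (pp_s i) :=
  tsub (fun x => match x return @term (ablang L) _ (tp_ctx (X := setB X))
                   (vjoin (tp_ctx (X := setB X)) bS x) with
    | inl v => @tvar (ablang L) _ (tp_ctx (X := setB X)) v
    | inr u => @zterm L _ (tp_ctx (X := setB X)) (bS u) end) (t i).
Let tC l (i : 'I_(pp_n (sphi l))) : @term (ablang L) _ bS (pp_s i) :=
  tsub (fun x => match x return @term (ablang L) _ bS
                   (vjoin (tp_ctx (X := setB X)) bS x) with
    | inl v => @zterm L _ bS (tp_ctx v)
    | inr u => @tvar (ablang L) _ bS u end) (t i).

Lemma eval_t (Y : abelian L) l (i : 'I_(pp_n (sphi l)))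
    (e : forall v : {v | setB X v}, ab_car Y (tp_ctx v)) (d : forall u, ab_car Y (bS u)) :
  @eval _ (abstr Y) _ _ _ (t i) (@ejoin _ (abstr Y) _ _ (tp_ctx (X := setB X)) bS e d) =
  @eval _ (abstr Y) _ _ _ (tX i) e + @eval _ (abstr Y) _ _ _ (tC i) d :> ab_car Y _.
Proof.
rewrite /tX /tC !(@eval_tsub _ (abstr Y)) -ab_evalD.
by congr (@eval _ (abstr Y) _ _ _ (t i) _); apply: fext => -[v|u] /=; rewrite ?addr0 ?add0r.
Qed.

Let tval x c l (i : 'I_(pp_n (sphi l))) : ab_car B (pp_s i) := evB (t i) (xB_join x c).
Let dom x c l := in_dom (@tval x c l).

Definition pair_formula (x : XE) (c : CT) :=
  [/\ sat (N := AA) alpha (ejoin (ejoin (prA x) (partA c)) (fun l => rval (benv x c) (f l))),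
      sat (N := CC) gamma (EC (benv x c)) & forall l, J l <-> dom x c l].

Definition wC (c : CT) l (i : 'I_(pp_n (sphi l))) : ab_car C (pp_s i) :=
  evC (tC i) (fun u => nu (partB c u)).

Definition dom_C (z : forall v, CC (nu_xsort v)) (c : CT) l := @ppsat L C (sphi l)
  (fun i => evC (tX i) z + wC c i).

Lemma domE x c l : dom x c l <-> dom_C (nu_x x) c l.
Proof.
rewrite /dom /in_dom /dom_C; suff -> : (fun i => nu (@tval x c l i)) =
  (fun i => evC (tX i) (nu_x x) + wC c i) by [].
apply: fext => i; rewrite /tval nu_eval -eval_t.
by congr (evC (t i) _); apply: fext => -[].
Qed.

(** The block is vacuous: [pair_formula] implies the only formula listed, which divides. The
    condition [th] serves to pass from [nu_x] to [nu_z], since the listed formula must be about C*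
    alone. *)
Lemma block_bad l : J l -> ~ Gamma (coset iota nu As Cs (@wC c0 l)) -> block pair_formula.
Proof.
move=> Jl hl.
have na : ~ acl Gamma (coset iota nu As Cs (@wC c0 l)).
  by move=> /acl_coset h; apply/hl/h; exact: svalP (phi l).
pose ps (i : 'I_(pp_n (sphi l))) : lsort LC := inl (@pp_s L (sphi l) i).
have hT i : @TFun _ CC _ (tp_ctx (X := setC X)) (ps i) (fun xC => evC (tX i) (nu_z xC)).
  apply: TFun_evalC => v; coord.
have [q [qE dq]] := coset_divides satG na hT.
pose ws := vjoin ps nu_xsort.
have hQ : Def (N := CC) (vs := ws) (fun e => @ppsat L C (sphi l)
    (fun i => evC (tX i) (fun v => e (inr v)) + e (inl i))).
  apply: Def_ppC => i; apply: TFun_addC; last coord.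
  by apply: TFun_evalC => v; coord.
have [th [dth hth hE]] := nu_support hQ.
exists void, unit, (fun v : void => match v with end), (fun=> q), th; split=> // x tx [_ _ hJ] _ hC.
case: (hC tt) => //; apply/qE.
apply: (hE x tx (@wC c0 l : forall i, CC (ps i))).1.
exact: (domE x c0 l).1 ((hJ l).1 Jl).
Qed.

Section Good.
Hypothesis hJ : forall l, J l -> Gamma (coset iota nu As Cs (@wC c0 l)).

Lemma beta_exists l : exists beta : forall i, ab_car B (pp_s (p := sphi l) i),
  (forall i, setB G (@Elt _ BB _ (beta i))) /\
  (J l -> @ppmod L C (sphi l) (@wC c0 l) (fun i => nu (beta i))).
Proof.
case: (boolP (J l)) => [/hJ/(lift_coset (svalP (phi l)))[beta [h1 h2]]|_]; first by exists beta.
(* Indices outside [J] get 0, which lies in [G] as the value of a closed term. *)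
exists (fun=> 0); split=> // i; apply: closedG.
exact: (@generated_evalB G _ (fun v : void => match v with end)
  (fun v : void => match v with end) _ (zterm _ (pp_s i)) (fun v : void => match v with end)).
Qed.

Let beta l := projT1 (cid (beta_exists l)).
Let betaG l i : setB G (@Elt _ BB _ (@beta l i)).
Proof. by rewrite /beta; case: cid => b [/= h _]; exact: h. Qed.
Let betaJ l : J l -> @ppmod L C (sphi l) (@wC c0 l) (fun i => nu (@beta l i)).
Proof. by rewrite /beta; case: cid => b [/= _ h]. Qed.

Let xval (xB : forall v : {v | setB X v}, ab_car B (tp_ctx v)) l (i : 'I_(pp_n (sphi l))) :
  ab_car B (pp_s i) := evB (tX i) xB + @beta l i.
Let cval (c : CT) l (i : 'I_(pp_n (sphi l))) : ab_car B (pp_s i) :=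
  evB (tC i) (partB c) - @beta l i.

Lemma tval_split x c l : @tval x c l = fun i => xval (prB x) i + @cval c l i.
Proof. by apply: fext => i; rewrite /tval eval_t /xval /cval addrACA subrr addr0. Qed.

Lemma TFunG_cval l (i : 'I_(pp_n (sphi l))) :
  @TFunG _ MM G _ ts (sortB (@pp_s L (sphi l) i)) (fun c => cval c i).
Proof.
apply: TFunG_addB; last first.
  apply: TFunG_oppB.
  exact: (@TFunG_param _ MM G _ ts (sortB (@pp_s L (sphi l) i)) (@beta l i) (betaG i)).
by apply: TFunG_TFun; apply: TFun_B => u; exact: TFun_partB.
Qed.

Lemma TFunG_xval l (i : 'I_(pp_n (sphi l))) :
  @TFunG _ MM G _ (tp_ctx (X := X)) (sortB (@pp_s L (sphi l) i)) (fun x => xval (prB x) i).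
Proof.
apply: TFunG_addB; last exact: (@TFunG_param _ MM G _ (tp_ctx (X := X))
  (sortB (@pp_s L (sphi l) i)) (@beta l i) (betaG i)).
apply: TFunG_TFun; apply: TFun_B => v; coord.
Qed.

Let rho_sort l : lsort LA := inl (inr (phi l)).

(** The value of [rho] on the shifted part of the term coming from U. It is an element of U, hence
    names a coordinate [rho_var l] of the A-part; [th1] asks other realisations to respect this. *)
Definition rho_id l : AA (rho_sort l) := rho iota (fun i => @xval (hval (H := setB X)) l i).

Lemma rho_id_in l : setA X (@Elt _ AA (rho_sort l) (rho_id l)).
Proof.
apply: closedX; apply: (@gen_fun _ MM X (Mrho _ _ _ (phi l))
  (fun i => @xval (hval (H := setB X)) l i)) => i.
have hE : generated X (inB (@Elt _ BB _ (evB (tX i) (hval (H := setB X))))).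
  by apply: generated_evalB => -[[s b] h]; exact: gen_base.
have hb : generated X (inB (@Elt _ BB _ (@beta l i))).
  by apply: gen_base; apply: GX; exact: betaG.
have := @gen_fun _ MM X (MfB _ _ _ (gadd (@pp_s L (sphi l) i))) (fun k : 'I_2 =>
  if k == ord0 then evB (tX i) (hval (H := setB X)) : ab_car B _ else @beta l i).
by apply=> k; case: (k == ord0).
Qed.

Definition rho_var l : {v | setA X v} := exist _ _ (rho_id_in l).

Let th1 x := forall l, rho iota (fun i => xval (prB x) i) = prA x (rho_var l) :> AA (rho_sort l).

Lemma th1_DefG : DefG G th1.
Proof.
apply: DefG_all => l; apply: (@DefG_eq _ MM G _ _ (sortA (rho_sort l))).
  by apply: TFunG_rho => i; exact: TFunG_xval.
apply: TFunG_TFun; exact: (TFun_var (N := MM) (vs := tp_ctx (X := X))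
    (exist (fun y => X y) (inA (sval (rho_var l))) (proj2_sig (rho_var l)))).
Qed.

Lemma th1_hval : th1 (hval (H := X)).
Proof. by move=> l; rewrite {2}/hval /prA /= /rho_id; congr rho. Qed.

Let wctxC := vjoin cS (fun u : iB => inl (bS u) : lsort LC).
Definition dataC (c : CT) : forall v, CC (wctxC v) :=
  @ejoin _ CC _ _ cS (fun u : iB => inl (bS u)) (partC c) (fun u => nu (partB c u)).

Let ctxC0 := vjoin (vjoin (tp_ctx (X := setC X)) wctxC) nu_xsort.

Definition joinC (z : forall v, CC (ctxC0 v)) (y : cB bctx + cC bctx) :
    CC (match y with inl v => inl (@sB bctx v) | inr v => @sC bctx v end) :=
  match y return CC (match y with inl v => inl (@sB bctx v)
                     | inr v => @sC bctx v end) with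
  | inl (inl v) => z (inr v) | inl (inr u) => z (inl (inr (inr u)))
  | inr (inl v) => z (inl (inl v)) | inr (inr u) => z (inl (inr (inl u))) end.

Lemma TFun_joinC y : TFun (N := CC) (vs := ctxC0) (fun z => joinC z y).
Proof.
by case: y => [[v|u]|[v|u]] /=; coord.
Qed.

(** The values of [nu] at B-variables of U form a separate block of variables: filled with [nu_x x]
    it gives the condition in the sequence, filled with [nu_z] it gives a formula on C-coordinates
    alone. *)
Definition QC0 (z : forall v, CC (ctxC0 v)) :=
  sat (N := CC) gamma (fun y => match y return CC (cctx (K := bctx) y) with
    | inl v => joinC z (inr v) | inr v => joinC z (inl v) end) /\
  forall l, J l <-> @ppsat L C (sphi l) (fun i => evC (t i) (fun v => joinC z (inl v))).

Lemma Def_QC0 : Def QC0.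
Proof.
apply: Def_and.
  apply: (Def_subst (F := fun y z => match y return CC (cctx (K := bctx) y) with
    | inl v => joinC z (inr v) | inr v => joinC z (inl v) end) (Def_sat CC gamma)) => -[v|v].
    exact: (TFun_joinC (inr v)).
  exact: (TFun_joinC (inl v)).
apply: Def_all => l; apply: Def_iff; first exact: Def_const.
by apply: Def_ppC => i; apply: TFun_evalC => v; exact: (TFun_joinC (inl v)).
Qed.

Lemma QC0E x c : QC0 (ejoin (ejoin (prC x) (dataC c)) (nu_x x)) <->
  sat (N := CC) gamma (EC (benv x c)) /\ forall l, J l <-> dom x c l.
Proof.
rewrite /QC0; set z := ejoin _ _.
have -> : (fun y => match y return CC (cctx (K := bctx) y) with
    | inl v => joinC z (inr v) | inr v => joinC z (inl v) end) = EC (benv x c).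
  by apply: fext => -[[v|u]|[v|u]].
have E l : (fun i => evC (t i) (fun v => joinC z (inl v))) = (fun i => nu (@tval x c l i)).
  apply: fext => i; rewrite /tval nu_eval; congr (evC (t i) _).
  by apply: fext => -[v|u].
by split=> -[h1 h2]; split=> // l; rewrite h2 ?E // /dom /in_dom E.
Qed.

Let wctxA := vjoin aS rho_sort.
Definition dataA (c : CT) : forall v, AA (wctxA v) :=
  @ejoin _ AA _ _ aS rho_sort (partA c) (fun l => rho iota (@cval c l)).

Let repsort (y : coset_index sphi) : lsort LA := inl (inl (@coset_index_sort L n sphi y)).
Notation RT := (forall y : coset_index sphi, ab_car A (@coset_index_sort L n sphi y)).

(** Addition on A/phi(A) is not a symbol supplied with the quotient sorts. The sum of the class
    coming from U and the class coming from [c] is therefore taken on representatives [w] and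
    [w']. *)
Definition QA0 (z : forall v, AA (vjoin (tp_ctx (X := setA X)) wctxA v)) :=
  exists w : RT, exists w' : RT,
  (forall l, J l -> z (inl (rho_var l)) = cls (@ppmod L A (sphi l)) (fun i => w (existT _ l i)) /\
    z (inr (inr l)) = cls (@ppmod L A (sphi l)) (fun i => w' (existT _ l i))) /\
  sat (N := AA) alpha (ejoin (ejoin (fun v => z (inl v)) (fun u => z (inr (inl u))))
    (fun l => cls (@ppmod L A (sphi l))
       (fun i => if J l then w (existT _ l i) + w' (existT _ l i) else 0) : AA (rsort (f l)))).

Lemma Def_QA0 : Def QA0.
Proof.
pose vs := vjoin (tp_ctx (X := setA X)) wctxA.
apply: (Def_exinf (N := AA) (ws := repsort) (fun y => 0 : ab_car A _)).
apply: (Def_exinf (N := AA) (ws := repsort) (fun y => 0 : ab_car A _)).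
pose ws := vjoin (vjoin vs repsort) repsort.
have h1 l i : @TFun _ AA _ ws (inl (inl (@pp_s L (sphi l) i)))
    (fun e => e (inl (inr (existT _ l i)))) by coord.
have h2 l i : @TFun _ AA _ ws (inl (inl (@pp_s L (sphi l) i))) (fun e => e (inr (existT _ l i))) by coord.
apply: Def_and.
  apply: Def_all => l; apply: Def_imp; first exact: Def_const.
  apply: Def_and; apply: (@Def_eq _ AA _ ws (inl (inr (phi l)))).
  - coord.
  - by apply: (@TFun_pi _ ws (phi l)) => i; exact: h1.
  - coord.
  - by apply: (@TFun_pi _ ws (phi l)) => i; exact: h2.
apply: (@Def_join _ AA _ (vjoin (tp_ctx (X := setA X)) aS) _ (fun l => rsort (f l)) _ ws _
  (fun y e => match y return AA (vjoin (tp_ctx (X := setA X)) aS y) with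
    | inl v => e (inl (inl (inl v))) | inr u => e (inl (inl (inr (inl u)))) end)
  (fun l e => cls (@ppmod L A (sphi l)) (fun i => if J l then
     (e (inl (inr (existT _ l i))) : ab_car A _) + e (inr (existT _ l i)) else 0) : AA (rsort (f l)))
  (Def_sat AA alpha)) => [[v|u]|l].
- coord.
- coord.
apply: (@TFun_pi _ ws (phi l) (fun i e => if J l then
     (e (inl (inr (existT _ l i))) : ab_car A _) + e (inr (existT _ l i)) else 0)) => i.
case: (J l).
  apply: (@TFun_app _ AA _ ws (inl (inl (gadd (@pp_s L (sphi l) i)))) (fun (k : 'I_2) e =>
    if k == ord0 then e (inl (inr (existT _ l i))) : ab_car A _ else e (inr (existT _ l i)))) => k.
  by case: (k == ord0); [exact: h1|exact: h2].
have [|u hu] := @TFun_evalA _ ws _ _ (fun v : void => match v with end)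
  _ (zterm (fun v : void => match v with end) (@pp_s L (sphi l) i)); first by case.
by exists u.
Qed.

Let condC (c : CT) := forall l, J l -> in_dom (@cval c l).

Lemma condC_c0 : condC c0.
Proof.
move=> l /betaJ h; have := ppN h; rewrite /in_dom; congr ppsat; apply: fext => i.
by rewrite opprB /cval nuD nuN nu_eval.
Qed.

Lemma condC_DefG : DefG G condC.
Proof.
apply: DefG_all => l; case: (J l); last first.
  by apply: DefG_ext (DefG_Def G (Def_const True)) _.
have h := @DefG_in_dom G _ ts (sphi l) _ (fun i => TFunG_cval i).
by apply: DefG_ext h _ => c; split=> [h' _|/(_ isT)].
Qed.

(** [condC] is a condition over [G] because the [beta] lie in [G]; the case of a single row of
    indiscernibility carries it from [c0] to all rows. *)
Lemma condC_seq b : indG G b -> b 0%N = c0 -> forall i, condC (b i).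
Proof.
move=> bI b0 i.
have hP : DefG G (vs := row_ctx ts (I := 'I_1)) (fun z => condC (fun t => z (ord0, t))).
  apply: (DefG_reindex (vs := row_ctx ts (I := 'I_1)) (F := fun t z => z (ord0, t)) condC_DefG).
  by move=> t'; coord.
have inc (a : 'I_1 -> nat) : incr a by move=> [[|]//] ? [[|]//].
apply: (bI 1%N _ hP (fun=> 0%N) (fun=> i) (inc _) (inc _)).1.
by rewrite /rows b0; exact: condC_c0.
Qed.

Lemma in_dom_xval x c l : in_dom (@cval c l) -> dom x c l ->
  in_dom (fun i => xval (prB x) i : ab_car B (pp_s (p := sphi l) i)).
Proof.
move=> hc; rewrite /dom tval_split => h; have := ab_ppB h hc; congr ppsat.
by apply: fext => i; rewrite nuD addrK.
Qed.

Lemma rho_rep l (y : forall i, ab_car B (pp_s (p := sphi l) i)) : in_dom y ->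
  exists a, rho iota y = cls (@ppmod L A (sphi l)) a.
Proof. by move=> h; have [a ha] := (in_domP _).1 h; exists a; apply/rho_eq. Qed.

Lemma QA0_intro x c : th1 x -> condC c -> pair_formula x c -> QA0 (ejoin (prA x) (dataA c)).
Proof.
move=> tx hc [ha _ hd].
have /dchoice[w hw] : forall l, exists w, J l ->
    rho iota (fun i => xval (prB x) i) = cls (@ppmod L A (sphi l)) w.
  move=> l; case: (boolP (J l)) => Jl; last by exists (fun=> 0).
  by have [a ha'] := rho_rep (in_dom_xval (hc l Jl) ((hd l).1 Jl)); exists a.
have /dchoice[w' hw'] : forall l, exists w', J l ->
    rho iota (@cval c l) = cls (@ppmod L A (sphi l)) w'.
  move=> l; case: (boolP (J l)) => Jl; last by exists (fun=> 0).
  by have [a ha'] := rho_rep (hc l Jl); exists a.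
exists (fun y => w (projT1 y) (projT2 y)), (fun y => w' (projT1 y) (projT2 y)).
split=> [l Jl|]; first by split; [rewrite /= -tx; exact: hw|exact: hw'].
move: ha; congr (sat (N := AA) _ _); congr ejoin; apply: fext => l.
rewrite /rval; case: (boolP (J l)) => Jl /=.
  have hx := in_dom_xval (hc l Jl) ((hd l).1 Jl).
  rewrite -(rho_add hx (hc l Jl) (hw l Jl) (hw' l Jl)); congr rho.
  exact: tval_split.
by apply: rho_outdom => h; move/negP: Jl; apply; apply/hd.
Qed.

Lemma QA0_elim x c : th1 x -> condC c -> (forall l, J l <-> dom x c l) ->
  QA0 (ejoin (prA x) (dataA c)) ->
  sat (N := AA) alpha (ejoin (ejoin (prA x) (partA c)) (fun l => rval (benv x c) (f l))).
Proof.
move=> tx hc hd [w [w' [hw]]]; congr (sat (N := AA) _ _); congr ejoin; apply: fext => l.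
rewrite /rval; case: (boolP (J l)) => Jl /=; last first.
  by symmetry; apply: rho_outdom => h; move/negP: Jl; apply; apply/hd.
have hx := in_dom_xval (hc l Jl) ((hd l).1 Jl).
have [e1 e2] := hw l Jl; rewrite /= -tx in e1.
rewrite -(rho_add hx (hc l Jl) e1 e2); congr rho.
by symmetry; exact: tval_split.
Qed.

Lemma block_good : block pair_formula.
Proof.
have [th2 [dth2 hth2 th2E]] := nu_support Def_QC0.
pose th x := th1 x /\ th2 x.
have dth : DefG G th by exact: DefG_and th1_DefG dth2.
have [T [al [ga hT]]] := amalgamation closedG dth.
pose wA := vjoin wctxA (tp_ctx (X := setA G)).
pose wC' := vjoin wctxC (tp_ctx (X := setC G)).
(* Each formula contains its side of the rectangle [u] of [th], so that solutions found separately
   in A* and in C* can be completed by a B-part to a realisation of [th]. *)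
pose QA u (z : forall v, AA (vjoin (tp_ctx (X := setA X)) wA v)) :=
  QA0 (ejoin (fun v => z (inl v)) (fun v => z (inr (inl v)))) /\
  sat (al u) (ejoin (fun v => z (inl v)) (fun v => z (inr (inr v)))).
pose QC u (z : forall v, CC (vjoin (tp_ctx (X := setC X)) wC' v)) :=
  QC0 (ejoin (ejoin (fun v => z (inl v)) (fun v => z (inr (inl v)))) (nu_z (fun v => z (inl v)))) /\
  sat (ga u) (ejoin (fun v => z (inl v)) (fun v => z (inr (inr v)))).
have dQA u : Def (QA u).
  pose zs := vjoin (tp_ctx (X := setA X)) wA.
  apply: Def_and.
    apply: (@Def_join _ AA _ (tp_ctx (X := setA X)) _ wctxA _ zs _ (fun v z => z (inl v))
      (fun v z => z (inr (inl v))) Def_QA0) => v; coord.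
  apply: (@Def_join _ AA _ (tp_ctx (X := setA X)) _ (tp_ctx (X := setA G)) _ zs _
    (fun v z => z (inl v)) (fun v z => z (inr (inr v))) (Def_sat AA (al u))) => v; coord.
have dQC u : Def (QC u).
  pose zs := vjoin (tp_ctx (X := setC X)) wC'.
  apply: Def_and.
    apply: (@Def_join _ CC _ (vjoin (tp_ctx (X := setC X)) wctxC) _ nu_xsort _ zs _
      (fun y z => match y return CC (vjoin (tp_ctx (X := setC X)) wctxC y) with
        | inl v => z (inl v) | inr v => z (inr (inl v)) end)
      (fun v z => z (inl (nu_var v))) Def_QC0) => [[v|v]|v]; coord.
  apply: (@Def_join _ CC _ (tp_ctx (X := setC X)) _ (tp_ctx (X := setC G)) _ zs _
    (fun v z => z (inl v)) (fun v z => z (inr (inr v))) (Def_sat CC (ga u))) => v; coord.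
pose dA (c : CT) := @ejoin _ AA _ _ wctxA (tp_ctx (X := setA G)) (dataA c) (hval (H := setA G)).
pose dC (c : CT) := @ejoin _ CC _ _ wctxC (tp_ctx (X := setC G)) (dataC c) (hval (H := setC G)).
have /dchoice[qA hqA] := fun u => pform_at (setA G) (dA c0) (dQA u).
have /dchoice[qC hqC] := fun u => pform_at (setC G) (dC c0) (dQC u).
exists T, T, qA, qC, th; split; first exact: dth.
  by split; [exact: th1_hval|exact: hth2].
move=> x tx px hA hC b bI b0 m.
have [t1x t2x] := tx; have [_ pg pd] := px.
have [u [hal hga]] : exists u, sat (al u) (ejoin (prA x) (hval (H := setA G))) /\
    sat (ga u) (ejoin (prC x) (hval (H := setC G))).
  by apply/hT; exists (prB x); rewrite to_env_pr.
have ndA : ~ divides (setA G) (qA u).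
  by apply: hA; apply/(hqA u).1; split=> //; exact: QA0_intro t1x condC_c0 px.
have ndC : ~ divides (setC G) (qC u).
  apply: hC; apply/(hqC u).1; split=> //.
  apply: (th2E x t2x (ejoin (prC x) (dataC c0))).1.
  by apply: (QC0E x c0).2.
have iA' k (g : 'I_k -> _) : indiscernible (setA G) (fun j i => dA (b j) (g i)).
  apply: (@indiscernible_setA G _ ts b _ (fun i => wA (g i))
    (fun i c => dA c (g i)) bI) => i.
  case: (g i) => [[v|l]|[[s a] h]] /=.
  - by apply: TFunG_TFun; exact: TFun_partA.
  - by apply: TFunG_rho => i'; exact: TFunG_cval.
  - exact: (@TFunG_param _ MM G _ ts (sortA s) a h).
have iC' k (g : 'I_k -> _) : indiscernible (setC G) (fun j i => dC (b j) (g i)).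
  apply: (@indiscernible_setC G _ ts b _ (fun i => wC' (g i))
    (fun i c => dC c (g i)) bI) => i.
  case: (g i) => [[v|v]|[[s a] h]] /=.
  - by apply: TFunG_TFun; exact: TFun_partC.
  - by apply: TFunG_TFun; apply: TFun_nu; exact: TFun_partB.
  - exact: (@TFunG_param _ MM G _ ts (sortC s) a h).
(* With [m.+1] instances there is at least one, from which the rectangle of [th] is read even when
   [m] is 0. *)
have [xA hxA] := (hqA u).2 ndA (fun j => dA (b j)) (f_equal dA b0) iA' m.+1.
have [xC hxC] := (hqC u).2 ndC (fun j => dC (b j)) (f_equal dC b0) iC' m.+1.
have [xB [t1' t2']] : exists xB, th (to_env xA xB xC).
  by apply/hT; exists u; have [_ ?] := hxA 0%N isT; have [_ ?] := hxC 0%N isT.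
exists (to_env xA xB xC) => i im; set x' := to_env xA xB xC.
have [hQC _] := hxC i (ltnW im); have [hQA _] := hxA i (ltnW im).
have [hg hd] : sat (N := CC) gamma (EC (benv x' (b i))) /\ forall l, J l <-> dom x' (b i) l.
  apply: (QC0E x' (b i)).1; apply: (th2E x' t2' (ejoin (prC x') (dataC (b i)))).2.
  by rewrite /x' prC_to_env.
split=> //; apply: QA0_elim => //; first exact: condC_seq.
by rewrite /x' prA_to_env.
Qed.

End Good.

Lemma block_pair : block pair_formula.
Proof.
case: (pselect (exists l, J l /\ ~ Gamma (coset iota nu As Cs (@wC c0 l)))).
  by move=> [l [Jl hl]]; exact: block_bad Jl hl.
move=> hn; apply: block_good => l Jl; apply: contrapT => hl.
by apply: hn; exists l.
Qed.

End Pair.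

(** Separation gives finitely many rectangles. Each is split further according to the set [J] of the
    occurring [rho_phi(t)] whose arguments lie in the domain. *)
Lemma block_formula (Q : (forall y, MM (vjoin (tp_ctx (X := X)) ts y)) -> Prop) :
  Def Q -> block (fun x c => Q (ejoin x c)).
Proof.
move=> [p hp]; have /dchoice[F hF] := rep_bctx.
have [T [al [ga hT]]] := SP_formula p (fun y => (hF y).1).
have H u : block (fun x c => sat (al u) (EA (benv x c)) /\ sat (ga u) (EC (benv x c))).
  have [n [f [al' hal]]] := Def_support (Def_sat AA (al u)).
  apply: block_ext (block_some (fun J : {ffun 'I_n -> bool} =>
    block_pair al' (ga u) J)) _ => x c.
  split=> [[J [h1 h2 _]]|[h1 h2]]; first by split=> //; apply/hal.
  exists [ffun l => `[< in_dom (fun i => evB (projT2 (f l) i) (xB_join x c)) >]].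
  split=> // [|l]; first by apply/hal.
  by rewrite ffunE; split=> /asboolP.
apply: block_ext (block_some H) _ => x c; rewrite -hp.
rewrite (_ : ejoin x c = fun y => F y (benv x c)) ?hT //.
by apply: fext => y; have [_ ->] := hF y.
Qed.

End Blocks.

(** * Non-forking in the sequence *)

Section Nonforking.
Variables (Gamma Delta : set (elt (eqstr MM))) (X : set (elt MM)).
Hypothesis GD : Gamma `<=` Delta.
Hypothesis dclG : Gamma = dcl Gamma.
Hypothesis dclD : Delta = dcl Delta.
Hypothesis homeD : Delta = dcl (@home _ MM @` home_part Delta).
Hypothesis satM : saturated_succ MM Delta.
Hypothesis acl_coset : forall phi, Phi phi -> forall c : (forall i, ab_car C (pp_s (p := phi) i)),
  acl Gamma (coset iota nu As Cs c) -> Gamma (coset iota nu As Cs c).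
Hypothesis lift_coset : forall phi, Phi phi -> forall c : (forall i, ab_car C (pp_s (p := phi) i)),
  Gamma (coset iota nu As Cs c) -> exists beta : forall i, ab_car B (pp_s (p := phi) i),
    (forall i, setB (home_part Gamma) (@Elt _ BB _ (beta i))) /\ ppmod c (fun i => nu (beta i)).
Hypothesis closedX : forall x, generated X x -> X x.
Hypothesis GX : home_part Gamma `<=` X.

Local Notation U := (@home _ MM @` X).

Lemma home_imageE (y : elt MM) : U (home y) <-> X y.
Proof. by split=> [[z hz /home_inj <-]|h] //; exists y. Qed.

Lemma trace_setA : Apart U = setA X.
Proof. by apply/seteqP; split=> x; [move/home_imageE|move=> h; apply/home_imageE]. Qed.

Lemma trace_setC : Cpart U = setC X.
Proof. by apply/seteqP; split=> x; [move/home_imageE|move=> h; apply/home_imageE]. Qed.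

Lemma home_coordinate (u : {u | U u}) :
  exists H : (forall y : {y | X y}, MM (tp_ctx y)) -> eqstr MM (tp_ctx u),
    erep H /\ H (hval (H := X)) = projT2 (sval u).
Proof.
case: u => u [y hy E]; case: u / E.
exists (fun e => e (exist (fun y => X y) y hy)); split=> //.
exact: (TFun_var (N := MM) (vs := tp_ctx (X := X)) (exist (fun y => X y) y hy)).
Qed.

Lemma nonforking_sequence :
  ~ type_forks (setA (home_part Gamma)) (tp (setA X) (setA (home_part Delta))) ->
  ~ type_forks (setC (home_part Gamma)) (tp (setC X) (setC (home_part Delta))) ->
  ~ type_forks Gamma (tp U Delta).
Proof.
move=> nfA nfC [q [[n [p [hp hpq]]] [m [d [hd hqd]]]]].
have GDh : home_part Gamma `<=` home_part Delta by move=> y /GD.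
have closedG := generated_home_part dclG.
have closedD := generated_home_part dclD.
have satG := @saturated_home_part _ MM _ _ dclD GDh satM.
have [H hH] := dchoice home_coordinate.
have hE u : erep (H u) by have [] := hH u.
pose th (x : forall y : {y | X y}, MM (tp_ctx y)) := forall k, psat (p k) (fun u => H u x).
have dth : DefG (home_part Delta) th.
  apply: DefG_all => k; have [hk _] := hp k; rewrite homeD in hk.
  have [f hf] := Def_dcl hk hE.
  by exists (sat f); split; [exact: Def_sat|move=> e; rewrite hf].
have hth : th (hval (H := X)).
  move=> k; have [_] := hp k; congr psat; apply: fext => u.
  by have [_ ->] := hH u.
have cov j := cover_sorts (pf_s (p := d j)).
have /dchoice[r /dchoice[ts /dchoice[F hF]]] := cov.
have /dchoice[c hc] : forall j, exists c, forall i, F j i c = pf_par (d j) i.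
  by move=> j; have [_ h] := hF j; exact: h.
pose Psi j x c := sat (pf_fm (d j)) (ejoin (fun u => H u x) (fun i => F j i c)).
have hB (j : 'I_m) : block Gamma (c j) (Psi j).
  pose vs := vjoin (tp_ctx (X := X)) (ts j).
  pose FF y := match y return (forall v, MM (vs v)) ->
      eqstr MM (vjoin (tp_ctx (X := U)) (pf_s (p := d j)) y) with
    | inl u => fun e => H u (fun y => e (inl y))
    | inr i => fun e => F j i (fun t => e (inr t)) end.
  have hFF y : erep (FF y).
    case: y => [u|i].
      exact: (erep_subst (ws := vs) (hE u) (fun y => TFun_var (N := MM) (vs := vs) (inl y))).
    have [h _] := hF j.
    exact: (erep_subst (ws := vs) (h i) (fun t => TFun_var (N := MM) (vs := vs) (inr t))).
  have := block_formula closedG satG acl_coset lift_coset closedX GX (c j)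
    (Def_imaginary (pf_fm (d j)) hFF).
  move/block_ext; apply=> x c'; rewrite /Psi.
  rewrite (_ : (fun y => FF y (ejoin x c')) = ejoin (N := eqstr MM) (fun u => H u x)
    (fun i => F j i c')) //.
  by apply: fext => -[].
have /dchoice[IA /dchoice[IC /dchoice[qA /dchoice[qC /dchoice[thj hthj]]]]] := hB.
(* The side conditions of the blocks are over Gamma and hold at U, so they can be added to the
   formula of the type before amalgamating. *)
have dth' : DefG (home_part Delta) (fun x => th x /\ forall j, thj j x).
  apply: DefG_and => //; apply: DefG_all => j; have [h _ _] := hthj j.
  exact: DefG_mono GDh h.
have [T [al [ga hT]]] := amalgamation closedD dth'.
have [t [hal hga]] : exists t,
    sat (al t) (ejoin (prA (hval (H := X))) (hval (H := setA (home_part Delta)))) /\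
    sat (ga t) (ejoin (prC (hval (H := X))) (hval (H := setC (home_part Delta)))).
  apply/hT; exists (prB (hval (H := X))); rewrite to_env_pr; split=> // j.
  by have [] := hthj j.
have [tA [htA tAE]] := @pform_DefG _ AA (setA (home_part Delta)) _ (tp_ctx (X := setA X))
  (fun x => sat (al t) (ejoin x (hval (H := setA (home_part Delta)))))
  (ex_intro _ _ (conj (Def_sat AA (al t)) (fun=> conj id id))).
have [tC [htC tCE]] := @pform_DefG _ CC (setC (home_part Delta)) _ (tp_ctx (X := setC X))
  (fun x => sat (ga t) (ejoin x (hval (H := setC (home_part Delta)))))
  (ex_intro _ _ (conj (Def_sat CC (ga t)) (fun=> conj id id))).
have pA : tp (setA X) (setA (home_part Delta)) tA.
  by split=> //; apply/tAE; rewrite prA_hval in hal.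
have pC : tp (setC X) (setC (home_part Delta)) tC.
  by split=> //; apply/tCE; rewrite prC_hval in hga.
(* The formulas listed by the blocks of all disjuncts [j] are avoided at once: the disjunct that
   will hold is not yet known. *)
have [xA [/tAE hxA ndA]] := nonforking_realized (T := {j : 'I_m & IA j})
  (fun y => qA (projT1 y) (projT2 y)) nfA pA.
have [xC [/tCE hxC ndC]] := nonforking_realized (T := {j : 'I_m & IC j})
  (fun y => qC (projT1 y) (projT2 y)) nfC pC.
have [xB [hx hxj]] : exists xB, th (to_env xA xB xC) /\ forall j, thj j (to_env xA xB xC).
  by apply/hT; exists t.
have [j hj] := hqd _ (hpq _ hx).
have [hF1 hF2] := hF j.
(* The disjunct that holds divides along a sequence of home tuples through [c j], with [k]
   inconsistent instances, whereas its block gives these instances a common solution. *)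
have [b [k [bI b0 bn]]] := divides_home satG (hval (H := X)) hE hF1 hF2 (hc j) (hd j).
have [_ _ hs] := hthj j.
have hj' : Psi j (to_env xA xB xC) (c j).
  by rewrite /Psi (_ : (fun i => F j i (c j)) = pf_par (d j)) //; apply: fext => i; exact: hc.
have hA i : psat (qA j i) (prA (to_env xA xB xC)) ->
    ~ divides (setA (home_part Gamma)) (qA j i).
  by rewrite prA_to_env; exact: ndA (existT _ j i).
have hC i : psat (qC j i) (prC (to_env xA xB xC)) ->
    ~ divides (setC (home_part Gamma)) (qC j i).
  by rewrite prC_to_env; exact: ndC (existT _ j i).
have [x hx'] := hs _ (hxj j) hj' hA hC b bI b0 k.
by apply: bn; exists x.
Qed.

End Nonforking.

End PureSequence.

Lemma generated_sub (L : lang) (N : str L) (X Y : set (elt N)) :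
  X `<=` generated Y -> generated X `<=` generated Y.
Proof. by move=> XY x; elim=> [y /XY//|f a _ IH]; exact: gen_fun. Qed.

Theorem corollary5p6p7 (L : lang) (A B C : abelian L)
    (iota : forall s, ab_car A s -> ab_car B s)
    (nu : forall s, ab_car B s -> ab_car C s)
    (Phi : set (ppform L))
    (As : expansion (xstr (quot_expansion A Phi)))
    (Cs : expansion (abstr C)) :
  pure_exact iota nu ->
  fundamental_system B Phi ->
  let M := Mstr iota nu As Cs in
  forall (Gamma Delta : set (elt (eqstr M))) (n : nat) (u : 'I_n -> elt M),
  Gamma `<=` Delta ->
  Gamma = dcl Gamma ->
  Delta = dcl Delta ->
  saturated_succ M Delta ->
  strongly_homogeneous_succ M Delta ->
  (* H1 *)
  (forall phi, Phi phi -> forall c : (forall i, ab_car C (pp_s (p := phi) i)),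
     acl Gamma (coset iota nu As Cs c) -> Gamma (coset iota nu As Cs c)) ->
  (* H2 *)
  Delta = dcl (home (N := M) @` parts Delta) ->
  (* H3 *)
  Gamma = dcl (home (N := M) @` parts Gamma) ->
  (forall phi, Phi phi -> forall c : (forall i, ab_car C (pp_s (p := phi) i)),
     Gamma (coset iota nu As Cs c) ->
     exists beta : forall i, ab_car B (pp_s (p := phi) i),
       (forall i, Bpart Gamma (@Elt _ (abstr B) _ (beta i))) /\
       ppmod c (fun i => nu _ (beta i))) ->
  let U := home (N := M) @` generated (range u `|` parts Gamma) in
  ~ type_forks Gamma (tp U Delta) <->
  ~ type_forks (Apart Gamma) (tp (Apart U) (Apart Delta)) /\
  ~ type_forks (Cpart Gamma) (tp (Cpart U) (Cpart Delta)).
Proof.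
move=> PE FS M Gamma Delta n u GD dclG dclD satM _ acl_coset homeD homeG lift_coset U.
rewrite parts_home in homeD; rewrite parts_home in homeG.
split=> [nf|[]].
  split=> h; apply: nf; first exact: type_forks_A PE FS _ dclG homeG _ _ h.
  exact: type_forks_C PE FS _ dclG homeG _ _ h.
rewrite /U parts_home trace_setA trace_setC.
apply: (nonforking_sequence PE FS GD dclG dclD homeD satM acl_coset lift_coset).
  by apply: generated_sub.
by move=> x hx; apply: gen_base; right.
Qed.
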